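(* Let $a_{-1},a_0,a_1,a_2,b,\delta\ge 0$, $\theta,\gamma>1$, $y_0>0$, and let $y(t)$ be the unique positive global solution of $$dy(t)=\big(a_{-1}y^{-1}(t)-a_0+a_1y(t)-a_2y^{\gamma}(t)\big)\,dt+b\,y^{\theta}(t)\,dB(t)+\delta y(t^-)\,dN(t),\qquad y(0)=y_0 .$$ For any $p\ge 2$, suppose that one of the following two conditions holds: (i) $2\theta<\gamma+1$; (ii) $2\theta=\gamma+1$ and $a_2>(p-1)b^2/2$. Then there is a constant $K_2$ such that $$\mathbb E\,y^p(t)\le \frac{y_0^p}{e^t}+K_2\qquad\text{for all } t>0 .$$
   Context: All processes are defined on a complete probability space $(\Omega,\mathcal F,\mathbb P)$ with a filtration $\{\mathcal F_t\}_{t\ge 0}$ satisfying the usual conditions. $B(t)$ is a scalar Brownian motion and $N(t)$ is a scalar Poisson process with jump intensity $\lambda$, and $y(t^-)=\lim_{s\to t^-}y(s)$.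
   Formalization: Condition (i) is stated with the additional requirement a_2 > 0; with a_2 = 0 the claim fails, e.g. a_{-1}=a_0=a_2=b=δ=0, a_1=1, θ=1.1, γ=2 gives y(t)=y_0 e^t, whose p-th moment is unbounded. *)

(* Defs.v *)
From HB Require Import structures.
From mathcomp Require Import all_boot all_order all_algebra.
From mathcomp Require Import all_classical all_reals all_analysis.
Set Implicit Arguments.
Unset Strict Implicit.
Unset Printing Implicit Defensive.
Import Order.TTheory GRing.Theory Num.Theory.
Import numFieldNormedType.Exports.
Local Open Scope classical_set_scope.
Local Open Scope ring_scope.

(* Processes are functions [R -> T -> R]; only times [0 <= t] are meaningful. *)

Section stochastic_calculus.
Context {R : realType} {d : measure_display} {T : measurableType d}.
Variable P : probability T R.

(* Measurability with respect to a sub-sigma-algebra [G], given as a plain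
   family of sets. *)
Definition measurable_wrt (G : set (set T)) (X : T -> R) : Prop :=
  forall U : set R, measurable U -> G (X @^-1` U).

Definition independent_of (G : set (set T)) (X : T -> R) : Prop :=
  forall (A : set T) (U : set R), G A -> measurable U ->
    P (A `&` X @^-1` U) = (P A * P (X @^-1` U))%E.

Record filtration (F : R -> set (set T)) : Prop := {
  filtration_sigma_algebra : forall t : R, 0 <= t -> sigma_algebra setT (F t) ;
  filtration_measurable : forall t : R, 0 <= t -> F t `<=` measurable ;
  filtration_nondecreasing : forall s t : R, 0 <= s -> s <= t -> F s `<=` F t }.

Record usual_conditions (F : R -> set (set T)) : Prop := {
  usual_complete : forall A : set T, P.-negligible A -> F 0 A ;
  usual_right_continuous : forall t : R, 0 <= t ->
    \bigcap_(s in [set s | t < s]) F s `<=` F t }.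

Definition adapted (F : R -> set (set T)) (X : R -> T -> R) : Prop :=
  forall t : R, 0 <= t -> measurable_wrt (F t) (X t).

Definition right_continuous_path (f : R -> R) : Prop :=
  forall t : R, 0 <= t -> f s @[s --> t^'+] --> f t.

Definition cadlag (f : R -> R) : Prop :=
  right_continuous_path f /\ forall t : R, 0 < t -> cvg (f s @[s --> t^'-]).

Definition left_limit (f : R -> R) (t : R) : R := lim (f s @[s --> t^'-]).

(* The second parameter of [normal_prob] is the standard deviation. *)
Record brownian_motion (F : R -> set (set T)) (B : R -> T -> R) : Prop := {
  brownian_adapted : adapted F B ;
  brownian_start : \forall w \ae P, B 0 w = 0 ;
  brownian_continuous :
    \forall w \ae P, {within `[0, +oo[, continuous (B^~ w)} ;
  brownian_law : forall (s t : R) (U : set R), 0 <= s -> s < t -> measurable U ->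
    P [set w | U (B t w - B s w)] = normal_prob 0 (Num.sqrt (t - s)) U ;
  brownian_independent : forall s t : R, 0 <= s -> s < t ->
    independent_of (F s) (fun w => B t w - B s w) }.

Definition real_process (N : R -> T -> nat) : R -> T -> R :=
  fun t w => (N t w)%:R.

Record poisson_process (F : R -> set (set T)) (lambda : R) (N : R -> T -> nat)
    : Prop := {
  poisson_adapted : adapted F (real_process N) ;
  poisson_start : \forall w \ae P, N 0 w = 0%N ;
  poisson_nondecreasing : \forall w \ae P,
    forall s t : R, 0 <= s -> s <= t -> (N s w <= N t w)%N ;
  poisson_right_continuous : \forall w \ae P,
    right_continuous_path (real_process N ^~ w) ;
  poisson_law : forall (s t : R) (k : nat), 0 <= s -> s < t ->
    P [set w | N t w = (N s w + k)%N]
    = (poisson_pmf (lambda * (t - s)) k)%:E ;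
  poisson_independent : forall s t : R, 0 <= s -> s < t ->
    independent_of (F s) (fun w => real_process N t w - real_process N s w) }.

(* The Stieltjes integral of [f] over ]0, t] against a counting path [n], i.e.
   the sum of [f] over the jump times weighted by the jumps. The support of
   the sum is finite when [n] is nat-valued, nondecreasing and
   right-continuous. *)
Definition jump_integral (f n : R -> R) (t : R) : R :=
  \sum_(s \in `]0, t]) (f s * (n s - left_limit n s)).

(* sum_(i < n) xi_i 1_(]t_i, t_(i+1)]) with xi_i bounded and
   F_(t_i)-measurable. *)
Record simple_process (F : R -> set (set T)) := {
  simple_size : nat ;
  simple_time : nat -> R ;
  simple_coef : nat -> T -> R ;
  simple_time_ge0 : 0 <= simple_time 0%N ;
  simple_time_nondecreasing : {homo simple_time : i j / (i <= j)%N >-> i <= j} ;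
  simple_coef_measurable :
    forall i, measurable_wrt (F (simple_time i)) (simple_coef i) ;
  simple_coef_bounded :
    forall i, exists M : R, forall w, `|simple_coef i w| <= M }.

Definition simple_value F (X : simple_process F) : R -> T -> R := fun s w =>
  \sum_(i < simple_size X)
    simple_coef X i w * \1_(`]simple_time X i, simple_time X i.+1]) s.

Definition simple_integral F (X : simple_process F) (B : R -> T -> R)
    : R -> T -> R := fun t w =>
  \sum_(i < simple_size X) simple_coef X i w *
    (B (Num.min (simple_time X i.+1) t) w - B (Num.min (simple_time X i) t) w).

(* Convergence to 0 in probability of nonnegative variables; measurability of
   the events is required since [P] is unspecified on other sets. *)
Definition cvg0_in_probability (Z : nat -> T -> \bar R) : Prop :=
  forall e : R, 0 < e ->
    (forall n, measurable [set w | (e%:E <= Z n w)%E]) /\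
    P [set w | (e%:E <= Z n w)%E] @[n --> \oo] --> 0%E.

(* [I] is the Ito integral of [H] against [B]: the continuous process which is
   the limit in probability of the integrals of simple processes [X n] such
   that int_0^t |X n - H|^2 ds --> 0 in probability. Existence of such [X]
   amounts to int_0^t |H|^2 ds < +oo almost surely for all t. *)
Definition ito_integral (F : R -> set (set T)) (B H I : R -> T -> R) : Prop :=
  (\forall w \ae P, {within `[0, +oo[, continuous (I^~ w)}) /\
  exists X : nat -> simple_process F, forall t : R, 0 <= t ->
    cvg0_in_probability (fun n w =>
      \int[lebesgue_measure]_(s in `[0%R, t])
        ((simple_value (X n) s w - H s w) ^+ 2)%:E)%E /\
    cvg0_in_probability (fun n w => `|simple_integral (X n) B t w - I t w|%:E).

(* [y] is a global strong solution, positive at all times, of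
   dy(t) = f(y(t)) dt + g(y(t)) dB(t) + h(y(t-)) dN(t),  y(0) = y0. *)
Record positive_global_solution (F : R -> set (set T)) (B : R -> T -> R)
    (N : R -> T -> nat) (f g h : R -> R) (y0 : R) (y : R -> T -> R) : Prop := {
  solution_adapted : adapted F y ;
  solution_cadlag : \forall w \ae P, cadlag (y^~ w) ;
  solution_positive : \forall w \ae P, forall t : R, 0 <= t -> 0 < y t w ;
  solution_start : \forall w \ae P, y 0 w = y0 ;
  solution_drift_integrable : \forall w \ae P, forall t : R, 0 <= t ->
    lebesgue_measure.-integrable `[0, t] (EFin \o (fun s => f (y s w))) ;
  solution_equation : exists I : R -> T -> R,
    ito_integral F B (fun s w => g (y s w)) I /\
    \forall w \ae P, forall t : R, 0 <= t ->
      y t w = y0 + Rintegral lebesgue_measure `[0, t] (fun s => f (y s w))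
                 + I t w
                 + jump_integral (fun s => h (left_limit (y^~ w) s))
                     (real_process N ^~ w) t }.

End stochastic_calculus.

(* Main.v *)
Require Import Defs.
From HB Require Import structures.
From mathcomp Require Import all_boot all_order all_algebra.
From mathcomp Require Import all_classical all_reals all_analysis.
From mathcomp Require Import measurable_realfun.
From mathcomp Require Import ring lra zify.
Set Implicit Arguments.
Unset Strict Implicit.
Unset Printing Implicit Defensive.
Import Order.TTheory GRing.Theory Num.Theory.
Import numFieldNormedType.Exports.
Local Open Scope classical_set_scope.
Local Open Scope ring_scope.

(** Along the solution consider the Euler scheme whose coefficients are frozen
    at the left end of each interval of a regular grid of [0, t]. Pathwise
    Riemann sums handle drift and jumps, and a Lenglart inequality compares the
    discrete martingale with the Ito integral, so the scheme stays uniformly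
    close to the solution with high probability. While both remain in a compact
    subset of (0, oo), a second-order Taylor expansion and the moments of the
    Gaussian and Poisson increments turn a pointwise bound [L phi <= K - phi]
    for a bounded C^2 function [phi >= 0] into
    [v_(i+1) <= (1 - D) v_i + (K + o(1)) D], whence
    [E phi(y_t) <= exp(-t) phi(y_0) + K]; no Ito formula is needed.
    This is applied to [phi(x) = x^p (1 + eps x^(gamma-1))^(-p/(gamma-1))],
    for which [K] does not depend on small [eps], and [eps] tends to 0. *)

(** * Exponential estimates *)

(** Two obstacles shape the proof. The Ito integral is only known as the limit of some sequence of
    simple integrals, so the convergence of left-endpoint sums has to be proved. And the Brownian
    and Poisson increments are each independent of the past, but nothing is known of their joint
    law. Hence the one-step bound is a sum of terms that each contain one of the two increments
    alone: mixed effects go into a small multiple of the indicator of one jump, and rare large moves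
    into a multiple of [W ^+ 4] plus the indicator of two or more jumps, both of expectation of
    order [D ^+ 2]. Once this factor is pulled out, the generator bound is an inequality between
    powers of [x], ruled by the drift term of exponent [p + q]. *)

Section normal_moments.
Context {R : realType}.

Lemma expR_ge1Dxx2 (x : R) : 0 <= x -> 1 + x + x ^+ 2 / 2 <= expR x.
Proof.
move=> x0.
have nd : nondecreasing_seq (series (exp_coeff x)).
  by apply/nondecreasing_series => n _ _; exact: exp_coeff_ge0.
have := nondecreasing_cvgn_le nd (is_cvg_series_exp_coeff x) 3%N.
rewrite !seriesSr [series _ 0%N]big_geq// /exp_coeff/=.
by rewrite expr0 divr1 expr1 divr1 add0r.
Qed.

Lemma expR_sub1_le (x : R) : expR x - 1 <= x * expR x.
Proof.
have h := expR_ge1Dx (- x); have e0 := expR_gt0 x.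
have : (1 - x) * expR x <= expR (- x) * expR x by rewrite ler_pM2r.
by rewrite -expRD addNr expR0; lra.
Qed.

Lemma expR_taylor1_le (x : R) : expR x - 1 - x <= x ^+ 2 * expR `|x|.
Proof.
have h := expR_sub1_le x.
have [x0|x0] := leP 0 x.
  rewrite ger0_norm//.
  have : x * (expR x - 1) <= x * (x * expR x) by rewrite ler_wpM2l.
  by rewrite expr2; lra.
rewrite ltr0_norm//.
have h2 := expR_ge1Dx x.
have h3 : 1 <= expR (- x) by rewrite -expR0 ler_expR; lra.
have h4 : 0 <= (- x) * (expR x - 1 - x) by rewrite mulr_ge0; lra.
have : x ^+ 2 * 1 <= x ^+ 2 * expR (- x) by rewrite ler_wpM2l ?sqr_ge0.
by rewrite expr2; lra.
Qed.

(** The right side is the square of [expR (x / 2) - expR (- (x / 2))]. With [y = x / 2], the bounds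
    [1 + y + y^2/2] below the first exponential and [1 - y + y^2/2] above the second, whose product
    is [1 + y^4/4], show that the difference is at least [2 y]. *)
Lemma cosh_ge (x : R) : x ^+ 2 <= expR x + expR (- x) - 2.
Proof.
wlog x0 : x / 0 <= x.
  move=> h; have [/h//|/ltW x0] := leP 0 x.
  by have := h (- x); rewrite opprK sqrrN [expR (-x) + _]addrC; apply; lra.
set e := expR (x / 2); have e0 : 0 < e := expR_gt0 _.
have h := @expR_ge1Dxx2 (x / 2) (ltac:(lra)).
have e1 : e * expR (- (x / 2)) = 1 by rewrite /e expRxMexpNx_1.
have -> : expR x = e ^+ 2.
  by rewrite /e expr2 -expRD; congr expR; lra.
have -> : expR (- x) = expR (- (x / 2)) ^+ 2.
  by rewrite expr2 -expRD; congr expR; lra.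
rewrite -/e in h; set f := expR (- (x / 2)) in e1 *.
have f0 : 0 < f := expR_gt0 _.
have h2 : f <= 1 - x / 2 + (x / 2) ^+ 2 / 2.
  rewrite -(ler_pM2l e0) e1.
  set y := x / 2 in h *.
  have y0 : 0 <= y by rewrite /y; lra.
  have : (1 + y + y ^+ 2 / 2) * (1 - y + y ^+ 2 / 2) <= e * (1 - y + y ^+ 2 / 2).
    by rewrite ler_pM2r//; nra.
  by apply: le_trans; have := sqr_ge0 (y ^+ 2); nra.
have : x <= e - f by lra.
move=> h3; have : x ^+ 2 <= (e - f) ^+ 2 by rewrite ler_sqr ?nnegrE //; lra.
by nra.
Qed.

Lemma cosh_le (x : R) : expR x + expR (- x) - 2 <= x ^+ 2 + `|x| ^+ 3 * expR `|x|.
Proof.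
wlog x0 : x / 0 <= x.
  move=> h; have [/h//|/ltW x0] := leP 0 x.
  by have := h (- x); rewrite opprK normrN sqrrN [expR (-x) + _]addrC; apply; lra.
rewrite ger0_norm//.
set e := expR (x / 2); set f := expR (- (x / 2)).
have e0 : 0 < e := expR_gt0 _.
have f0 : 0 < f := expR_gt0 _.
have e1 : e * f = 1 by rewrite /e expRxMexpNx_1.
have xe : expR x = e ^+ 2 by rewrite /e expr2 -expRD; congr expR; lra.
have xf : expR (- x) = f ^+ 2 by rewrite expr2 -expRD; congr expR; lra.
have h1 : e - f <= x * e.
  have := expR_sub1_le x; rewrite xe => h.
  have : f * (e ^+ 2 - 1) <= f * (x * e ^+ 2) by rewrite ler_pM2l.
  have -> : f * (e ^+ 2 - 1) = (e * f) * e - f by ring.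
  have -> : f * (x * e ^+ 2) = x * ((e * f) * e) by ring.
  by rewrite e1 !mul1r.
have h0 : 0 <= e - f.
  by rewrite subr_ge0 /e /f ler_expR; lra.
have : (e - f) ^+ 2 <= (x * e) ^+ 2 by rewrite ler_sqr ?nnegrE//; nra.
have -> : (e - f) ^+ 2 = expR x + expR (- x) - 2.
  by rewrite xe xf sqrrB e1; ring.
move=> h; apply: (le_trans h).
rewrite exprMn -xe.
have := expR_sub1_le x => h2.
have : x ^+ 2 * (expR x - 1) <= x ^+ 2 * (x * expR x) by rewrite ler_wpM2l ?sqr_ge0.
have -> : x ^+ 3 = x ^+ 2 * x by ring.
lra.
Qed.

Lemma exprn_le_expR (n : nat) (x : R) : 0 <= x -> x ^+ n.+1 <= n.+1`!%:R * expR x.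
Proof.
move=> x0; have := expR_ge1Dxn n x0 => h.
have f0 : 0 < (n.+1)`!%:R :> R by rewrite ltr0n fact_gt0.
rewrite mulrC -ler_pdivrMr//; lra.
Qed.

Lemma expR_norm_le (x : R) : expR `|x| <= expR x + expR (- x).
Proof.
have := expR_ge0 x; have := expR_ge0 (- x).
by have [x0|x0] := leP 0 x; [rewrite ger0_norm | rewrite ltr0_norm]; lra.
Qed.

Lemma expR_weight (n : nat) (x : R) : 0 <= x ->
  x ^+ n.+1 * expR x <= n.+1`!%:R * expR (2 * x).
Proof.
move=> x0; have -> : expR (2 * x) = expR x * expR x by rewrite -expRD; congr expR; ring.
by rewrite mulrA ler_pM2r ?expR_gt0 ?exprn_le_expR.
Qed.

(** This form of letting [u] tend to 0 serves both to read off Taylor coefficients and to remove the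
    final error terms. *)
Lemma le_of_small (a b c : R) :
  (forall u, 0 < u <= 1 -> a <= b + c * u) -> a <= b.
Proof.
move=> h; apply/ler_addgt0Pr => e e0.
pose u := Num.min 1 (e / (`|c| + 1)).
have c0 : 0 < `|c| + 1 by rewrite ltr_pwDr.
have u0 : 0 < u by rewrite lt_min ltr01 divr_gt0.
have u1 : u <= e / (`|c| + 1) by rewrite ge_min lexx orbT.
apply: (le_trans (h u _)); first by rewrite u0 ge_min lexx.
rewrite lerD2l; apply: (@le_trans _ _ ((`|c| + 1) * u)).
  by rewrite ler_pM2r//; have := ler_norm c; lra.
by rewrite mulrC -ler_pdivlMr.
Qed.

Lemma integral_normal_expR (s u : R) : 0 < s ->
  (\int[normal_prob 0%R s]_x (expR (u * x))%:E)%E = (expR (u ^+ 2 * s ^+ 2 / 2))%:E.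
Proof.
move=> s0.
have sn0 : s != 0 by rewrite gt_eqF.
have me : measurable_fun setT (fun x : R => (expR (u * x))%:E).
  by apply/measurable_EFinP; apply: measurableT_comp.
rewrite -(Radon_Nikodym_SigmaFinite.change_of_variables
  (normal_prob_dominates 0 s))//.
(* The density of the normal law is first an abstract Radon-Nikodym derivative; it agrees almost
   everywhere with the explicit one because both have the same integrals over measurable sets.
   Completing the square then shifts the mean to [u * s ^+ 2]. *)
set g := Radon_Nikodym_SigmaFinite.f _ _.
have gE : ae_eq lebesgue_measure setT g (fun x => (normal_pdf 0 s x)%:E).
  apply: integral_ae_eq => //.
  - exact: Radon_Nikodym_SigmaFinite.f_integrable (normal_prob_dominates 0 s).
  - by apply/measurable_EFinP; exact: measurable_normal_pdf.
  - move=> E _ mE.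
    by rewrite -(Radon_Nikodym_SigmaFinite.f_integral (normal_prob_dominates 0 s)).
rewrite (@ae_eq_integral _ _ _ lebesgue_measure setT (fun x => (expR (u ^+ 2 * s ^+ 2 / 2) *
   normal_pdf (u * s ^+ 2) s x)%:E))//; last 3 first.
- apply: emeasurable_funM => //.
  apply: (measurable_int lebesgue_measure).
  exact: Radon_Nikodym_SigmaFinite.f_integrable (normal_prob_dominates 0 s).
- apply/measurable_EFinP; apply: measurable_funM => //; exact: measurable_normal_pdf.
- apply: filterS gE => x /= h _; rewrite h// -EFinM; congr EFin.
  rewrite !normal_pdfE// /normal_fun mulrCA -!expRD [RHS]mulrCA -expRD; congr (_ * expR _).
  by field.
under eq_integral do rewrite EFinM.
rewrite ge0_integralZl//; last 2 first.
- by apply/measurable_EFinP; exact: measurable_normal_pdf.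
- by move=> x _; rewrite lee_fin normal_pdf_ge0.
by rewrite integral_normal_pdf mule1.
Qed.
End normal_moments.

(** * Expectations and Gaussian moments *)

Section probability_toolbox.
Context {R : realType} {d : measure_display} {T : measurableType d}.
Variable P : probability T R.

Lemma bounded_integrable (X : T -> R) (M : R) : measurable_fun setT X ->
  (forall w, `|X w| <= M) -> P.-integrable setT (EFin \o X).
Proof.
move=> mX bX; apply: measurable_bounded_integrable => //.
  by rewrite ltey_eq fin_num_measure.
exists M; split; first exact: num_real.
by move=> N MN w _ /=; rewrite (le_trans (bX w)) ?ltW.
Qed.

Lemma measurable_fun_pair2 (X Z : T -> R) : measurable_fun setT X ->
  measurable_fun setT Z -> measurable_fun setT (fun w => (X w, Z w)).
Proof. by move=> mX mZ; exact: measurable_fun_pair. Qed.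

(** Independence says that the law of the pair and the product of the laws agree on rectangles,
    hence everywhere. Tonelli gives integrability of the product and Fubini its value. *)
Lemma independent_integralM (X Z : T -> R) :
  P.-integrable setT (EFin \o X) -> P.-integrable setT (EFin \o Z) ->
  (forall U V : set R, measurable U -> measurable V ->
    P (X @^-1` U `&` Z @^-1` V) = (P (X @^-1` U) * P (Z @^-1` V))%E) ->
  P.-integrable setT (EFin \o (fun w => X w * Z w)) /\
  \int[P]_w (X w * Z w) = (\int[P]_w X w) * (\int[P]_w Z w).
Proof.
move=> iX iZ ind.
have mX : measurable_fun setT X by exact/measurable_EFinP/(measurable_int P).
have mZ : measurable_fun setT Z by exact/measurable_EFinP/(measurable_int P).
pose X' : {mfun T >-> R} := mfun_Sub (mem_set mX).
pose Z' : {mfun T >-> R} := mfun_Sub (mem_set mZ).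
have mXZ := measurable_fun_pair2 mX mZ.
pose XZ : {mfun T >-> (R * R)%type} := mfun_Sub (mem_set mXZ).
pose m1 : probability R R := distribution P X'.
pose m2 : probability R R := distribution P Z'.
pose m12 : probability (R * R)%type R := distribution P XZ.
have m12E (A : set (R * R)) : measurable A -> (m1 \x m2)%E A = m12 A.
  move=> mA; apply: (@product_measure_unique _ _ _ _ _ m1 m2 m12) => //.
have mM : measurable_fun setT (fun z : R * R => (z.1 * z.2)%:E).
  by apply/measurable_EFinP; exact: measurable_funM.
have ge0E (f g : R -> \bar R) : measurable_fun setT f -> measurable_fun setT g ->
    (forall x, 0 <= f x)%E -> (forall x, 0 <= g x)%E ->
    (\int[m1 \x m2]_z (f z.1 * g z.2) = \int[m1]_x f x * \int[m2]_x g x)%E.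
  move=> mf mg f0 g0; rewrite fubini_tonelli1/=; last 2 first.
  - by apply: emeasurable_funM; exact: measurableT_comp.
  - by move=> z; exact: mule_ge0.
  rewrite /fubini_F/=.
  under eq_integral => x _ do rewrite ge0_integralZl//.
  rewrite ge0_integralZr//; exact: integral_ge0.
have iX1 : m1.-integrable setT (EFin : R -> \bar R).
  by apply: integrable_pushforward => //.
have iZ2 : m2.-integrable setT (EFin : R -> \bar R).
  by apply: integrable_pushforward => //.
have i12 : (m1 \x m2)%E.-integrable setT (fun z : R * R => (z.1 * z.2)%:E).
  apply/integrableP; split => //.
  under eq_integral => z _ do rewrite abse_EFin normrM EFinM.
  rewrite (ge0E (fun x => `|x|%:E) (fun x => `|x|%:E))//; last 2 first.
  - by apply/measurable_EFinP; exact: normr_measurable.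
  - by apply/measurable_EFinP; exact: normr_measurable.
  have /integrableP[_ fX] := iX1; have /integrableP[_ fZ] := iZ2.
  by rewrite lte_mul_pinfty ?integral_ge0// ge0_fin_numE// integral_ge0.
have iXZ : P.-integrable setT (EFin \o (fun w => X w * Z w)).
  have /integrableP[_] := i12.
  rewrite (eq_measure_integral m12) => [|A mA _]; last exact: m12E.
  rewrite ge0_integral_pushforward//= => [fi|]; last first.
    by apply/measurable_EFinP; apply: measurableT_comp => //; exact/measurable_EFinP.
  apply/integrableP; split => //; first by apply/measurable_EFinP; exact: measurable_funM.
split => //.
have := integral12_prod_meas1 i12.
rewrite [RHS](eq_measure_integral m12) => [|A mA _]; last exact: m12E.
rewrite [RHS]integral_pushforward//= /fubini_F/=.
set c := (\int[m2]_x x%:E)%E.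
have cE : c = (\int[P]_w (Z w)%:E)%E by rewrite /c integral_pushforward.
have cf : c = (fine c)%:E by rewrite fineK// cE integrable_fin_num.
under eq_integral => x _ do (under eq_integral do rewrite EFinM; rewrite integralZl//= -/c cf).
rewrite integralZr//= integral_pushforward//= => h.
move: h; rewrite !preimage_setT => h.
by rewrite /Rintegral /= -h -cE fineM//= integrable_fin_num.
Qed.


Lemma integrable_le (X Y : T -> R) : measurable_fun setT X ->
  P.-integrable setT (EFin \o Y) -> (forall w, `|X w| <= Y w) ->
  P.-integrable setT (EFin \o X).
Proof.
move=> mX iY XY; apply: (le_integrable _ _ _ iY) => //; first exact/measurable_EFinP.
by move=> w _ /=; rewrite lee_fin (le_trans (XY w))// ler_norm.
Qed.

Lemma integrableDR (X Y : T -> R) : P.-integrable setT (EFin \o X) ->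
  P.-integrable setT (EFin \o Y) ->
  P.-integrable setT (EFin \o (fun w => X w + Y w)).
Proof. by move=> iX iY; have := integrableD measurableT iX iY. Qed.

Lemma integrableBR (X Y : T -> R) : P.-integrable setT (EFin \o X) ->
  P.-integrable setT (EFin \o Y) ->
  P.-integrable setT (EFin \o (fun w => X w - Y w)).
Proof. by move=> iX iY; have := integrableB measurableT iX iY. Qed.

Lemma integrableZR (X : T -> R) (k : R) : P.-integrable setT (EFin \o X) ->
  P.-integrable setT (EFin \o (fun w => k * X w)).
Proof. by move=> iX; have := integrableZl measurableT k iX. Qed.

Lemma integrable_cstR (M : R) : P.-integrable setT (EFin \o (fun=> M)).
Proof. exact: finite_measure_integrable_cst. Qed.

Lemma Rintegral_cst_prob (M : R) : \int[P]_w M = M.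
Proof. by rewrite Rintegral_cst// -[RHS]mulr1; congr (_ * _); exact: (congr1 fine (probability_setT P)). Qed.

Lemma expectDR (X Y : T -> R) : P.-integrable setT (EFin \o X) ->
  P.-integrable setT (EFin \o Y) ->
  \int[P]_w (X w + Y w) = \int[P]_w X w + \int[P]_w Y w.
Proof. exact: RintegralD. Qed.

Lemma expectBR (X Y : T -> R) : P.-integrable setT (EFin \o X) ->
  P.-integrable setT (EFin \o Y) ->
  \int[P]_w (X w - Y w) = \int[P]_w X w - \int[P]_w Y w.
Proof. exact: RintegralB. Qed.

Lemma expectZR (X : T -> R) (k : R) : P.-integrable setT (EFin \o X) ->
  \int[P]_w (k * X w) = k * \int[P]_w X w.
Proof. by move=> iX; exact: RintegralZl. Qed.

Lemma expect_leR (X Y : T -> R) : P.-integrable setT (EFin \o X) ->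
  P.-integrable setT (EFin \o Y) -> (forall w, X w <= Y w) ->
  \int[P]_w X w <= \int[P]_w Y w.
Proof. by move=> iX iY XY; exact: le_Rintegral. Qed.

End probability_toolbox.

Lemma ge0_integral_law d d' (T : measurableType d) (Y : measurableType d')
    (R : realType) (P : probability T R) (W : T -> Y)
    (nu : {measure set Y -> \bar R}) : measurable_fun setT W ->
  (forall U, measurable U -> P (W @^-1` U) = nu U) ->
  forall f : Y -> \bar R, measurable_fun setT f -> (forall y, (0 <= f y)%E) ->
  (\int[P]_w f (W w) = \int[nu]_y f y)%E.
Proof.
move=> mW law f mf f0.
pose W' : {mfun T >-> Y} := mfun_Sub (mem_set mW).
transitivity (\int[distribution P W']_y f y)%E.
  by rewrite ge0_integral_distribution.
by apply: eq_measure_integral => A mA _; rewrite -law.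
Qed.

Section gaussian_moments.
Context {R : realType} {d : measure_display} {T : measurableType d}.
Variables (P : probability T R) (W : T -> R) (s : R).
Hypothesis s0 : 0 < s.
Hypothesis mW : measurable_fun setT W.
Hypothesis law : forall U : set R, measurable U -> P (W @^-1` U) = normal_prob 0 s U.

(** Exponential moments are the only integrals computed against the normal law; mean, variance and
    fourth moment follow by comparing expansions in [u]. *)
Lemma gauss_expR (u : R) :
  P.-integrable setT (EFin \o (fun w => expR (u * W w))) /\
  \int[P]_w (expR (u * W w)) = expR (u ^+ 2 * s ^+ 2 / 2).
Proof.
have me : measurable_fun setT (fun x : R => expR (u * x)).
  by apply: measurableT_comp.
have mWu : measurable_fun setT (fun w => expR (u * W w)).
  exact: (measurableT_comp me mW).
have h : (\int[P]_w (expR (u * W w))%:E)%E = (expR (u ^+ 2 * s ^+ 2 / 2))%:E.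
  rewrite -(integral_normal_expR u s0).
  apply: (@ge0_integral_law _ _ _ (measurableTypeR R) _ P W _ mW _ (fun x => (expR (u * x))%:E)).
  - by move=> U mU; exact: law.
  - by apply/measurable_EFinP.
  - by move=> x; rewrite lee_fin expR_ge0.
split; last by rewrite /Rintegral h.
apply/integrableP; split; first exact/measurable_EFinP.
under eq_integral do rewrite /= ger0_norm ?expR_ge0//.
by rewrite /= h ltry.
Qed.

Let iE u := (gauss_expR u).1.
Let EE u := (gauss_expR u).2.

Let Y (u : R) w := expR (u * W w) + expR (- (u * W w)).

Lemma gauss_cosh (u : R) : P.-integrable setT (EFin \o Y u) /\
  \int[P]_w Y u w = 2 * expR (u ^+ 2 * s ^+ 2 / 2).
Proof.
have hY : Y u = (fun w => expR (u * W w) + expR (- u * W w)).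
  by apply/funext => w; rewrite /Y mulNr.
rewrite hY; split; first by apply: integrableDR; exact: iE.
rewrite (expectDR (iE _) (iE _)).
by rewrite !EE sqrrN; lra.
Qed.

Lemma gauss_integrableX (n : nat) : P.-integrable setT (EFin \o (fun w => W w ^+ n)).
Proof.
case: n => [|n].
  exact: integrable_cstR.
apply: (integrable_le _ (integrableZR (n.+1`!%:R) (gauss_cosh 1).1)).
  exact: measurable_funX.
move=> w; rewrite normrX; apply: (le_trans (exprn_le_expR n (normr_ge0 _))).
by rewrite ler_wpM2l// /Y mul1r expR_norm_le.
Qed.

(** A Taylor remainder at [v * W] is thus a power of [v] times one integrable variable that does not
    depend on [v]. *)
Lemma weightY (n : nat) (v x : R) : `|v| <= 1 ->
  `|v * x| ^+ n.+1 * expR `|v * x| <=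
    n.+1`!%:R * `|v| ^+ n.+1 * (expR (2 * x) + expR (- (2 * x))).
Proof.
move=> v1; rewrite normrM exprMn -mulrA [_%:R * _]mulrC -[leRHS]mulrA.
rewrite -mulrA ler_wpM2l ?exprn_ge0// [leRHS]mulrC.
apply: (@le_trans _ _ (`|x| ^+ n.+1 * expR `|x|)).
  by rewrite ler_wpM2l ?exprn_ge0// ler_expR ler_piMl.
apply: (le_trans (expR_weight _ (normr_ge0 _))).
rewrite ler_wpM2l// -[2 * `|x|]ger0_norm ?mulr_ge0// normrM normr_id -normrM.
exact: expR_norm_le.
Qed.

Lemma gauss_mean : \int[P]_w W w = 0.
Proof.
have iW : P.-integrable setT (EFin \o W) := gauss_integrableX 1.
pose C := 2 * (2 * expR (2 ^+ 2 * s ^+ 2 / 2)).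
(* A linear function of [v] bounded below by a quadratic near 0 has slope 0: divide by [v] for both
   signs and let it tend to 0. *)
have key v : `|v| <= 1 -> - (C * v ^+ 2) <= v * \int[P]_w W w.
  move=> v1.
  have i1 := integrableZR v iW.
  have i2 := integrableBR (iE v) (integrable_cstR P 1).
  have E2 : \int[P]_w (expR (v * W w) - 1 - v * W w) =
      expR (v ^+ 2 * s ^+ 2 / 2) - 1 - v * \int[P]_w W w.
    by rewrite (expectBR i2 i1) (expectBR (iE v) (integrable_cstR P 1)) EE
      Rintegral_cst_prob (expectZR _ iW).
  have g1 : \int[P]_w (expR (v * W w) - 1 - v * W w) <= C * v ^+ 2.
    have -> : C * v ^+ 2 = \int[P]_w (2 * v ^+ 2 * Y 2 w).
      by rewrite (expectZR _ (gauss_cosh 2).1) (gauss_cosh 2).2 /C; ring.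
    apply: expect_leR; [exact: integrableBR|exact/integrableZR/(gauss_cosh 2).1|].
    move=> w; apply: (le_trans (expR_taylor1_le _)).
    by have := weightY 1 (W w) v1; rewrite !real_normK ?num_real.
  rewrite E2 in g1; have := expR_ge1Dx (v ^+ 2 * s ^+ 2 / 2).
  have : 0 <= v ^+ 2 * s ^+ 2 / 2 by rewrite divr_ge0// mulr_ge0 ?sqr_ge0.
  lra.
apply/eqP; rewrite eq_le; apply/andP; split.
  apply: (@le_of_small _ _ _ C) => u /andP[u0 u1].
  have := key (- u); rewrite normrN gtr0_norm// sqrrN => /(_ u1) h.
  rewrite -(ler_pM2l u0); move: h; rewrite expr2; lra.
apply: (@le_of_small _ _ _ C) => u /andP[u0 u1].
have := key u; rewrite gtr0_norm// => /(_ u1) h.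
rewrite -(ler_pM2l u0); move: h; rewrite expr2; lra.
Qed.

(** The expectation of [Y u - 2] is known exactly and lies between [u ^+ 2 * V] and the same plus a
    cubic error, by [cosh_ge] and [cosh_le]; dividing by [u ^+ 2] and letting [u] tend to 0
    identifies [V]. *)
Lemma gauss_var : \int[P]_w (W w ^+ 2) = s ^+ 2.
Proof.
have iW := gauss_integrableX 2.
set V := \int[P]_w _.
pose C := 2 * expR (2 ^+ 2 * s ^+ 2 / 2).
have i2 u := integrableBR (gauss_cosh u).1 (integrable_cstR P 2).
have E2 u : \int[P]_w (Y u w - 2) = 2 * (expR (u ^+ 2 * s ^+ 2 / 2) - 1).
  by rewrite (expectBR (gauss_cosh u).1 (integrable_cstR P 2)) (gauss_cosh u).2
     Rintegral_cst_prob; ring.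
have lo u : u ^+ 2 * V <= 2 * (expR (u ^+ 2 * s ^+ 2 / 2) - 1).
  rewrite -E2 /V -(expectZR _ iW); apply: expect_leR => //; first exact: integrableZR.
  by move=> w; have := cosh_ge (u * W w); rewrite exprMn.
have hi u : 0 < u <= 1 -> 2 * (expR (u ^+ 2 * s ^+ 2 / 2) - 1) <= u ^+ 2 * V + 6 * u ^+ 3 * C.
  move=> /andP[u0 u1].
  have i3 := integrableDR (integrableZR (u ^+ 2) iW)
     (integrableZR (6 * u ^+ 3) (gauss_cosh 2).1).
  rewrite -E2 /V -(expectZR _ iW) /C -(gauss_cosh 2).2 -(expectZR _ (gauss_cosh 2).1).
  rewrite -expectDR; [|exact: integrableZR|exact/integrableZR/(gauss_cosh 2).1].
  apply: expect_leR => // w; apply: (le_trans (cosh_le _)).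
  rewrite exprMn lerD2l.
  by have := weightY 2 (W w) (v := u); rewrite gtr0_norm// => /(_ u1).
apply/eqP; rewrite eq_le; apply/andP; split.
  apply: (@le_of_small _ _ _ (s ^+ 4 / 2 * expR (s ^+ 2 / 2))) => u /andP[u0 u1].
  have u20 : 0 < u ^+ 2 by rewrite exprn_gt0.
  rewrite -(ler_pM2l u20); apply: (le_trans (lo u)).
  set z := _ / 2; have zE : z = u ^+ 2 * s ^+ 2 / 2 by [].
  have z0 : 0 <= z by rewrite divr_ge0// mulr_ge0 ?sqr_ge0.
  have u21 : u ^+ 2 <= u by rewrite expr2 ler_piMl// ltW.
  have zs : z <= u * s ^+ 2 / 2.
    by rewrite ler_pM2r// ler_wpM2r ?sqr_ge0.
  have zs2 : z <= s ^+ 2 / 2.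
    by rewrite ler_pM2r// ler_piMl ?sqr_ge0// (le_trans u21).
  have : expR z <= expR (s ^+ 2 / 2) by rewrite ler_expR.
  set e := expR (s ^+ 2 / 2) => ez.
  have z1 := expR_sub1_le z.
  have z2 : expR z - 1 <= z + z * z * expR z.
    have := ler_wpM2l z0 z1; lra.
  have e0 : 0 <= e := expR_ge0 _.
  have ez0 : 0 <= expR z := expR_ge0 _.
  have z3 : z * z * expR z <= z * (u * s ^+ 2 / 2) * e.
    by apply: ler_pM => //; [exact: mulr_ge0|rewrite ler_wpM2l].
  have -> : u ^+ 2 * (s ^+ 2 + s ^+ 4 / 2 * e * u) = 2 * (z + z * (u * s ^+ 2 / 2) * e).
    by rewrite zE; field.
  by lra.
apply: (@le_of_small _ _ _ (6 * C)) => u u01.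
have /andP[u0 u1] := u01.
have u20 : 0 < u ^+ 2 by rewrite exprn_gt0.
rewrite -(ler_pM2l u20).
have := hi u u01; have := expR_ge1Dx (u ^+ 2 * s ^+ 2 / 2).
have -> : u ^+ 2 * (V + 6 * C * u) = u ^+ 2 * V + 6 * u ^+ 3 * C by ring.
lra.
Qed.

(** The constant is 4! from [x ^+ 4 <= 4! * expR |x|] at [x = W / s], times 2 for the two
    exponentials, times 2 bounding [expR (2^-1)]. *)
Lemma gauss_fourth : \int[P]_w (W w ^+ 4) <= 96 * (s ^+ 2) ^+ 2.
Proof.
have iW := gauss_integrableX 4.
have h : \int[P]_w (24^-1 * s^-1 ^+ 4 * W w ^+ 4) <= \int[P]_w Y (s^-1) w.
  apply: expect_leR; [exact: integrableZR|exact: (gauss_cosh _).1|] => w.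
  have := exprn_le_expR 3 (normr_ge0 (s^-1 * W w)).
  have e4 (r : R) : `|r| ^+ 4 = r ^+ 4 by rewrite -normrX ger0_norm// exprn_even_ge0.
  rewrite e4 exprMn => h1.
  have := expR_norm_le (s^-1 * W w); rewrite -/(Y _ _) => h2.
  have -> : 24^-1 * s^-1 ^+ 4 * W w ^+ 4 = 24^-1 * (s^-1 ^+ 4 * W w ^+ 4) by ring.
  move: h1; rewrite (_ : 4`!%:R = 24)//; lra.
move: h; rewrite (expectZR _ iW) (gauss_cosh _).2.
have -> : s^-1 ^+ 2 * s ^+ 2 / 2 = 2^-1 by rewrite -exprMn mulVf ?gt_eqF// expr1n mul1r.
have : expR (2^-1) <= 2 :> R.
  have h1 := expR_ge1Dx (- 2^-1 : R).
  have h2 := expRxMexpNx_1 (2^-1 : R); have h3 := expR_gt0 (2^-1 : R); nra.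
set e := expR _ => e2 h.
have s40 : 0 < s ^+ 4 by rewrite exprn_gt0.
have : s ^+ 4 * (24^-1 * s^-1 ^+ 4 * \int[P]_w W w ^+ 4) <= s ^+ 4 * (2 * e) by rewrite ler_pM2l.
have -> : s ^+ 4 * (24^-1 * s^-1 ^+ 4 * \int[P]_w W w ^+ 4) = 24^-1 * \int[P]_w W w ^+ 4.
  by field; rewrite gt_eqF.
have -> : s ^+ 2 ^+ 2 = s ^+ 4 by ring.
nra.
Qed.

End gaussian_moments.

(** * Taylor estimates for one step of the scheme *)

Section real_tools.
Context {R : realType}.

Lemma seq_lower_bound (T : eqType) (s : seq T) (g : T -> R) :
  (forall c, c \in s -> 0 < g c) ->
  exists2 r : R, 0 < r & forall c, c \in s -> r <= g c.
Proof.
elim: s => [_|c s ih h]; first by exists 1.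
have [|r r0 hr] := ih; first by move=> x xs; apply: h; rewrite inE xs orbT.
exists (Num.min r (g c)); first by rewrite lt_min r0 h// inE eqxx.
move=> x; rewrite inE => /predU1P[->|/hr]; first by rewrite ge_min lexx orbT.
by move=> h'; rewrite ge_min h'.
Qed.

(** A Lebesgue number: balls of half the radius cover by compactness, and the other half leaves room
    for a common [rho], so that [x] and all its [rho]-neighbours share one centre. *)
Lemma itv_cover (r : R -> R) (a b : R) : (forall x, a <= x <= b -> 0 < r x) ->
  exists s : seq R, (forall c, c \in s -> a <= c <= b) /\
    exists2 rho : R, 0 < rho & forall x, a <= x <= b ->
      exists2 c, c \in s & forall y, `|x - y| <= rho -> `|y - c| < r c.
Proof.
move=> r0.
have := @segment_compact R a b; rewrite compact_cover => /(_ _ [set x | a <= x <= b] (fun x => ball x (r x / 2))).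
case => [x xab|x|D Dab Dcov].
- by apply: ball_open; rewrite divr_gt0// r0.
- rewrite /= in_itv/= => xab; exists x => //.
  by apply: ballxx; rewrite divr_gt0// r0.
have sab c : c \in finmap.enum_fset D -> a <= c <= b.
  by move=> cD; have := Dab c cD; rewrite inE.
have [|rho rho0 hrho] := @seq_lower_bound _ (finmap.enum_fset D) (fun c => r c / 2).
  by move=> c cD; rewrite divr_gt0// r0// sab.
exists (finmap.enum_fset D); split => //; exists (rho / 2); first by rewrite divr_gt0.
move=> x xab; have xI : `[a, b]%classic x by rewrite /= in_itv.
have [c /= cD xc] := Dcov x xI.
exists c => // y xy; have := hrho c cD.
have : `|c - x| < r c / 2 by [].
rewrite distrC => h1 h2.
have := ler_distD x y c; rewrite [`|y - x|]distrC.
lra.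
Qed.

Lemma unif_continuous_itv (u : R -> R) (a b e : R) : 0 < e ->
  (forall x, a <= x <= b -> {for x, continuous u}) ->
  exists2 r : R, 0 < r & forall x y, a <= x <= b -> a <= y <= b ->
    `|x - y| <= r -> `|u x - u y| <= e.
Proof.
move=> e0 cu.
have h1 x : exists r : R, a <= x <= b -> 0 < r /\ forall y, `|x - y| < r -> `|u x - u y| < e / 2.
  have [xab|] := boolP (a <= x <= b); last by exists 0.
  have /cvgrPdist_lt := cu x xab; move=> /(_ (e / 2)); rewrite divr_gt0// => /(_ isT).
  by move=> [r /= r0 hr]; exists r => _; split => // y xy; exact: hr.
have [r hr] := choice h1.
have [s [sab [rho rho0 scov]]] := itv_cover (fun x xab => (hr x xab).1).
exists rho => // x y xab yab xy.
have [c cs hc] := scov x xab.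
have [_ hc2] := hr c (sab c cs).
have hx := hc2 x; rewrite distrC in hx.
have hy := hc2 y; rewrite distrC in hy.
have {}hx := hx (hc x _); have {}hy := hy (hc y xy).
rewrite subrr normr0 ltW// in hx; have {}hx := hx isT.
have := ler_distD (u c) (u x) (u y); rewrite [`|u x - u c|]distrC.
lra.
Qed.

Lemma MVT_pt (f df : R -> R) (a b x z : R) :
  (forall y, a < y < b -> is_derive y 1 f (df y)) ->
  a < x < b -> a < x + z < b ->
  exists2 t, 0 <= t <= 1 & f (x + z) - f x = df (x + t * z) * z.
Proof.
move=> d /andP[ax xb] /andP[ay yb].
have cont p q : a < p -> q < b -> {within `[p, q], continuous f}.
  move=> ap qb; apply: derivable_within_continuous => y; rewrite in_itv/= => /andP[py yq].
  by have [] := d y; rewrite ?(lt_le_trans ap py) ?(le_lt_trans yq qb).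
have [z0|z0|->] := ltgtP z 0; last by exists 0; rewrite ?lexx ?ler01// !mulr0 addr0 subrr.
- have [|y yxz||c] := @MVT _ f df (x + z) x.
  + by rewrite gtrDl.
  + by apply: d; move: yxz; rewrite in_itv/= => /andP[h1 h2]; rewrite (lt_trans ay h1) (lt_trans h2 xb).
  + exact: cont.
  rewrite in_itv/= => /andP[c1 c2] h; exists ((c - x) / z).
    rewrite ler_ndivlMr// ler_ndivrMr//; apply/andP; split; lra.
  have -> : x + (c - x) / z * z = c by field; rewrite lt_eqF.
  have -> : f (x + z) - f x = - (f x - f (x + z)) by ring.
  by rewrite h; ring.
- have [|y yxz||c] := @MVT _ f df x (x + z).
  + by rewrite ltrDl.
  + by apply: d; move: yxz; rewrite in_itv/= => /andP[h1 h2]; rewrite (lt_trans ax h1) (lt_trans h2 yb).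
  + exact: cont.
  rewrite in_itv/= => /andP[c1 c2] h; exists ((c - x) / z).
    rewrite ler_pdivlMr// ler_pdivrMr//; apply/andP; split; lra.
  have -> : x + (c - x) / z * z = c by field; rewrite gt_eqF.
  by rewrite h; ring.
Qed.

Lemma between_itv (a b x z t : R) : 0 <= t <= 1 -> a < x < b -> a < x + z < b ->
  a < x + t * z < b.
Proof.
move=> /andP[t0 t1] /andP[ax xb] /andP[az zb].
have [z0|z0] := leP 0 z.
  have : 0 <= t * z by exact: mulr_ge0.
  have : t * z <= z by rewrite ler_piMl.
  by move=> h1 h2; apply/andP; split; lra.
have : t * z <= 0 by rewrite mulr_ge0_le0// ltW.
have : z <= t * z by rewrite ler_niMl// ltW.
by move=> h1 h2; apply/andP; split; lra.
Qed.

(** The mean value theorem is applied to the remainder [Rt] as a function of the end point, then to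
    [u1]. Only the modulus of continuity of [u2] enters, so no third derivative is required. *)
Lemma taylor2 (u u1 u2 : R -> R) (a b e r : R) :
  (forall x, a < x < b -> is_derive x 1 u (u1 x)) ->
  (forall x, a < x < b -> is_derive x 1 u1 (u2 x)) ->
  (forall x y, a < x < b -> a < y < b -> `|x - y| <= r -> `|u2 x - u2 y| <= e) ->
  forall x z, a < x < b -> a < x + z < b -> `|z| <= r ->
  `|u (x + z) - u x - u1 x * z - u2 x * z ^+ 2 / 2| <= e * z ^+ 2.
Proof.
move=> du du1 hu2 x z xab xzab zr.
pose Rt y := u y - u1 x * (y - x) - u2 x / 2 * (y - x) ^+ 2.
pose dRt y := u1 y - u1 x - u2 x * (y - x).
have dR y : a < y < b -> is_derive y 1 Rt (dRt y).
  move=> yab; have := du y yab => ?.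
  apply: is_derive_eq; rewrite /GRing.scale/=.
  rewrite /dRt; lra.
have [t t01 h] := MVT_pt dR xab xzab.
have xtab := between_itv t01 xab xzab.
have [t' t01' h'] := MVT_pt du1 xab xtab.
have xtab' := between_itv t01' xab xtab.
have /andP[t0 t1] := t01; have /andP[t0' t1'] := t01'.
have tz : `|t * z| <= `|z| by rewrite normrM (ger0_norm t0) ler_piMl.
have ttz : `|t' * (t * z)| <= `|z|.
  by apply: le_trans tz; rewrite [leLHS]normrM (ger0_norm t0') ler_piMl.
have h2 := hu2 (x + t' * (t * z)) x xtab' xab.
rewrite [x + _]addrC addrK in h2.
have -> : u (x + z) - u x - u1 x * z - u2 x * z ^+ 2 / 2 = Rt (x + z) - Rt x.
  by rewrite /Rt; ring.
rewrite h /dRt h'.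
have -> : x + t * z - x = t * z by ring.
have -> : (u2 (x + t' * (t * z)) * (t * z) - u2 x * (t * z)) * z =
   (u2 (t' * (t * z) + x) - u2 x) * ((t * z) * z) by rewrite [t' * _ + _]addrC; ring.
rewrite normrM; apply: ler_pM => //; first exact: (h2 (le_trans ttz zr)).
have -> : z ^+ 2 = `|z| * `|z| by rewrite -normrM -expr2 ger0_norm ?sqr_ge0.
by rewrite normrM ler_wpM2r.
Qed.

Lemma bounded_itv (u : R -> R) (a b : R) :
  (forall x, a <= x <= b -> {for x, continuous u}) ->
  exists2 M : R, 0 < M & forall x, a <= x <= b -> `|u x| <= M.
Proof.
move=> cu; have [ab|ba] := leP a b; last first.
  by exists 1 => // x /andP[h1 h2]; have := le_trans h1 h2; rewrite leNgt ba.
have cw : {within `[a, b], continuous (fun x => `|u x|)}.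
  apply: continuous_in_subspaceT => x; rewrite inE/= in_itv/= => xab.
  by apply: continuous_comp; [exact: cu|exact: norm_continuous].
have [c _ hc] := EVT_max ab cw.
exists (`|u c| + 1); first by rewrite ltr_pwDr.
by move=> x xab; rewrite (le_trans (hc x _)) ?in_itv//= lerDl.
Qed.

Lemma le_sqr_1D4 (w : R) : `|w| <= 1 + w ^+ 4 /\ w ^+ 2 <= 1 + w ^+ 4.
Proof.
have -> : w ^+ 4 = (w ^+ 2) ^+ 2 by ring.
have h : w ^+ 2 <= 1 + w ^+ 2 ^+ 2 by have := sqr_ge0 (w ^+ 2 - 1); rewrite sqrrB1; have := sqr_ge0 w; lra.
split => //; have : 0 <= `|w| by []. have <- : `|w| ^+ 2 = w ^+ 2 by rewrite real_normK ?num_real.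
by set v := `|w| => v0; have := sqr_ge0 (v - 1); have := sqr_ge0 (v ^+ 2 - 1);  nra.
Qed.

Lemma is_derive_continuous (f df : R -> R) (x : R) :
  is_derive x 1 f (df x) -> {for x, continuous f}.
Proof. by case=> d _; apply: differentiable_continuous; exact/derivable1_diffP. Qed.

Lemma coef_bounds (K p1 p2 a be D W : R) : 0 <= K -> 0 <= D ->
  `|p1| <= K -> `|p2| <= K -> `|a| <= K -> `|be| <= K ->
  [/\ `|p1 * a * D| <= K ^+ 2 * D, `|p1 * be * W| <= K ^+ 2 * `|W| &
   `|p2 * be ^+ 2 / 2 * W ^+ 2| <= K ^+ 3 / 2 * W ^+ 2].
Proof.
move=> K0 D0 p1K p2K aK beK.
have KK (u w : R) : `|u| <= K -> `|w| <= K -> `|u * w| <= K ^+ 2.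
  by move=> uK wK; rewrite normrM expr2 ler_pM.
split; first by rewrite normrM (ger0_norm D0) ler_wpM2r ?KK.
  by rewrite normrM ler_wpM2r ?KK.
rewrite normrM [`|W ^+ 2|]ger0_norm ?sqr_ge0// ler_wpM2r ?sqr_ge0//.
rewrite normrM [`|2^-1|]gtr0_norm// ler_pM2r// exprS normrM ler_pM//.
by rewrite -[K * K]expr2 KK.
Qed.

(** A Markov-type charge: when [|W|] exceeds [h] or there are two jumps, [W ^+ 4 + [1 < n]] is at
    least [h ^+ 4], so its multiple by [1 + h ^- 4] pays for everything bounded or of order at most
    [1 + W ^+ 4]. *)
Lemma step_large (M K h p1 p2 a be D W : R) (n : nat) : 0 <= M -> 1 <= K -> 0 < h <= 1 ->
  0 <= D <= h -> `|p1| <= K -> `|p2| <= K -> `|a| <= K -> `|be| <= K ->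
  h < `|W| \/ (1 < n)%N ->
  M <= p1 * a * D + p1 * be * W + p2 * be ^+ 2 / 2 * W ^+ 2 - M +
    (2 * M + 2 * K ^+ 2 + K ^+ 3) * (1 + h ^- 4) * (W ^+ 4 + (1 < n)%N%:R).
Proof.
move=> M0 K1 /andP[h0 h1] /andP[D0 Dh] p1K p2K aK beK hWn.
have K0 : 0 <= K by exact: le_trans K1.
have [] := coef_bounds W K0 D0 p1K p2K aK beK.
set t1 := p1 * a * D; set t2 := p1 * be * W; set t3 := _ * W ^+ 2.
rewrite ![`|t1| <= _]ler_norml ![`|t2| <= _]ler_norml ![`|t3| <= _]ler_norml.
move=> /andP[T1l _] /andP[T2l _] /andP[T3l _].
have K20 : 0 <= K ^+ 2 by exact: exprn_ge0.
have K30 : 0 <= K ^+ 3 by exact: exprn_ge0.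
have W40 : 0 <= W ^+ 4 by exact: exprn_even_ge0.
have [w1 w2] := le_sqr_1D4 W.
have q5 : 1 + W ^+ 4 <= (1 + h ^- 4) * (W ^+ 4 + (1 < n)%N%:R).
  have h4 : 0 <= h ^- 4 by rewrite invr_ge0 exprn_ge0// ltW.
  have n0 : 0 <= (1 < n)%N%:R :> R by [].
  have hn0 : 0 <= h ^- 4 * (1 < n)%N%:R by exact: mulr_ge0.
  case: hWn => [Wh|->]; last first.
    have : 0 <= h ^- 4 * W ^+ 4 by exact: mulr_ge0.
    by have -> : true%:R = 1 :> R by []; clear -W40 h4; lra.
  suff : 1 <= h ^- 4 * W ^+ 4 by clear -W40 h4 hn0 n0; lra.
  have W2h : h ^+ 2 <= W ^+ 2.
    rewrite -[W ^+ 2]real_normK ?num_real// ler_sqr ?nnegrE ?normr_ge0//; exact: ltW.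
  rewrite mulrC ler_pdivlMr ?exprn_gt0// mul1r.
  have -> : h ^+ 4 = h ^+ 2 * h ^+ 2 by ring.
  have -> : W ^+ 4 = W ^+ 2 * W ^+ 2 by ring.
  by rewrite ler_pM ?sqr_ge0.
have q6 : K ^+ 2 * `|W| <= K ^+ 2 * (1 + W ^+ 4) by rewrite ler_wpM2l.
have q7 : K ^+ 3 / 2 * W ^+ 2 <= K ^+ 3 / 2 * (1 + W ^+ 4) by rewrite ler_wpM2l// divr_ge0.
have q8 : K ^+ 2 * D <= K ^+ 2 by rewrite ler_piMr// (le_trans Dh).
pose Q := 2 * M + 2 * K ^+ 2 + K ^+ 3.
have Q0 : 0 <= Q by rewrite /Q; clear -M0 K20 K30; lra.
have := ler_wpM2l Q0 q5; rewrite mulrA -/Q.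
have -> : Q * (1 + W ^+ 4) = 2 * M + 2 * K ^+ 2 + K ^+ 3 + 2 * (M * W ^+ 4) +
    2 * (K ^+ 2 * W ^+ 4) + K ^+ 3 * W ^+ 4 by rewrite /Q; ring.
have q9 : 0 <= M * W ^+ 4 by exact: mulr_ge0.
have q10 : 0 <= K ^+ 2 * W ^+ 4 by exact: mulr_ge0.
have q11 : 0 <= K ^+ 3 * W ^+ 4 by exact: mulr_ge0.
move: (Q * _ * _) => X.
clear -T1l T2l T3l q6 q7 q8 q9 q10 q11 M0 K20 K30.
move: t1 t2 t3 T1l T2l T3l => t1 t2 t3 T1l T2l T3l; lra.
Qed.

(** The modulus [e / (4 * K ^+ 2)] meets [z ^+ 2 <= 2 * K ^+ 2 * (D + W ^+ 2)] and costs half of the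
    slack. The terms of the expanded square other than [W ^+ 2] carry a factor [h * D], and the
    constant 10 makes them at most [3 / 20 * (e * D)]. *)
Lemma step_nojump (phi phi1 phi2 : R -> R) (K h r c c' e x a be D W : R) :
  (forall x : R, 0 < x -> is_derive x 1 phi (phi1 x)) ->
  (forall x : R, 0 < x -> is_derive x 1 phi1 (phi2 x)) ->
  1 <= K -> 0 < e ->
  0 <= D <= h -> `|a| <= K -> `|be| <= K -> `|phi2 x| <= K ->
  (forall y, c < y < c' -> 0 < y) -> c < x < c' ->
  c < x + (a * D + be * W) < c' -> `|a * D + be * W| <= r -> `|W| <= h -> h <= 1 ->
  h * (10 * K ^+ 3) <= e ->
  (forall x y, c < x < c' -> c < y < c' -> `|x - y| <= r ->
    `|phi2 x - phi2 y| <= e / (4 * K ^+ 2)) ->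
  phi (x + (a * D + be * W)) - phi x <=
   phi1 x * a * D + phi1 x * be * W + phi2 x * be ^+ 2 / 2 * W ^+ 2
   + e * (D + W ^+ 2).
Proof.
move=> dphi dphi1 K1 e0 /andP[D0 Dh] aK beK p2K dpos xo xzo zr Wh h1 he hr.
have K0 : 0 <= K by exact: le_trans K1.
set z := a * D + be * W in xzo zr *.
have := @taylor2 phi phi1 phi2 c c' _ r (fun y hy => dphi _ (dpos y hy))
   (fun y hy => dphi1 _ (dpos y hy)) hr x z xo xzo zr.
set p1 := phi1 x; set p2 := phi2 x in p2K *; move/ler_normlW.
set t1 := p1 * a * D; set t2 := p1 * be * W; set t3 := _ * W ^+ 2.
have -> : p1 * z = t1 + t2 by rewrite /t1 /t2 /z; ring.
have -> : p2 * z ^+ 2 / 2 = t3 + p2 * (a * a) / 2 * (D * D) + p2 * (a * be) * W * D.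
  by rewrite /t3 /z; field.
set e2 := e / _.
have e20 : 0 < e2 by rewrite divr_gt0// mulr_gt0// exprn_gt0// (lt_le_trans _ K1).
have KK (u w : R) : `|u| <= K -> `|w| <= K -> `|u * w| <= K ^+ 2.
  by move=> uK wK; rewrite normrM expr2 ler_pM.
have K30 : 0 <= K ^+ 3 by exact: exprn_ge0.
have DD : D * D <= h * D by rewrite ler_wpM2r.
have b1 : p2 * (a * a) / 2 * (D * D) <= K ^+ 3 * (h * D) / 2.
  have -> : K ^+ 3 * (h * D) / 2 = K ^+ 3 / 2 * (h * D) by field.
  apply: (@le_trans _ _ (K ^+ 3 / 2 * (D * D))); last first.
    by rewrite ler_wpM2l// divr_ge0.
  rewrite ler_wpM2r ?mulr_ge0// ler_pM2r//.
  apply: (le_trans (ler_norm _)); rewrite exprS normrM ler_pM//; exact: KK.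
have b2 : p2 * (a * be) * W * D <= K ^+ 3 * (h * D).
  rewrite [K ^+ 3 * _]mulrA ler_wpM2r//.
  apply: (le_trans (ler_norm _)); rewrite normrM ler_pM//.
  by rewrite exprS normrM ler_pM// KK.
have b3 : 3 / 2 * (K ^+ 3 * (h * D)) <= 3 / 20 * (e * D).
  have := ler_wpM2r D0 he.
  have -> : h * (10 * K ^+ 3) * D = 10 * (K ^+ 3 * (h * D)) by ring.
  by clear -D; lra.
have b4 : e2 * z ^+ 2 <= e * D / 2 + e * W ^+ 2 / 2.
  have z2 : z ^+ 2 <= 2 * (K ^+ 2 * (D + W ^+ 2)).
    have s1 : (a * D) ^+ 2 <= K ^+ 2 * D.
      rewrite exprMn ler_pM ?sqr_ge0//.
        by rewrite -[a ^+ 2]real_normK ?num_real// ler_sqr ?nnegrE.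
      by rewrite expr2 (le_trans DD)// ler_piMl.
    have s2 : (be * W) ^+ 2 <= K ^+ 2 * W ^+ 2.
      rewrite exprMn ler_wpM2r ?sqr_ge0//.
      by rewrite -[be ^+ 2]real_normK ?num_real// ler_sqr ?nnegrE.
    have := sqr_ge0 (a * D - be * W); rewrite sqrrB => s3.
    rewrite /z sqrrD mulrDr; clear -s1 s2 s3; lra.
  apply: (le_trans (ler_wpM2l (ltW e20) z2)).
  rewrite le_eqVlt; apply/orP; left; apply/eqP; rewrite /e2; field.
  by rewrite gt_eqF// (lt_le_trans _ K1).
have eD : 0 <= e * D by rewrite mulr_ge0// ltW.
have eW : 0 <= e * W ^+ 2 by rewrite mulr_ge0 ?sqr_ge0// ltW.
have -> : e * (D + W ^+ 2) = e * D + e * W ^+ 2 by ring.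
move: b1 b2 b4; move: (_ / 2 * (D * D)) (_ * W * D) (e2 * _) t1 t2 t3 => X Y Z t1 t2 t3.
clear -b3 eD eW; lra.
Qed.

(** Here [y] is the position after the jump. The continuous move and the three Taylor terms are of
    order [h], hence below [e], which is charged to the indicator of one jump; this removes every
    product of Brownian and Poisson increments. *)
Lemma step_onejump (phi phi1 phi2 : R -> R) (K h c c' e x y a be D W : R) :
  (forall x : R, 0 < x -> is_derive x 1 phi (phi1 x)) ->
  1 <= K ->
  0 <= D <= h -> `|a| <= K -> `|be| <= K -> `|phi1 x| <= K -> `|phi2 x| <= K ->
  (forall y, c < y < c' -> 0 < y) ->  (forall y, c < y < c' -> `|phi1 y| <= K) ->
  c < y < c' -> c < y + (a * D + be * W) < c' -> `|W| <= h -> h <= 1 ->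
  h * (10 * K ^+ 3) <= e ->
  phi (y + (a * D + be * W)) - phi x <=
   phi1 x * a * D + phi1 x * be * W + phi2 x * be ^+ 2 / 2 * W ^+ 2
   + (phi y - phi x) + e.
Proof.
move=> dphi K1 /andP[D0 Dh] aK beK p1K p2K dpos p1b xo xzo Wh h1 he.
have K0 : 0 <= K by exact: le_trans K1.
have h0 : 0 <= h by exact: le_trans Dh.
set z := a * D + be * W in xzo *.
have zb : `|z| <= 2 * (K * h).
  apply: (le_trans (ler_normD _ _)); rewrite !normrM (ger0_norm D0).
  have : `|a| * D <= K * h by rewrite ler_pM.
  have : `|be| * `|W| <= K * h by rewrite ler_pM.
  by clear -D; lra.
have [] := coef_bounds W K0 D0 p1K p2K aK beK.
set t1 := _ * D; set t2 := _ * W; set t3 := _ * W ^+ 2.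
rewrite ![`|t1| <= _]ler_norml ![`|t2| <= _]ler_norml ![`|t3| <= _]ler_norml.
move=> /andP[T1l _] /andP[T2l _] /andP[T3l _].
have [t t01 ht] := MVT_pt (fun y hy => dphi _ (dpos y hy)) xo xzo.
have L1z : phi (y + z) - phi y <= 2 * (K ^+ 2 * h).
  have -> : 2 * (K ^+ 2 * h) = K * (2 * (K * h)) by ring.
  rewrite ht; apply: (le_trans (ler_norm _)); rewrite normrM ler_pM//.
  by apply: p1b; exact: between_itv.
have K20 : 0 <= K ^+ 2 by exact: exprn_ge0.
have K30 : 0 <= K ^+ 3 by exact: exprn_ge0.
have K23 : K ^+ 2 * h <= K ^+ 3 * h by rewrite ler_wpM2r// [leRHS]exprSr ler_peMr.
have b1 : K ^+ 2 * D <= K ^+ 2 * h by rewrite ler_wpM2l.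
have b2 : K ^+ 2 * `|W| <= K ^+ 2 * h by rewrite ler_wpM2l.
have W2 : W ^+ 2 <= h.
  rewrite -[W ^+ 2]real_normK ?num_real// expr2 (le_trans (ler_pM _ _ Wh Wh))//.
  by rewrite ler_piMl.
have b3 : K ^+ 3 / 2 * W ^+ 2 <= (K ^+ 3 * h) / 2.
  have -> : (K ^+ 3 * h) / 2 = K ^+ 3 / 2 * h by field.
  by rewrite ler_wpM2l// divr_ge0.
have K3h : 0 <= K ^+ 3 * h by exact: mulr_ge0.
have hE : h * (10 * K ^+ 3) = 10 * (K ^+ 3 * h) by ring.
rewrite hE in he; move: t1 t2 t3 T1l T2l T3l => t1 t2 t3 T1l T2l T3l.
clear -T1l T2l T3l L1z K23 b1 b2 b3 K3h he; lra.
Qed.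

(** [D0] and [kap] are chosen before the points and increments, so one mesh works along the whole
    path. The jump uses [v] and the Taylor terms [x], as the scheme and the solution are distinct
    points. *)
Lemma one_step_ineq (phi phi1 phi2 : R -> R) (M c C A S delta e : R) :
  (forall x, 0 <= phi x <= M) ->
  (forall x : R, 0 < x -> is_derive x 1 phi (phi1 x)) ->
  (forall x : R, 0 < x -> is_derive x 1 phi1 (phi2 x)) ->
  (forall x : R, 0 < x -> {for x, continuous phi2}) ->
  0 < c -> 0 <= A -> 0 <= S ->
  0 <= delta -> 0 < e ->
  exists2 D0 : R, 0 < D0 & exists2 kap : R, 0 <= kap &
  forall (x v a be D W : R) (n : nat), c <= x <= C -> 0 <= v <= C ->
   `|a| <= A -> `|be| <= S -> 0 <= D <= D0 ->
   phi (x + (a * D + be * W + delta * v * n%:R)) - phi x <=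
   phi1 x * a * D + phi1 x * be * W + phi2 x * be ^+ 2 / 2 * W ^+ 2
   + (phi (x + delta * v) - phi x) * (n == 1%N)%:R
   + e * (D + W ^+ 2 + (n == 1%N)%:R) + kap * (W ^+ 4 + (1 < n)%N%:R).
Proof.
move=> phiM dphi dphi1 cphi2 c0 A0 S0 del0 e0.
(* The interval from [c / 2] to [C'] contains every point reached after at most one jump and a
   continuous move of size at most [c / 3]. *)
pose C' := C + delta * C + c.
have pos x : c / 2 <= x <= C' -> 0 < x by case/andP => h _; apply: lt_le_trans h; rewrite divr_gt0.
have [L1 L10 hL1] : exists2 L : R, 0 < L & forall x, c / 2 <= x <= C' -> `|phi1 x| <= L.
  by apply: bounded_itv => x /pos x0; exact: is_derive_continuous (dphi1 _ x0).
have [L2 L20 hL2] : exists2 L : R, 0 < L & forall x, c / 2 <= x <= C' -> `|phi2 x| <= L.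
  by apply: bounded_itv => x /pos x0; exact: cphi2.
pose K := 1 + A + S + L1 + L2.
have [K1 AK SK LK1 LK2] : [/\ 1 <= K, A <= K, S <= K, L1 <= K & L2 <= K].
  by clear -A0 S0 L10 L20; rewrite /K; split; lra.
have K0 : 0 < K by exact: lt_le_trans K1.
pose e2 := e / (4 * K ^+ 2).
have e20 : 0 < e2 by rewrite divr_gt0// mulr_gt0// exprn_gt0.
have [r r0 hr] := @unif_continuous_itv phi2 (c / 2) C' e2 e20 (fun x h => cphi2 _ (pos x h)).
pose h := Num.min 1 (Num.min (Num.min r (c / 3) / (2 * K)) (e / (10 * K ^+ 3))).
have h0 : 0 < h.
  by rewrite !lt_min ltr01 !divr_gt0 ?mulr_gt0 ?exprn_gt0 ?lt_min ?r0 ?divr_gt0.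
have h1 : h <= 1 by rewrite /h ge_min lexx.
have hr3 : h * (2 * K) <= Num.min r (c / 3).
  by rewrite -ler_pdivlMr ?mulr_gt0// /h !ge_min lexx orbT.
have he : h * (10 * K ^+ 3) <= e.
  have K30 : 0 < 10 * K ^+ 3 by rewrite mulr_gt0// exprn_gt0.
  by rewrite -(ler_pdivlMr _ _ K30) /h !ge_min lexx !orbT.
have M0 : 0 <= M by have /andP[p0 pM] := phiM 0; exact: le_trans pM.
pose Q := 2 * M + 2 * K ^+ 2 + K ^+ 3.
have kap0 : 0 <= Q * (1 + h ^- 4).
  rewrite mulr_ge0//; last by rewrite addr_ge0// invr_ge0 exprn_ge0// ltW.
  by rewrite /Q !addr_ge0 ?mulr_ge0 ?exprn_ge0// ltW.
exists h => //; exists (Q * (1 + h ^- 4)) => //.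
move=> x v a be D W n /andP[cx xC] /andP[v0 vC] aA beS /andP[D0 Dh].
have C0 : 0 <= C by exact: le_trans vC.
have dv0 : 0 <= delta * v by exact: mulr_ge0.
have dvC : delta * v <= delta * C by rewrite ler_wpM2l.
have dC0 : 0 <= delta * C by exact: mulr_ge0.
have xI : c / 2 <= x <= C' by clear -cx xC dC0 c0; rewrite /C'; apply/andP; split; lra.
have p1K : `|phi1 x| <= K by exact: le_trans (hL1 _ xI) LK1.
have p2K : `|phi2 x| <= K by exact: le_trans (hL2 _ xI) LK2.
have aK : `|a| <= K by exact: le_trans AK.
have beK : `|be| <= K by exact: le_trans SK.
have Dh0 : 0 <= D <= h by rewrite D0.
have q3 : 0 <= e * (D + W ^+ 2 + (n == 1%N)%:R).
  apply: mulr_ge0; first exact: ltW.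
  by apply: addr_ge0 => //; apply: addr_ge0 => //; exact: sqr_ge0.
have W40 : 0 <= W ^+ 4 by exact: exprn_even_ge0.
have [big|small] := pselect (h < `|W| \/ (1 < n)%N).
  have h01 : 0 < h <= 1 by rewrite h0.
  have := step_large M0 K1 h01 Dh0 p1K p2K aK beK big; rewrite -/Q.
  have q1 : phi (x + (a * D + be * W + delta * v * n%:R)) - phi x <= M.
    have /andP[_ ] := phiM (x + (a * D + be * W + delta * v * n%:R)).
    by have /andP[] := phiM x; clear -D; lra.
  have q2 : - M <= (phi (x + delta * v) - phi x) * (n == 1%N)%:R.
    have /andP[u1 u2] := phiM (x + delta * v); have /andP[u3 u4] := phiM x.
    by case: eqP => _; clear -u1 u2 u3 u4 M0; rewrite ?mulr1 ?mulr0; lra.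
  move: q1 q2 q3; move: (_ - phi x) (_ * (n == 1%N)%:R) (_ * (_ + _ + _)) => X Y Z.
  by move: (Q * _ * _) => U; clear -D; lra.
have Wh : `|W| <= h by rewrite leNgt; apply/negP => ?; apply: small; left.
have n1 : (n <= 1)%N by rewrite leqNgt; apply/negP => ?; apply: small; right.
have kapW : 0 <= Q * (1 + h ^- 4) * W ^+ 4 by exact: mulr_ge0.
have zb : `|a * D + be * W| <= h * (2 * K).
  apply: (le_trans (ler_normD _ _)); rewrite !normrM (ger0_norm D0).
  have -> : h * (2 * K) = K * h + K * h by ring.
  by rewrite lerD// ler_pM.
have := le_trans zb hr3; rewrite le_min => /andP[zr zc].
have /andP[zl zu] : - (c / 3) <= a * D + be * W <= c / 3 by rewrite -ler_norml.
have dpos (y : R) : c / 2 < y < C' -> 0 < y.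
  by case/andP => hy _; apply: lt_trans hy; rewrite divr_gt0.
have cl (y : R) : c / 2 < y < C' -> c / 2 <= y <= C'.
  by case/andP => y1 y2; rewrite !ltW.
have cases : n = 0%N \/ n = 1%N by case: n {q3 small} n1 => [|[|]]//; [left|right].
case: cases => n_eq; rewrite n_eq in q3 *.
  have xo : c / 2 < x < C' by clear -cx xC dC0 c0; rewrite /C'; apply/andP; split; lra.
  have xzo : c / 2 < x + (a * D + be * W) < C'.
    by clear -cx xC dC0 c0 zl zu; rewrite /C'; apply/andP; split; lra.
  have := @step_nojump phi phi1 phi2 K h r (c / 2) C' e x a be D W dphi dphi1 K1 e0 Dh0 aK beK p2K dpos xo xzo zr Wh h1 he
    (fun y w hy hw => hr y w (cl y hy) (cl w hw)).
  rewrite !mulr0 !addr0; move: kapW.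
  by move: (Q * _ * _) => U; clear -D; lra.
have xo : c / 2 < x + delta * v < C'.
  by clear -cx xC dv0 dvC c0; rewrite /C'; apply/andP; split; lra.
have xzo : c / 2 < x + delta * v + (a * D + be * W) < C'.
  by clear -cx xC dv0 dvC c0 zl zu; rewrite /C'; apply/andP; split; lra.
have := @step_onejump phi phi1 phi2 K h (c / 2) C' e x (x + delta * v) a be D W dphi K1 Dh0 aK beK p1K p2K dpos
  (fun y hy => le_trans (hL1 y (cl y hy)) LK1) xo xzo Wh h1 he.
rewrite !mulr1 /= addr0 -[x + delta * v + _]addrA [delta * v + _]addrC.
have eDW : 0 <= e * (D + W ^+ 2).
  by apply: mulr_ge0; [exact: ltW|apply: addr_ge0 => //; exact: sqr_ge0].
have -> : e * (D + W ^+ 2 + 1%:R) = e * (D + W ^+ 2) + e by ring.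
move: kapW eDW; move: (Q * _ * _) (e * _) => U V.
by clear -D; lra.
Qed.
End real_tools.

(** * Cadlag paths and counting paths *)

Section cadlag_paths.
Context {R : realType}.
Implicit Types (v : R -> R).

Lemma cadlag_local v (c e : R) : cadlag v -> 0 <= c -> 0 < e ->
  exists2 r : R, 0 < r & forall u, 0 <= u -> `|u - c| < r ->
    (c <= u -> `|v u - v c| <= e) /\ (u < c -> `|v u - left_limit v c| <= e).
Proof.
move=> [rc lc] c0 e0.
have [r1 r10 h1] : exists2 r : R, 0 < r & forall u, c <= u -> u - c < r -> `|v u - v c| <= e.
  have /cvgrPdist_le/(_ e e0)[r /= r0 hr] := rc c c0.
  exists r => // u; rewrite le_eqVlt => /predU1P[<- _|cu ur].
    by rewrite subrr normr0 ltW.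
  by rewrite distrC; apply: hr => //=; rewrite ltr0_norm; lra.
have [c00|cn0] := eqVneq c 0.
  exists r1 => // u u0 uc; split => [cu|]; last by rewrite c00 ltNge u0.
  by apply: h1 => //; rewrite ger0_norm// in uc; lra.
have cp : 0 < c by rewrite lt_neqAle eq_sym cn0.
have [r2 r20 h2] : exists2 r : R, 0 < r & forall u, u < c -> c - u < r -> `|v u - left_limit v c| <= e.
  have /cvgrPdist_le/(_ e e0)[r /= r0 hr] := lc c cp.
  exists r => // u uc ur.
  by rewrite distrC; apply: hr => //=; rewrite gtr0_norm; lra.
exists (Num.min r1 r2); first by rewrite lt_min r10.
move=> u u0; rewrite lt_min => /andP[u1 u2]; split => [cu|uc].
  by apply: h1 => //; rewrite ger0_norm// in u1; lra.
by apply: h2 => //; rewrite ltr0_norm// in u2; lra.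
Qed.

(** Near a centre the path is within [e / 2] of one value on each side. If no centre separates [x]
    from [y], both lie on the same side of the centre they share. *)
Lemma cadlag_osc v (b e : R) : cadlag v -> 0 < e ->
  exists s : seq R, exists2 rho : R, 0 < rho & forall x y, 0 <= x -> x <= y ->
    y <= b -> y - x <= rho -> (forall c, c \in s -> ~~ (x < c <= y)) ->
    `|v y - v x| <= e.
Proof.
move=> cv e0.
have h1 (c : R) : exists r : R, 0 <= c <= b -> 0 < r /\ forall u, 0 <= u -> `|u - c| < r ->
    (c <= u -> `|v u - v c| <= e / 2) /\ (u < c -> `|v u - left_limit v c| <= e / 2).
  have [/andP[c0 cb]|] := boolP (0 <= c <= b); last by exists 0.
  by have [|r r0 hr] := cadlag_local cv c0 (e := e / 2); [lra|exists r].
have [r hr] := choice h1.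
have [s [sab [rho rho0 scov]]] := itv_cover (fun x xab => (hr x xab).1).
exists s, rho => // x y x0 xy yb yx hs.
have xb : 0 <= x <= b by rewrite x0 (le_trans xy).
have [c cs hc] := scov x xb.
have [_ hc2] := hr c (sab c cs).
have [] := hc2 x x0 (hc x _); first by rewrite subrr normr0 ltW.
have [] := hc2 y (le_trans x0 xy) (hc y _); first by rewrite distrC ger0_norm// subr_ge0.
move=> y1 y2 x1 x2.
have := hs c cs; rewrite negb_and -leNgt -ltNge => /orP[cx|yc].
  have := y1 (le_trans cx xy); have := x1 cx.
  have := ler_distD (v c) (v y) (v x); rewrite [`|v c - v x|]distrC; lra.
have := y2 yc; have := x2 (le_lt_trans xy yc).
have := ler_distD (left_limit v c) (v y) (v x); rewrite [`|left_limit v c - v x|]distrC; lra.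
Qed.

Lemma seq_upper_bound (T : eqType) (s : seq T) (g : T -> R) :
  exists2 M : R, 0 <= M & forall c, c \in s -> g c <= M.
Proof.
elim: s => [|c s [M M0 h]]; first by exists 0.
exists (Num.max M (g c)); first by rewrite le_max M0.
move=> x; rewrite inE => /predU1P[->|/h h']; rewrite le_max ?lexx ?orbT//.
by rewrite h'.
Qed.

Lemma cadlag_bounded v (b : R) : cadlag v ->
  exists2 M : R, 0 <= M & forall x, 0 <= x <= b -> `|v x| <= M.
Proof.
move=> cv.
have h1 (c : R) : exists r : R, 0 <= c <= b -> 0 < r /\ forall u, 0 <= u -> `|u - c| < r ->
    (c <= u -> `|v u - v c| <= 1) /\ (u < c -> `|v u - left_limit v c| <= 1).
  have [/andP[c0 cb]|] := boolP (0 <= c <= b); last by exists 0.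
  by have [r r0 hr] := cadlag_local cv c0 (@ltr01 R); exists r.
have [r hr] := choice h1.
have [s [sab [rho rho0 scov]]] := itv_cover (fun x xab => (hr x xab).1).
have [M M0 hM] := seq_upper_bound s (fun c => `|v c| + `|left_limit v c| + 1).
exists M => // x xb; have [c cs hc] := scov x xb.
have [_ hc2] := hr c (sab c cs).
have /andP[x0 _] := xb.
have [] := hc2 x x0 (hc x _); first by rewrite subrr normr0 ltW.
move=> x1 x2; apply: le_trans (hM c cs).
have [/x1 h|/x2 h] := leP c x.
  have := ler_normD (v x - v c) (v c); rewrite subrK.
  have : 0 <= `|left_limit v c| by []. lra.
have := ler_normD (v x - left_limit v c) (left_limit v c); rewrite subrK.
have : 0 <= `|v c| by []. lra.
Qed.

Lemma cadlag_comp v (u : R -> R) : cadlag v ->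
  (forall s, 0 <= s -> 0 < v s) -> (forall s, 0 < s -> 0 < left_limit v s) ->
  (forall x, 0 < x -> {for x, continuous u}) ->
  cadlag (u \o v) /\ forall s, 0 < s -> left_limit (u \o v) s = u (left_limit v s).
Proof.
move=> [rc lc] v0 lv0 cu.
have left s : 0 < s -> (u \o v) x @[x --> s^'-] --> u (left_limit v s).
  move=> s0; apply: (@cvg_comp _ _ _ v u); first exact: lc.
  exact: (cu _ (lv0 s s0)).
split; last by move=> s s0; apply/cvg_lim; [exact: Rhausdorff|exact: left].
split=> [s s0|s s0]; last by apply/cvg_ex; exists (u (left_limit v s)); exact: left.
apply: (@cvg_comp _ _ _ v u); first exact: rc.
exact: (cu _ (v0 s s0)).
Qed.

(** The half-open blocks partition the interval from [s 0] to [s j], so exactly one contains [c].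
    This evaluates step functions at a time and also locates jump times among grid cells. *)
Lemma nondecreasing_block_sum (s : nat -> R) (F : nat -> R) (c : R) (j : nat) :
  {homo s : i k / (i <= k)%N >-> i <= k} ->
  (s 0%N < c <= s j -> exists2 i, (i < j)%N & s i < c <= s i.+1 /\
      \sum_(i < j) F i * (s i < c <= s i.+1)%R%:R = F i) /\
  (~~ (s 0%N < c <= s j) -> \sum_(i < j) F i * (s i < c <= s i.+1)%R%:R = 0).
Proof.
move=> ns; split; last first.
  move=> h; rewrite big1// => i _.
  suff -> : (s i < c <= s i.+1) = false by rewrite mulr0.
  apply: contraNF h => /andP[h1 h2].
  by rewrite (le_lt_trans (ns 0%N i _) h1)// (le_trans h2)// ns.
elim: j => [|j ih] /andP[c0 cj]; first by have := lt_le_trans c0 cj; rewrite ltxx.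
have [csj|csj] := leP c (s j).
  have [|i ij [hi hs]] := ih; first by rewrite c0.
  exists i; first exact: ltnW.
  split => //; rewrite big_ord_recr /= hs ltNge csj /= mulr0 addr0//.
exists j => //; rewrite csj cj; split => //.
rewrite big_ord_recr /= csj cj mulr1 big1 ?add0r// => i _.
by rewrite [c <= _]leNgt (le_lt_trans (ns i.+1 j (ltn_ord i)) csj) andbF mulr0.
Qed.


Lemma right_continuous_measurable v : right_continuous_path v ->
  measurable_fun `[(0 : R), +oo[ v.
Proof.
move=> rc.
(* The right end of the cell containing [x]: it lies strictly above [x], so right limits suffice,
   and the composition with [v] is constant on each cell. *)
pose k (m : nat) (x : R) : R := (Num.truncn (x * m.+1%:R)).+1%:R / m.+1%:R.
have kx m x : 0 <= x -> x < k m x /\ k m x <= x + m.+1%:R^-1.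
  move=> x0; have := truncn_itv (mulr_ge0 x0 (ler0n R m.+1)) => /andP[h1 h2].
  split; first by rewrite /k ltr_pdivlMr.
  rewrite /k ler_pdivrMr// mulrDl mulVf// -natr1; lra.
apply: (@measurable_fun_cvg _ _ _ _ (fun m x => v (k m x))).
  move=> m _ U mU.
  pose I (n : nat) : set R := [set` `[n%:R / m.+1%:R, n.+1%:R / m.+1%:R[ ].
  rewrite (_ : _ `&` _ = \bigcup_(n in [set n | U (v (n.+1%:R / m.+1%:R))]) I n); last first.
    apply/seteqP; split=> [x [/=]|x [n /= Un]]; rewrite in_itv/= ?andbT.
      move=> x0 Ux; exists (Num.truncn (x * m.+1%:R)) => //.
      have := truncn_itv (mulr_ge0 x0 (ler0n R m.+1)) => /andP[h1 h2].
      by rewrite /I /= in_itv/= ler_pdivrMr// h1 ltr_pdivlMr.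
    rewrite /I/= in_itv/= => /andP[h1 h2].
    have x0 : 0 <= x by apply: le_trans h1; rewrite divr_ge0.
    split => //.
    rewrite /k; suff -> : Num.truncn (x * m.+1%:R) = n by [].
    by apply: truncn_def; rewrite -ler_pdivrMr// h1 -ltr_pdivlMr.
  by apply: bigcup_measurable => n _; exact: measurable_itv.
move=> x; rewrite /= in_itv/= andbT => x0.
have /cvg_at_rightP := rc x x0; apply; split => [n|]; first by have [] := kx n x x0.
apply: (@squeeze_cvgr _ _ _ _ (fun=> x) (fun n => x + n.+1%:R^-1)).
- by near=> n; have [h1 h2] := kx n x x0; rewrite h2 ltW.
- exact: cvg_cst.
- rewrite -[X in _ --> X]addr0; apply: cvgD; first exact: cvg_cst.
  exact: cvg_harmonic.
Unshelve. all: by end_near. Qed.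

Definition grid (b : R) (m i : nat) : R := b * (i%:R / m.+1%:R).

Lemma grid0 b m : grid b m 0 = 0.
Proof. by rewrite /grid mul0r mulr0. Qed.

Lemma gridS b m i : grid b m i.+1 = grid b m i + b / m.+1%:R.
Proof. by rewrite /grid -natr1; field. Qed.

Lemma gridT b m : grid b m m.+1 = b.
Proof. by rewrite /grid divff ?mulr1. Qed.

Lemma grid_nd b m : 0 <= b -> {homo grid b m : i k / (i <= k)%N >-> i <= k}.
Proof.
by move=> b0 i k ik; rewrite /grid ler_wpM2l// ler_wpM2r// ?invr_ge0// ler_nat.
Qed.

Lemma grid_ge0 b m i : 0 <= b -> 0 <= grid b m i.
Proof. by move=> b0; rewrite mulr_ge0// divr_ge0. Qed.

Lemma grid_le b m i : 0 <= b -> (i <= m.+1)%N -> grid b m i <= b.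
Proof. by move=> b0 im; rewrite -[leRHS](gridT b m) grid_nd. Qed.

Lemma mesh_small (b e : R) : 0 < e -> exists m0 : nat, forall m : nat, (m0 <= m)%N ->
  b / m.+1%:R <= e.
Proof.
move=> e0; exists (Num.truncn (b / e)) => m hm.
rewrite ler_pdivrMr// mulrC -ler_pdivrMr//.
apply: ltW; apply: (lt_le_trans (truncnS_gt _)); by rewrite ler_nat.
Qed.

Lemma cadlag_integrable v (a b : R) (ba bb : bool) : cadlag v -> 0 <= a ->
  lebesgue_measure.-integrable [set` Interval (BSide ba a) (BSide bb b)] (EFin \o v).
Proof.
move=> cv a0.
have sub0 : [set` Interval (BSide ba a) (BSide bb b)] `<=` `[(0 : R), +oo[%classic.
  move=> x /=; rewrite !in_itv/= andbT; case: ba => /andP[h _].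
    exact: le_trans h.
  exact: le_trans (ltW h).
have [M M0 hM] := cadlag_bounded b cv.
apply: measurable_bounded_integrable => //.
- by have := lebesgue_measure_itv (Interval (BSide ba a) (BSide bb b)) => /= ->; case: ifP => _; rewrite ?ltry.
- apply: measurable_funS sub0 _ => //; exact: right_continuous_measurable cv.1.
- exists M; split; first exact: num_real.
  move=> N MN x /= xI; apply: le_trans (ltW MN); apply: hM.
  have := sub0 x xI; rewrite /= in_itv/= andbT => ->/=.
  move: xI; rewrite in_itv/=; case: bb {sub0} => /andP[_] //; exact: ltW.
Qed.

(** For each level [k] above [nn 0] the time is the infimum of those at which the path has reached
    [k]; right-continuity makes it attained. A jump of size larger than one puts its time several
    times in the list. *)
Lemma nat_jump_times (nn : R -> nat) (b : R) : 0 <= b ->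
  (forall s t : R, 0 <= s -> s <= t -> (nn s <= nn t)%N) ->
  right_continuous_path (fun t => (nn t)%:R : R) ->
  exists2 taus : seq R, forall c, c \in taus -> 0 < c <= b &
    forall s : R, 0 <= s <= b -> nn s = (nn 0%R + count (fun c => c <= s)%R taus)%N.
Proof.
move=> b0 nd rc.
have tau (k : nat) : exists t : R, (nn 0%R < k <= nn b)%N ->
    0 < t <= b /\ forall s : R, 0 <= s <= b -> (k <= nn s)%N = (t <= s)%R.
  have [/andP[k0 kb]|] := boolP (nn 0%R < k <= nn b)%N; last by exists 0.
  pose S : set R := [set s | 0 <= s <= b /\ (k <= nn s)%N].
  have Sb : S b by split; rewrite ?b0 ?lexx.
  have S0 : lbound S 0 by move=> s [/andP[]].
  have hiS : has_inf S by split; [exists b|exists 0].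
  exists (inf S) => _.
  have t0 : 0 <= inf S by apply: lb_le_inf => //; exists b.
  have tb : inf S <= b by apply: ge_inf => //; exists 0.
  have kt : (k <= nn (inf S))%N.
    have /cvgrPdist_lt/(_ 1 ltr01)[r /= r0 hr] := rc _ t0.
    have [s [/andP[s0 sb] ks] sr] := inf_adherent r0 hiS.
    have ts : inf S <= s by apply: ge_inf; [exists 0|split; rewrite ?s0].
    move: ts; rewrite le_eqVlt => /predU1P[->//|ts].
    have := hr s; rewrite /= ltr0_norm ?subr_lt0// opprB => /(_ _ ts) h.
    have {}h : `|(nn (inf S))%:R - (nn s)%:R| < 1 :> R by apply: h; lra.
    have nts : (nn (inf S) <= nn s)%N by apply: nd => //; exact: ltW.
    have : (nn s < (nn (inf S)).+1)%N.
      move: h; rewrite distrC ger0_norm ?subr_ge0 ?ler_nat// -(ltr_nat R) -natr1; lra.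
    by rewrite ltnS => h'; exact: leq_trans h'.
  split; last first.
    move=> s /andP[s0 sb]; apply/idP/idP => [ks|ts].
      by apply: ge_inf; [exists 0|split; rewrite ?s0].
    exact: leq_trans (nd _ _ t0 ts).
  rewrite tb andbT lt_neqAle t0 andbT; apply/eqP => e0.
  by rewrite -e0 leqNgt k0 in kt.
have [t ht] := choice tau.
exists [seq t k | k <- iota (nn 0%R).+1 (nn b - nn 0%R)].
  move=> c /mapP[k]; rewrite mem_iota => /andP[k1 k2] ->.
  have [] := ht k; first by rewrite k1 /=; have := nd 0 b (lexx 0) b0; lia.
  by [].
move=> s /andP[s0 sb].
have n0s := nd 0 s (lexx 0) s0; have nsb := nd s b s0 sb.
rewrite count_map (@eq_in_count _ _ (fun k => k <= nn s)%N); last first.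
  move=> k; rewrite mem_iota => /andP[k1 k2] /=.
  have [|_ h] := ht k; first by rewrite k1 /=; lia.
  by rewrite h// s0.
have cnt a l n : count (fun k => k <= n)%N (iota a.+1 l) = minn (n - a) l.
  elim: l => [|l ih]; first by rewrite minn0.
  rewrite -[in LHS](addn1 l) iotaD count_cat ih /= addn0; lia.
rewrite cnt; lia.
Qed.

(** * Jump integrals as finite sums over jump times *)

Section jumps.
Variables (nn : R -> nat) (b : R) (taus : seq R).
Hypothesis tausb : forall c, c \in taus -> 0 < c <= b.
Hypothesis nnE : forall s : R, 0 <= s <= b -> nn s = (nn 0%R + count (fun c => c <= s)%R taus)%N.

Lemma left_limit_jump (s : R) : 0 < s <= b ->
  left_limit (fun t => (nn t)%:R) s = (nn 0%R + count (fun c => c < s)%R taus)%:R.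
Proof.
move=> /andP[s0 sb]; apply: cvg_lim; first exact: Rhausdorff.
(* Adding 0 to the list keeps the points within [r] of [s] nonnegative, where [nnE] applies. *)
have [r r0 hr] : exists2 r : R, 0 < r & forall c, c \in [seq c <- 0 :: taus | c < s] -> r <= s - c.
  by apply: seq_lower_bound => c; rewrite mem_filter subr_gt0 => /andP[].
apply: cvg_near_cst; exists r => //= u /= /[swap] us.
rewrite gtr0_norm ?subr_gt0// => ur.
have u0 : 0 <= u.
  by have := hr 0; rewrite mem_filter s0 inE eqxx => /(_ isT); lra.
rewrite nnE; last by rewrite u0 ltW// (lt_le_trans us).
congr (_ + _)%:R; apply: eq_in_count => c ct.
apply/idP/idP => [cu|cs]; first exact: le_lt_trans us.
by have := hr c; rewrite mem_filter cs inE ct orbT => /(_ isT); lra.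
Qed.

(** The jump of the path at [s] is the multiplicity of [s] in [taus], so the sum over reals
    collapses to a sum over the list with repetitions. *)
Lemma jump_integralE (f : R -> R) (t : R) : t <= b ->
  jump_integral f (fun t => (nn t)%:R) t = \sum_(c <- taus | c <= t) f c.
Proof.
move=> tb; rewrite /jump_integral.
transitivity (\sum_(s \in `]0, t]) f s *+ count_mem s [seq c <- taus | c <= t]).
  apply: eq_fsbigr => s; rewrite inE/= in_itv/= => /andP[s0 st].
  have sb : s <= b by exact: le_trans tb.
  rewrite left_limit_jump ?s0// nnE ?(ltW s0)// !natrD.
  rewrite -[RHS]mulr_natr; congr (_ * _).
  have -> : count (fun c => c <= s) taus =
     (count (fun c => c < s)%R taus + count_mem s taus)%N.
    rewrite -count_predUI (@eq_count _ (predI _ _) pred0) ?count_pred0 ?addn0; last first.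
      by move=> c /=; case: eqP => [->|]; rewrite ?ltxx ?andbF.
    by apply: eq_count => c /=; rewrite le_eqVlt orbC.
  rewrite natrD count_filter (@eq_count _ (predI _ _) (pred1 s)); last first.
    by move=> c /=; case: eqP => // ->; rewrite st.
  by ring.
rewrite (@fsbigE _ _ _ _ _ (undup [seq c <- taus | c <= t])); first last.
- by move=> c _; rewrite mem_undup => /count_memPn ->.
- move=> c /=; rewrite mem_undup mem_filter in_itv/= => /andP[-> /tausb/andP[-> _]] //.
- exact: undup_uniq.
rewrite -[RHS]big_filter -(big_undup_iterop_count _ _ predT).
rewrite [LHS]big_seq_cond [RHS]big_seq_cond; apply: eq_bigl => c.
rewrite andbT; apply: andb_idr; rewrite mem_undup mem_filter => /andP[ct /tausb/andP[c0 _]].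
by rewrite inE /= in_itv/= c0.
Qed.

(** After exchanging sums, each jump time picks the one cell that contains it, whose left end is
    strictly earlier and close; hence left limits appear. The error is counted per jump time, which
    makes it uniform in [j]. *)
Lemma jump_riemann (u f : R -> R) (e : R) : 0 <= b -> 0 < e ->
  (forall c, 0 < c -> u x @[x --> c^'-] --> f c) ->
  exists m0 : nat, forall m, (m0 <= m)%N -> forall j, (j <= m.+1)%N ->
    `| \sum_(i < j) u (grid b m i) * ((nn (grid b m i.+1))%:R - (nn (grid b m i))%:R)
       - jump_integral f (fun t => (nn t)%:R) (grid b m j) | <= e.
Proof.
move=> b0 e0 uf.
pose e1 := e / (size taus).+1%:R.
have e10 : 0 < e1 by rewrite divr_gt0.
have h1 (c : R) : exists r : R, 0 < c -> 0 < r /\ forall x, 0 < c - x < r -> `|u x - f c| <= e1.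
  have [c0|] := boolP (0 < c); last by exists 0.
  have /cvgrPdist_le/(_ e1 e10)[r /= r0 hr] := uf c c0.
  exists r => _; split => // x /andP[cx xr]; rewrite distrC; apply: hr => //=.
    by rewrite gtr0_norm.
  by rewrite -subr_gt0.
have [r hr] := choice h1.
have [|rho rho0 hrho] := @seq_lower_bound _ _ taus r.
  by move=> c /tausb/andP[c0 _]; have [] := hr c c0.
have [m0 hm0] := @mesh_small b (rho / 2) (divr_gt0 rho0 (ltr0Sn R 1)).
exists m0 => m /hm0 hm j jm.
have gb : grid b m j <= b by exact: grid_le.
rewrite jump_integralE// [X in _ - X]big_mkcond/=.
have nnS i : (i < j)%N -> (nn (grid b m i.+1))%:R - (nn (grid b m i))%:R =
    \sum_(c <- taus) (grid b m i < c <= grid b m i.+1)%R%:R :> R.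
  move=> ij; have g1 := grid_le b0 (leq_trans ij jm).
  have g2 : grid b m i <= grid b m i.+1 by exact: grid_nd.
  have g3 : 0 <= grid b m i.+1 <= b by rewrite g1 grid_ge0.
  have g4 : 0 <= grid b m i <= b by rewrite (le_trans g2 g1) grid_ge0.
  have cE (p : pred R) : (count p taus)%:R = \sum_(c <- taus) (p c)%:R :> R.
    by rewrite -sum1_count natr_sum big_mkcond; apply: eq_bigr => c _; case: (p c).
  rewrite (nnE g3) (nnE g4) !natrD !cE.
  rewrite opprD addrACA subrr add0r -sumrB; apply: eq_bigr => c _.
  have [h|h] := leP c (grid b m i); last by rewrite subr0; case: (c <= _).
  by rewrite (le_trans h g2) /= subrr.
under eq_bigr => i _ do rewrite nnS// mulr_sumr.
rewrite exchange_big /= -sumrB.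
apply: (le_trans (ler_norm_sum _ _ _)).
have -> : e = \sum_(c <- taus) e1 + e1.
  by rewrite big_const_seq count_predT iter_addr_0 -mulr_natr /e1 -[size _]/(size taus) ; field.
rewrite -[leLHS]addr0 lerD ?(ltW e10)//.
rewrite big_seq [leRHS]big_seq; apply: ler_sum => c ct.
have /andP[c0 cb] := tausb ct.
have [hs hn] := nondecreasing_block_sum (fun i => u (grid b m i)) c j (@grid_nd b m b0).
rewrite grid0 c0 /= in hs hn.
case: ifP => cj; last by rewrite hn ?cj// subrr normr0 ltW.
have [i ij [/andP[hi1 hi2] ->]] := hs cj.
have [_ ]:= hr c c0; apply.
rewrite subr_gt0 hi1 /=; apply: lt_le_trans (hrho c ct).
rewrite ltrBlDl (le_lt_trans hi2)// gridS ltrD2l (le_lt_trans hm)//.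
by rewrite ltr_pdivrMr// ltr_pMr// ltr1n.
Qed.

End jumps.

Lemma cadlag_compT v (u : R -> R) : cadlag v -> continuous u -> cadlag (u \o v).
Proof.
move=> [rc lc] cu; split=> [s s0|s s0].
  by apply: (@cvg_comp _ _ _ v u); [exact: rc|exact: cu].
apply/cvg_ex; exists (u (left_limit v s)).
by apply: (@cvg_comp _ _ _ v u); [exact: lc|exact: cu].
Qed.

Lemma cadlag_sub v (k : R) : cadlag v -> cadlag (fun x => v x - k).
Proof.
move=> cv; apply: (@cadlag_compT v (fun x => x - k)) => // x.
by apply: cvgB; [exact: cvg_id|exact: cvg_cst].
Qed.

Lemma cadlag_dist v (k : R) : cadlag v -> cadlag (fun x => `|v x - k|).
Proof.
move=> cv; apply: (@cadlag_compT v (fun x => `|x - k|)) => // x.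
apply: (@continuous_comp _ _ _ (fun x => x - k) (fun x => `|x|)); last exact: norm_continuous.
by apply: cvgB; [exact: cvg_id|exact: cvg_cst].
Qed.

Lemma cadlag_cst (k : R) : cadlag (fun=> k : R).
Proof.
split=> [s _|s _]; first exact: cvg_cst.
by apply/cvg_ex; exists k; exact: cvg_cst.
Qed.

Lemma Rintegral_grid b m i (k : R) : 0 <= b ->
  \int[lebesgue_measure]_(x in `]grid b m i, grid b m i.+1]) k = k * (b / m.+1%:R).
Proof.
move=> b0; rewrite Rintegral_cst//; congr (_ * _).
have /= -> := lebesgue_measure_itv (`]grid b m i, grid b m i.+1]).
have D0 : 0 <= b / m.+1%:R by rewrite divr_ge0.
rewrite lte_fin gridS; case: ltP => h; first by rewrite -EFinB /= addrC addKr.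
by rewrite /=; apply/eqP; rewrite eq_le D0 /= -(lerD2l (grid b m i)) addr0.
Qed.

Lemma sum_grid_itv b m j v : 0 <= b -> cadlag v ->
  \int[lebesgue_measure]_(x in `[0, grid b m j]) v x =
  \sum_(i < j) \int[lebesgue_measure]_(x in `]grid b m i, grid b m i.+1]) v x.
Proof.
move=> b0 cv; elim: j => [|j ih].
  by rewrite big_ord0 grid0 set_itv1 Rintegral_set1.
rewrite big_ord_recr /= -ih.
rewrite -(@Rintegral_itvB _ v (BLeft 0) (BRight (grid b m j.+1)) (grid b m j)).
- by rewrite addrC subrK.
- exact: cadlag_integrable.
- by rewrite bnd_simp grid_ge0.
- by rewrite bnd_simp grid_nd.
Qed.

Lemma cadlag_riemann v (b e : R) : cadlag v -> 0 <= b -> 0 < e ->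
  exists m0 : nat, forall m, (m0 <= m)%N ->
  \sum_(i < m.+1) \int[lebesgue_measure]_(x in `]grid b m i, grid b m i.+1])
    `|v x - v (grid b m i)| <= e.
Proof.
move=> cv b0 e0.
have [M M0 hM] := cadlag_bounded b cv.
(* Cells free of centres contribute at most [e1 * b], below [e / 2]. There are at most [size s]
   others, each costing at most [2 * M] times the mesh; [K] and the mesh make these at most [e / 2]
   together. *)
pose e1 := e / (2 * (b + 1)).
have e10 : 0 < e1 by rewrite divr_gt0// mulr_gt0//; lra.
have [s [rho rho0 hs]] := cadlag_osc b cv e10.
pose K := 2 * M * (size s)%:R + 1.
have K0 : 0 < K by rewrite ltr_wpDl// mulr_ge0// mulr_ge0.
have [m0 hm0] := @mesh_small b (Num.min rho (e / (2 * K)))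
   (ltac:(by rewrite lt_min rho0 divr_gt0// mulr_gt0)).
exists m0 => m /hm0; rewrite le_min => /andP[D1 D2].
set D := b / m.+1%:R in D1 D2.
have D0 : 0 <= D by rewrite divr_ge0.
pose bad i : R := \sum_(c <- s) (grid b m i < c <= grid b m i.+1)%R%:R.
have bad0 i : 0 <= bad i by apply: sumr_ge0.
apply: (@le_trans _ _ (\sum_(i < m.+1) (e1 + 2 * M * bad i) * D)).
  apply: ler_sum => i _.
  have gi : grid b m i <= grid b m i.+1 by exact: grid_nd.
  have gb := grid_le b0 (ltn_ord i).
  have g0 := @grid_ge0 b m i b0.
  have -> : (e1 + 2 * M * bad i) * D = \int[lebesgue_measure]_(x in `]grid b m i, grid b m i.+1]) (e1 + 2 * M * bad i).
    by rewrite Rintegral_grid.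
  apply: le_Rintegral => //.
  - exact: (@cadlag_integrable _ _ _ false false (cadlag_dist (v (grid b m i)) cv) g0).
  - exact: (@cadlag_integrable _ _ _ false false (cadlag_cst _) g0).
  move=> x /=; rewrite in_itv/= => /andP[x1 x2].
  have x0 : 0 <= x <= b by rewrite (le_trans g0 (ltW x1)) (le_trans x2).
  have [hb|hb] := boolP (has (fun c => grid b m i < c <= grid b m i.+1) s).
    have b1 : 1 <= bad i.
      rewrite /bad; move: hb; elim: s {hs K K0 hm0 D1 D2 bad bad0} => //= c s ih.
      rewrite big_cons; case: (boolP (grid b m i < c <= grid b m i.+1)) => /= _ h.
        by rewrite lerDl sumr_ge0.
      by rewrite add0r ih.
    apply: (@le_trans _ _ (2 * M)).
      apply: (le_trans (ler_normB _ _)).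
      have := hM x x0; have := hM (grid b m i); rewrite g0 (le_trans gi gb) => /(_ isT).
      lra.
    have : 2 * M * 1 <= 2 * M * bad i by rewrite ler_wpM2l// mulr_ge0.
    lra.
  apply: (@le_trans _ _ e1); last by rewrite lerDl mulr_ge0// mulr_ge0.
  apply: hs => //; [exact: ltW|by have /andP[] := x0| |].
    by move: x2; rewrite gridS -/D; lra.
  move=> c cs; apply: contra hb => /andP[c1 c2]; apply/hasP; exists c => //.
  by rewrite c1 (le_trans c2).
rewrite -mulr_suml big_split /= sumr_const card_ord -mulr_sumr.
have hbad : \sum_(i < m.+1) bad i <= (size s)%:R.
  rewrite /bad exchange_big /= -sum1_size natr_sum; apply: ler_sum => c _.
  have [h1 h2] := nondecreasing_block_sum (fun=> 1) c m.+1 (@grid_nd b m b0).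
  have eq1 : \sum_(i < m.+1) (grid b m i < c <= grid b m i.+1)%R%:R =
     \sum_(i < m.+1) 1 * (grid b m i < c <= grid b m i.+1)%R%:R :> R.
    by apply: eq_bigr => i _; rewrite mul1r.
  rewrite eq1.
  have [/h1[i _ [_ ->]]|/h2 ->] := boolP (grid b m 0 < c <= grid b m m.+1); by rewrite ?ler01.
have mD : m.+1%:R * D = b by rewrite /D; field.
rewrite mulrDl -[e1 *+ _]mulr_natr -[e1 * _ * D]mulrA mD.
have p1 : 2 * M * (\sum_(i < m.+1) bad i) * D <= K * D.
  rewrite ler_wpM2r// (@le_trans _ _ (2 * M * (size s)%:R))//; last by rewrite /K lerDl.
  by rewrite ler_wpM2l// mulr_ge0.
have p2 : K * D <= e / 2.
  have := ler_wpM2l (ltW K0) D2; have -> : K * (e / (2 * K)) = e / 2 by field; rewrite gt_eqF.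
  by [].
have p3 : e1 * b <= e / 2.
  have -> : e1 * b = (e / 2) * (b / (b + 1)) by rewrite /e1; field; lra.
  rewrite ler_piMr//; first lra.
  by rewrite ler_pdivrMr; lra.
lra.
Qed.

(** The bound sums over all cells, so it controls the error at every grid time simultaneously. *)
Lemma riemann_error v (b : R) m j : cadlag v -> 0 <= b -> (j <= m.+1)%N ->
  `|\int[lebesgue_measure]_(x in `[0, grid b m j]) v x -
    \sum_(i < j) v (grid b m i) * (b / m.+1%:R)| <=
  \sum_(i < m.+1) \int[lebesgue_measure]_(x in `]grid b m i, grid b m i.+1])
    `|v x - v (grid b m i)|.
Proof.
move=> cv b0 jm; rewrite sum_grid_itv// -sumrB.
apply: (le_trans (ler_norm_sum _ _ _)).
pose G i := \int[lebesgue_measure]_(x in `]grid b m i, grid b m i.+1])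
    `|v x - v (grid b m i)|.
apply: (@le_trans _ _ (\sum_(i < j) G i)); last first.
  rewrite (big_ord_widen m.+1 G jm) [leRHS](bigID (fun i : 'I_m.+1 => (i < j)%N))/=.
  rewrite lerDl sumr_ge0// => i _; apply: Rintegral_ge0 => x _; exact: normr_ge0.
apply: ler_sum => i _.
have g0 := @grid_ge0 b m i b0.
have gi : grid b m i <= grid b m i.+1 by exact: grid_nd.
have iv (k : R) := @cadlag_integrable v (grid b m i) (grid b m i.+1) false false cv g0.
have ik (k : R) := @cadlag_integrable (fun=> k) (grid b m i) (grid b m i.+1) false false (cadlag_cst k) g0.
have -> : v (grid b m i) * (b / m.+1%:R) =
    \int[lebesgue_measure]_(x in `]grid b m i, grid b m i.+1]) v (grid b m i).
  by rewrite Rintegral_grid.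
rewrite -RintegralB//; last exact: iv.
apply: le_normr_Rintegral => //.
exact: (@cadlag_integrable _ _ _ false false (cadlag_sub (v (grid b m i)) cv) g0).
Qed.

End cadlag_paths.

(** * Measurability and independence of increments *)

Section adaptedness.
Context {R : realType} {d : measure_display} {T : measurableType d}.
Variable G : set (set T).
Hypothesis sG : sigma_algebra setT G.
Implicit Types (X Y : T -> R).

(** [g_sigma_algebraType G] carries [G] itself as its measurable sets, since [G] is a sigma-algebra;
    the closure properties below are then inherited from ordinary measurability. *)
Lemma measurable_wrtE X :
  measurable_wrt G X <-> measurable_fun setT (X : g_sigma_algebraType G -> R).
Proof.
have GE : <<s G >> = G := sigma_algebra_id sG.
split=> [mX _ U mU|mX U mU].
  by rewrite setTI; change (<<s G >> (X @^-1` U)); rewrite GE; exact: mX.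
by have := mX measurableT U mU; rewrite setTI; change (<<s G >> (X @^-1` U) -> G (X @^-1` U)); rewrite GE.
Qed.

Lemma measurable_wrt_cst (k : R) : measurable_wrt G (fun=> k).
Proof. exact/measurable_wrtE. Qed.

Lemma measurable_wrtD X Y : measurable_wrt G X -> measurable_wrt G Y ->
  measurable_wrt G (fun w => X w + Y w).
Proof. by move=> /measurable_wrtE mX /measurable_wrtE mY; apply/measurable_wrtE; exact: measurable_funD. Qed.

Lemma measurable_wrtB X Y : measurable_wrt G X -> measurable_wrt G Y ->
  measurable_wrt G (fun w => X w - Y w).
Proof. by move=> /measurable_wrtE mX /measurable_wrtE mY; apply/measurable_wrtE; exact: measurable_funB. Qed.

Lemma measurable_wrtM X Y : measurable_wrt G X -> measurable_wrt G Y ->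
  measurable_wrt G (fun w => X w * Y w).
Proof. by move=> /measurable_wrtE mX /measurable_wrtE mY; apply/measurable_wrtE; exact: measurable_funM. Qed.

Lemma measurable_wrt_sum I (s : seq I) (h : I -> T -> R) :
  (forall i, measurable_wrt G (h i)) -> measurable_wrt G (fun w => \sum_(i <- s) h i w).
Proof.
move=> mh; apply/measurable_wrtE; apply: measurable_sum => i.
exact/measurable_wrtE.
Qed.

Lemma measurable_wrt_comp (u : R -> R) X : measurable_fun setT u ->
  measurable_wrt G X -> measurable_wrt G (u \o X).
Proof.
by move=> mu /measurable_wrtE mX; apply/measurable_wrtE; exact: measurableT_comp.
Qed.

Lemma measurable_wrt_indic (A : set T) : G A -> measurable_wrt G (\1_A : T -> R).
Proof.
move=> GA; apply/measurable_wrtE; apply: measurable_indic.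
by change (<<s G >> A); exact: sub_sigma_algebra.
Qed.

Lemma measurable_wrt_le X Y : measurable_wrt G X -> measurable_wrt G Y ->
  G [set w | X w <= Y w].
Proof.
move=> mX mY; have := measurable_wrtB mX mY (measurable_itv `]-oo, (0 : R)]).
by congr (G _); apply/seteqP; split=> w /=; rewrite in_itv/= subr_le0.
Qed.

Lemma sigma_algebraI (A B : set T) : G A -> G B -> G (A `&` B).
Proof.
have GE : <<s G >> = G := sigma_algebra_id sG.
move=> GA GB; rewrite -GE.
have mA : measurable (A : set (g_sigma_algebraType G)) by exact: sub_sigma_algebra.
have mB : measurable (B : set (g_sigma_algebraType G)) by exact: sub_sigma_algebra.
exact: measurableI mA mB.
Qed.

Lemma sigma_algebra_bigcap (I : set nat) (A : nat -> set T) :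
  (forall i, I i -> G (A i)) -> G (\bigcap_(i in I) A i).
Proof.
have GE : <<s G >> = G := sigma_algebra_id sG.
move=> GA; rewrite -GE.
have : measurable (\bigcap_(i in I) A i : set (g_sigma_algebraType G)).
  by apply: bigcap_measurableType => i Ii; apply: sub_sigma_algebra; exact: GA.
by [].
Qed.

End adaptedness.

Lemma measurable_wrtS {R : realType} {d} {T : measurableType d} (G G' : set (set T))
  (X : T -> R) : G `<=` G' -> measurable_wrt G X -> measurable_wrt G' X.
Proof. by move=> GG' mX U mU; exact/GG'/mX. Qed.

Lemma measurable_wrt_fun {R : realType} {d} {T : measurableType d} (G : set (set T))
  (X : T -> R) : G `<=` measurable -> measurable_wrt G X -> measurable_fun setT X.
Proof. by move=> GG' mX _ U mU; rewrite setTI; exact/GG'/mX. Qed.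

Lemma measurable_set_gt {R : realType} {d} {T : measurableType d} (X : T -> R) (c : R) :
  measurable_fun setT X -> measurable [set w | c < X w].
Proof.
move=> mX; have := mX measurableT _ (measurable_itv `]c, +oo[); rewrite setTI.
by congr measurable; apply/seteqP; split=> w /=; rewrite in_itv/= andbT.
Qed.

Lemma measurable_exists_norm_gt {R : realType} {d} {T : measurableType d}
  (X : nat -> T -> R) (c : R) (k : nat) :
  (forall j, (j <= k)%N -> measurable_fun setT (X j)) ->
  measurable [set w | exists2 j, (j <= k)%N & c < `|X j w|].
Proof.
move=> mX; rewrite (_ : [set w | _] =
  \bigcup_(j in [set j | (j <= k)%N]) [set w | c < `|X j w|]); last first.
  by apply/seteqP; split=> w /= [j jk h]; exists j.
apply: bigcup_measurable => j jk; apply: measurable_set_gt.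
by apply: (measurableT_comp (@normr_measurable R setT)); exact: mX.
Qed.

Section independence.
Context {R : realType} {d : measure_display} {T : measurableType d}.
Variables (P : probability T R) (G : set (set T)).
Hypothesis Gm : G `<=` measurable.

Lemma independent_expectation (xi W : T -> R) (psi : R -> R) (M : R) :
  measurable_wrt G xi -> (forall w, `|xi w| <= M) -> independent_of P G W ->
  measurable_fun setT psi -> P.-integrable setT (EFin \o (fun w => psi (W w))) ->
  P.-integrable setT (EFin \o (fun w => xi w * psi (W w))) /\
  \int[P]_w (xi w * psi (W w)) = (\int[P]_w xi w) * \int[P]_w psi (W w).
Proof.
move=> mxi bxi ind mpsi ipsi.
apply: independent_integralM => //.
  exact: (bounded_integrable _ (measurable_wrt_fun Gm mxi) bxi).
move=> U V mU mV.
have mpV : measurable (psi @^-1` V) by rewrite -[_ @^-1` _]setTI; exact: mpsi.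
exact: ind _ _ (mxi U mU) mpV.
Qed.

End independence.

Section increments.
Context {R : realType} {d : measure_display} {T : measurableType d}.
Variables (P : probability T R) (F : R -> set (set T)).
Hypothesis hF : filtration F.
Variables (s s' : R).
Hypotheses (s0 : 0 <= s) (ss' : s < s').
Let D := s' - s.
Let D0 : 0 < D. Proof. by rewrite subr_gt0. Qed.
Let s'0 : 0 <= s'. Proof. exact: le_trans (ltW ss'). Qed.

Section brownian.
Variable B : R -> T -> R.
Hypothesis hB : brownian_motion P F B.
Let W w := B s' w - B s w.

Lemma brownian_increment_measurable : measurable_fun setT W.
Proof.
by apply: measurable_funB;
  [exact: measurable_wrt_fun (filtration_measurable hF s'0) (brownian_adapted hB s'0)
  |exact: measurable_wrt_fun (filtration_measurable hF s0) (brownian_adapted hB s0)].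
Qed.

Let sq0 : 0 < Num.sqrt D. Proof. by rewrite sqrtr_gt0. Qed.
Let law (U : set R) : measurable U -> P (W @^-1` U) = normal_prob 0 (Num.sqrt D) U.
Proof. by move=> mU; exact: (brownian_law hB s0 ss' mU). Qed.

Lemma brownian_integrableX n : P.-integrable setT (EFin \o (fun w => W w ^+ n)).
Proof. exact: gauss_integrableX sq0 brownian_increment_measurable law n. Qed.

Lemma brownian_fourth : \int[P]_w (W w ^+ 4) <= 96 * D ^+ 2.
Proof.
have := gauss_fourth sq0 brownian_increment_measurable law.
by rewrite sqr_sqrtr// ltW.
Qed.

(** Bounded weights known at time [s] stand in for conditional expectation given the past. *)
Lemma brownian_expectation (xi : T -> R) (M : R) :
  measurable_wrt (F s) xi -> (forall w, `|xi w| <= M) ->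
  [/\ P.-integrable setT (EFin \o (fun w => xi w * W w)),
   \int[P]_w (xi w * W w) = 0,
   P.-integrable setT (EFin \o (fun w => xi w * W w ^+ 2)) &
   \int[P]_w (xi w * W w ^+ 2) = (\int[P]_w xi w) * D].
Proof.
move=> mxi bxi.
have Gm := filtration_measurable hF s0.
have ind := brownian_independent hB s0 ss'.
have [i1 e1] := independent_expectation Gm mxi bxi ind (@measurable_id _ _ _)
  (brownian_integrableX 1).
have m2 : measurable_fun setT (fun x : R => x ^+ 2) by exact: measurable_funX.
have [i2 e2] := independent_expectation Gm mxi bxi ind m2
  (brownian_integrableX 2).
split => //.
  by rewrite e1 (gauss_mean sq0 brownian_increment_measurable law) mulr0.
by rewrite e2 (gauss_var sq0 brownian_increment_measurable law) sqr_sqrtr// ltW.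
Qed.
End brownian.

Section poisson.
Variables (N : R -> T -> nat) (lambda : R).
Hypotheses (lambda0 : 0 < lambda) (hN : poisson_process P F lambda N).
Hypothesis Nmono : forall w, (N s w <= N s' w)%N.
(** The truncated subtraction is exact because [Nmono] holds at every [w]. *)
Let n w := (N s' w - N s w)%N.
Let x := lambda * D.
Let x0 : 0 < x. Proof. exact: mulr_gt0. Qed.

Let preimE k : [set w | n w = k] = [set w | N s' w = (N s w + k)%N].
Proof.
apply/seteqP; split=> w /=; rewrite /n => h; last by rewrite h addKn.
by rewrite -h subnKC.
Qed.

Lemma poisson_increment_measurable k : measurable [set w | n w = k].
Proof.
have m1 : measurable_fun setT (fun w => real_process N s' w - real_process N s w).
  by apply: measurable_funB;
    [exact: measurable_wrt_fun (filtration_measurable hF s'0) (poisson_adapted hN s'0)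
    |exact: measurable_wrt_fun (filtration_measurable hF s0) (poisson_adapted hN s0)].
have := m1 measurableT [set (k%:R : R)] (measurable_set1 _); rewrite setTI.
congr measurable; rewrite preimE; apply/seteqP; split=> w /=; rewrite /real_process.
  by move/eqP; rewrite subr_eq -natrD eqr_nat addnC => /eqP.
by move=> ->; rewrite natrD addrC addKr.
Qed.

Lemma poisson_increment_integrable k :
  P.-integrable setT (EFin \o (fun w => (n w == k)%:R)).
Proof.
apply: (@bounded_integrable _ _ _ P _ 1); last first.
  by move=> w; case: eqP => _; rewrite ?normr1 ?normr0.
have := @measurable_indic _ _ R setT _ (poisson_increment_measurable k).
apply: eq_measurable_fun => w _; rewrite indicE; congr (_%:R); congr nat_of_bool.
by apply/idP/eqP; rewrite inE.
Qed.

Lemma poisson_increment_law k : \int[P]_w (n w == k)%:R = poisson_pmf x k.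
Proof.
rewrite /Rintegral (eq_integral (fun w => (\1_[set w | n w = k] w : R)%:E)); last first.
  move=> w _; congr EFin; rewrite indicE; congr (_%:R); congr nat_of_bool.
  by apply/eqP/idP; rewrite inE.
rewrite integral_indic//; last exact: poisson_increment_measurable.
transitivity (fine (poisson_pmf x k)%:E) => //.
by congr fine; rewrite setIT preimE; exact: (poisson_law hN k s0 ss').
Qed.

Lemma poisson_increment1 : \int[P]_w (n w == 1%N)%:R <= x /\
  x - x ^+ 2 <= \int[P]_w (n w == 1%N)%:R.
Proof.
rewrite poisson_increment_law /poisson_pmf x0 expr1 (_ : (1`!)%:R = 1 :> R)// invr1 mulr1.
have := expR_ge1Dx (- x); have : expR (- x) <= 1 by rewrite expR_le1 oppr_le0 ltW.
move=> h1 h2; split; first by rewrite ler_piMr// ltW.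
have := ler_wpM2l (ltW x0) h2; lra.
Qed.

Lemma poisson_increment_ge2 :
  P.-integrable setT (EFin \o (fun w => (1 < n w)%N%:R)) /\
  \int[P]_w (1 < n w)%N%:R <= x ^+ 2.
Proof.
have E : (fun w => (1 < n w)%N%:R) = (fun w => 1 - (n w == 0%N)%:R - (n w == 1%N)%:R) :> (T -> R).
  by apply/funext => w; case: (n w) => [|[|k]] //=; rewrite ?subrr ?subr0 ?sub0r ?subr0 ?subrr//; lra.
have i0 := integrableBR (integrable_cstR P 1) (poisson_increment_integrable 0).
have i1 := integrableBR i0 (poisson_increment_integrable 1).
rewrite E; split => //.
rewrite (expectBR i0 (poisson_increment_integrable 1)).
rewrite (expectBR (integrable_cstR P 1) (poisson_increment_integrable 0)).
rewrite !poisson_increment_law Rintegral_cst_prob /poisson_pmf x0 expr0 expr1 (_ : (1`!)%:R = 1 :> R)// ?(_ : (0`!)%:R = 1 :> R)// invr1 !mulr1 mul1r.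
have h2 := expR_ge1Dx (- x).
have h3 : x * (1 - x) <= x * expR (- x) by rewrite ler_wpM2l// ltW.
lra.
Qed.

Lemma poisson_expectation (xi : T -> R) (M : R) :
  measurable_wrt (F s) xi -> (forall w, `|xi w| <= M) ->
  P.-integrable setT (EFin \o (fun w => xi w * (n w == 1%N)%:R)) /\
   \int[P]_w (xi w * (n w == 1%N)%:R) = (\int[P]_w xi w) * \int[P]_w (n w == 1%N)%:R.
Proof.
move=> mxi bxi.
have Gm := filtration_measurable hF s0.
have ind := poisson_independent hN s0 ss'.
have mp : measurable_fun setT (\1_[set (1 : R)] : R -> R).
  by apply: measurable_indic; exact: measurable_set1.
have E w : (\1_[set (1 : R)] (real_process N s' w - real_process N s w)) = (n w == 1%N)%:R :> R.
  rewrite indicE; congr (_%:R); congr nat_of_bool; rewrite /real_process /n -natrB//.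
  by apply/idP/eqP => [|->]; rewrite inE //= => /eqP; rewrite pnatr_eq1 => /eqP.
have fE : (fun w => \1_[set (1 : R)] (real_process N s' w - real_process N s w)) =
    (fun w => (n w == 1%N)%:R) :> (T -> R) by apply/funext => w; exact: E.
have := independent_expectation Gm mxi bxi ind mp.
rewrite fE => /(_ (poisson_increment_integrable 1)) [i1 e1].
have fE2 : (fun w => xi w * \1_[set (1 : R)] (real_process N s' w - real_process N s w)) =
    (fun w => xi w * (n w == 1%N)%:R) :> (T -> R) by apply/funext => w; rewrite E.
by rewrite fE2 in i1 e1.
Qed.
End poisson.
End increments.

(** * One step in expectation *)

Section expectation_values.
Context {R : realType} {d : measure_display} {T : measurableType d}.
Variable P : probability T R.
Implicit Types (X Y : T -> R) (a b : R).

(** Integrability travels with the value, so the expectation of a long linear combination is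
    assembled without separate integrability goals. *)
Definition has_expectation X a :=
  P.-integrable setT (EFin \o X) /\ \int[P]_w X w = a.

Lemma has_expectationD X Y a b : has_expectation X a -> has_expectation Y b ->
  has_expectation (fun w => X w + Y w) (a + b).
Proof.
by move=> [iX EX] [iY EY]; split; [exact: integrableDR|rewrite (expectDR iX iY) EX EY].
Qed.

Lemma has_expectationZ X a (k : R) : has_expectation X a ->
  has_expectation (fun w => k * X w) (k * a).
Proof.
by move=> [iX EX]; split; [exact: integrableZR|rewrite (expectZR k iX) EX].
Qed.

Lemma has_expectation_cst (k : R) : has_expectation (fun=> k) k.
Proof. by split; [exact: integrable_cstR|exact: Rintegral_cst_prob]. Qed.

Lemma has_expectation_le X Y a b : has_expectation X a -> has_expectation Y b ->
  (forall w, X w <= Y w) -> a <= b.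
Proof. by move=> [iX <-] [iY <-] XY; exact: expect_leR. Qed.

Lemma has_expectation_bounded X M : measurable_fun setT X ->
  (forall w, `|X w| <= M) -> has_expectation X (\int[P]_w X w).
Proof. by move=> mX bX; split => //; exact: bounded_integrable bX. Qed.

End expectation_values.

Lemma ler_dist_itv {R : realDomainType} (M a b : R) :
  0 <= a <= M -> 0 <= b <= M -> `|a - b| <= M.
Proof. by move=> /andP[? ?] /andP[? ?]; rewrite ler_norml; apply/andP; split; lra. Qed.

Lemma step_rearrange {R : realFieldType} (PX Px p1 a D be W W2 p2 J n1 e k Q : R) :
  PX - Px <= p1 * a * D + p1 * be * W + p2 * be ^+ 2 / 2 * W2 + J * n1 + e * (D + W2 + n1) + k * Q ->
  PX <= Px + D * (p1 * a) + p1 * be * W + p2 * (be * be * 2^-1) * W2 + J * n1 +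
    e * (D + W2 + n1) + k * Q.
Proof. by rewrite lerBlDl => /le_trans; apply; rewrite le_eqVlt; apply/orP; left; apply/eqP; ring. Qed.

(** Here [q1] and [q2] are the probabilities of one and of several jumps. Replacing [q1] by [l * D]
    in the jump term costs [M * (l * D) ^+ 2], and the slack [D + D + q1] is at most [(2 + l) * D],
    hence the choice of [e']. *)
Lemma step_total {R : realFieldType} (EZ E1 E3 E4 D q1 q2 m4 e e' k K M l : R) :
  0 <= D -> 0 <= k -> 0 <= e' -> e' * (2 + l) = e ->
  E1 + E3 + l * E4 <= K - EZ -> `|E4| <= M -> q1 <= l * D ->
  l * D - (l * D) ^+ 2 <= q1 -> q2 <= (l * D) ^+ 2 -> m4 <= 96 * D ^+ 2 ->
  EZ + D * E1 + 0 + E3 * D + E4 * q1 + e' * (D + D + q1) + k * (m4 + q2) <=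
  (1 - D) * EZ + (K + e) * D + (k * (96 + l ^+ 2) + M * l ^+ 2) * D ^+ 2.
Proof.
move=> D0 k0 e0 <- hg E4M q1u q1l hq2 hm4.
have h1 := ler_wpM2l D0 hg.
have h2 : E4 * (q1 - l * D) <= M * (l * D) ^+ 2.
  apply: le_trans (ler_norm _) _; rewrite normrM; apply: ler_pM => //.
  by rewrite ler_norml; apply/andP; split; lra.
have h3 := ler_wpM2l e0 q1u.
have h4 : k * (m4 + q2) <= k * (96 * D ^+ 2 + (l * D) ^+ 2) by rewrite ler_wpM2l// lerD.
lra.
Qed.

Section one_step_expectation.
Context {R : realType} {d : measure_display} {T : measurableType d}.
Variables (P : probability T R) (F : R -> set (set T)).
Hypothesis hF : filtration F.
Variables (B : R -> T -> R) (lambda : R) (N : R -> T -> nat).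
Hypotheses (hB : brownian_motion P F B) (lambda0 : 0 < lambda)
  (hN : poisson_process P F lambda N)
  (Nmono : forall w (s t : R), 0 <= s -> s <= t -> (N s w <= N t w)%N).
Variables (phi phi1 phi2 f g : R -> R) (M delta : R).
Hypotheses (phiM : forall x, 0 <= phi x <= M)
  (dphi : forall x : R, 0 < x -> is_derive x 1 phi (phi1 x))
  (dphi1 : forall x : R, 0 < x -> is_derive x 1 phi1 (phi2 x))
  (cphi2 : forall x : R, 0 < x -> {for x, continuous phi2})
  (cf : forall x : R, 0 < x -> {for x, continuous f})
  (cg : forall x : R, 0 < x -> {for x, continuous g})
  (mphi : measurable_fun setT phi) (mphi1 : measurable_fun setT phi1)
  (mphi2 : measurable_fun setT phi2) (mf : measurable_fun setT f)
  (mg : measurable_fun setT g) (delta0 : 0 <= delta).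

(** The derivatives are taken at the scheme [x] and the coefficients at the solution [v]; on the
    diagonal this is the generator of the equation applied to [phi]. *)
Definition generator (x v : R) : R :=
  phi1 x * f v + phi2 x * g v ^+ 2 / 2 + lambda * (phi (x + delta * v) - phi x).

(** The event [A] confines both points to a compact set and is known at time [s], so every
    coefficient multiplied by [\1_A] is an admissible bounded weight for the increment moments. *)
Lemma one_step_expectation (c C e K : R) : 0 < c -> 0 < e -> 0 <= K ->
  exists2 D0 : R, 0 < D0 & exists2 kap : R, 0 <= kap &
  forall (s s' : R) (A : set T) (x v : T -> R), 0 <= s -> s < s' -> s' - s <= D0 ->
    F s A -> measurable_wrt (F s) x -> measurable_wrt (F s) v ->
    (forall w, A w -> [/\ c <= x w <= C, c <= v w <= C &
       generator (x w) (v w) <= K - phi (x w)]) ->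
    \int[P]_w (\1_A w * phi (x w + (f (v w) * (s' - s) + g (v w) * (B s' w - B s w) +
        delta * v w * ((N s' w)%:R - (N s w)%:R)))) <=
    (1 - (s' - s)) * \int[P]_w (\1_A w * phi (x w)) +
    (K + e) * (s' - s) + kap * (s' - s) ^+ 2.
Proof.
move=> c0 e0 K0.
have M0 : 0 <= M by have /andP[p0 pM] := phiM 0; exact: le_trans pM.
have [Af Af0 hAf] : exists2 L : R, 0 < L & forall x, c <= x <= C -> `|f x| <= L.
  by apply: bounded_itv => x /andP[cx _]; apply: cf; exact: lt_le_trans cx.
have [Ag Ag0 hAg] : exists2 L : R, 0 < L & forall x, c <= x <= C -> `|g x| <= L.
  by apply: bounded_itv => x /andP[cx _]; apply: cg; exact: lt_le_trans cx.
have [L1 L10 hL1] : exists2 L : R, 0 < L & forall x, c <= x <= C -> `|phi1 x| <= L.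
  apply: bounded_itv => x /andP[cx _].
  exact: is_derive_continuous (dphi1 (lt_le_trans c0 cx)).
have [L2 L20 hL2] : exists2 L : R, 0 < L & forall x, c <= x <= C -> `|phi2 x| <= L.
  by apply: bounded_itv => x /andP[cx _]; apply: cphi2; exact: lt_le_trans cx.
have l2 : 0 < 2 + lambda by rewrite addr_gt0.
pose e' := e / (2 + lambda).
have e'0 : 0 < e' by rewrite divr_gt0.
have Af0' : 0 <= Af by exact: ltW.
have Ag0' : 0 <= Ag by exact: ltW.
have [D0 D00 [kap kap0 step]] := @one_step_ineq R phi phi1 phi2 M c C Af Ag delta e' phiM dphi dphi1 cphi2 c0 Af0' Ag0' delta0 e'0.
exists D0 => //; exists (kap * (96 + lambda ^+ 2) + M * lambda ^+ 2).
  by rewrite addr_ge0// mulr_ge0// ?addr_ge0// sqr_ge0.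
move=> s s' A x v s0 ss' sD FA mx mv hA.
set D := s' - s in sD *.
have Dgt0 : 0 < D by rewrite subr_gt0.
have Dge0 := ltW Dgt0.
pose W w := B s' w - B s w.
pose n w := (N s' w - N s w)%N.
have sG := filtration_sigma_algebra hF s0.
have Gm := filtration_measurable hF s0.
have s'0 : 0 <= s' by exact: le_trans (ltW ss').
have Nm w : (N s w <= N s' w)%N by exact: Nmono (ltW ss').
have mA := measurable_wrt_indic (R := R) sG FA.
have bA (X : T -> R) (L : R) : 0 <= L -> (forall w, A w -> `|X w| <= L) ->
    forall w, `|\1_A w * X w| <= L.
  move=> L0 h w; rewrite indicE; have [wA|wA] := boolP (w \in A).
    by rewrite mul1r; apply: h; rewrite inE in wA.
  by rewrite mul0r normr0.
have mphix := measurable_wrt_comp sG mphi mx.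
have mp1 := measurable_wrt_comp sG mphi1 mx.
have mp2 := measurable_wrt_comp sG mphi2 mx.
have ma := measurable_wrt_comp sG mf mv.
have mb := measurable_wrt_comp sG mg mv.
have mJ : measurable_wrt (F s) (fun w => phi (x w + delta * v w) - phi (x w)).
  apply: measurable_wrtB => //.
  apply: (@measurable_wrt_comp _ _ _ _ sG phi (fun w => x w + delta * v w)) => //.
  apply: measurable_wrtD => //; apply: measurable_wrtM => //; exact: measurable_wrt_cst.
pose xi1 w := \1_A w * (phi1 (x w) * f (v w)).
pose xi2 w := \1_A w * (phi1 (x w) * g (v w)).
pose xi3 w := \1_A w * (phi2 (x w) * (g (v w) * g (v w) * 2^-1)).
pose xi4 w := \1_A w * (phi (x w + delta * v w) - phi (x w)).
have mxi1 : measurable_wrt (F s) xi1 by do 2 (apply: measurable_wrtM => //).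
have mxi2 : measurable_wrt (F s) xi2 by do 2 (apply: measurable_wrtM => //).
have mxi3 : measurable_wrt (F s) xi3.
  do 2 (apply: measurable_wrtM => //); apply: measurable_wrtM => //; last exact: measurable_wrt_cst.
  exact: measurable_wrtM.
have mxi4 : measurable_wrt (F s) xi4 by apply: measurable_wrtM.
have L10' := ltW L10; have L20' := ltW L20.
have bxi1 w : `|xi1 w| <= L1 * Af.
  apply: (bA (fun w => phi1 (x w) * f (v w))); first exact: mulr_ge0.
  by move=> u /hA[hx hv _]; rewrite normrM ler_pM// ?hL1 ?hAf.
have bxi2 w : `|xi2 w| <= L1 * Ag.
  apply: (bA (fun w => phi1 (x w) * g (v w))); first exact: mulr_ge0.
  by move=> u /hA[hx hv _]; rewrite normrM ler_pM// ?hL1 ?hAg.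
have bxi3 w : `|xi3 w| <= L2 * (Ag * Ag * 2^-1).
  apply: (bA (fun w => phi2 (x w) * (g (v w) * g (v w) * 2^-1))); first by rewrite mulr_ge0// mulr_ge0// mulr_ge0.
  move=> u /hA[hx hv _]; rewrite normrM ler_pM// ?hL2// normrM [`|2^-1|]gtr0_norm// ler_pM2r//.
  by rewrite normrM ler_pM// ?hAg.
have dM (p q : R) : `|phi p - phi q| <= M by exact: ler_dist_itv.
have bxi4 w : `|xi4 w| <= M by exact: (bA (fun w => phi (x w + delta * v w) - phi (x w))).
have mZ : measurable_wrt (F s) (fun w => \1_A w * phi (x w)) by apply: measurable_wrtM.
have bZ w : `|\1_A w * phi (x w)| <= M.
  by apply: (bA (fun w => phi (x w))) => // u _; have /andP[u1 u2] := phiM (x u); rewrite ger0_norm.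
set EZ := \int[P]_w (\1_A w * phi (x w)).
have hZ : has_expectation P (fun w => \1_A w * phi (x w)) EZ.
  by apply: has_expectation_bounded bZ; exact: measurable_wrt_fun Gm mZ.
have h1 : has_expectation P xi1 (\int[P]_w xi1 w).
  by apply: has_expectation_bounded bxi1; exact: measurable_wrt_fun Gm mxi1.
have h3 : has_expectation P xi3 (\int[P]_w xi3 w).
  by apply: has_expectation_bounded bxi3; exact: measurable_wrt_fun Gm mxi3.
have h4 : has_expectation P xi4 (\int[P]_w xi4 w).
  by apply: has_expectation_bounded bxi4; exact: measurable_wrt_fun Gm mxi4.
have hW2 : has_expectation P (fun w => xi2 w * W w) 0.
  by have [i1 E1 _ _] := brownian_expectation hF s0 ss' hB mxi2 bxi2.
have hW3 : has_expectation P (fun w => xi3 w * W w ^+ 2) ((\int[P]_w xi3 w) * D).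
  by have [_ _ i1 E1] := brownian_expectation hF s0 ss' hB mxi3 bxi3.
have hW : has_expectation P (fun w => W w ^+ 2) D.
  have h1' (w : T) : `|(1 : R)| <= 1 by rewrite normr1.
  have [_ _ i1 E1] := brownian_expectation hF s0 ss' hB (measurable_wrt_cst sG 1) h1'.
  have Eq : (fun w => 1 * (B s' w - B s w) ^+ 2) = (fun w => W w ^+ 2).
    by apply/funext => w; rewrite mul1r.
  by rewrite Eq in i1 E1; split; rewrite // E1 Rintegral_cst_prob mul1r.
set m4 := \int[P]_w (W w ^+ 4).
have hW4 : has_expectation P (fun w => W w ^+ 4) m4.
  by split => //; exact: (brownian_integrableX hF s0 ss' hB 4%N).
have m4D : m4 <= 96 * D ^+ 2 by exact: (brownian_fourth hF s0 ss' hB).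
set q1 := \int[P]_w (n w == 1%N)%:R.
have hn1 : has_expectation P (fun w => (n w == 1%N)%:R) q1.
  by split => //; exact: (poisson_increment_integrable hF s0 ss' hN Nm).
have [q1u q1l] := poisson_increment1 hF s0 ss' lambda0 hN Nm.
rewrite -/D -/(n _) -/q1 in q1u q1l.
have [in2 q2u] := poisson_increment_ge2 hF s0 ss' lambda0 hN Nm.
set q2 := \int[P]_w (1 < n w)%N%:R in q2u.
have hn2 : has_expectation P (fun w => (1 < n w)%N%:R) q2 by split.
have hn4 : has_expectation P (fun w => xi4 w * (n w == 1%N)%:R) ((\int[P]_w xi4 w) * q1).
  exact: (poisson_expectation hF s0 ss' hN Nm mxi4 bxi4).
(* The order of the summands matches the right side of [step_rearrange]. *)
have hU := has_expectationD (has_expectationD (has_expectationD (has_expectationD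
   (has_expectationD (has_expectationD hZ (has_expectationZ D h1)) hW2) hW3) hn4)
   (has_expectationZ e' (has_expectationD (has_expectationD (has_expectation_cst P D) hW) hn1)))
   (has_expectationZ kap (has_expectationD hW4 hn2)).
set LHS := (X in X <= _).
have hL : has_expectation P (fun w => \1_A w * phi (x w + (f (v w) * D + g (v w) * (B s' w - B s w) +
        delta * v w * ((N s' w)%:R - (N s w)%:R)))) LHS.
  apply: (@has_expectation_bounded _ _ _ P _ M); last first.
    apply: (bA (fun w => phi (x w + (f (v w) * D + g (v w) * (B s' w - B s w) +
        delta * v w * ((N s' w)%:R - (N s w)%:R))))) => // u _; have /andP[u1 u2] := phiM (x u + (f (v u) * D + g (v u) * (B s' u - B s u) +
        delta * v u * ((N s' u)%:R - (N s u)%:R))).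
    by rewrite ger0_norm.
  apply: measurable_funM; first exact: measurable_wrt_fun Gm mA.
  apply: measurableT_comp => //.
  apply: measurable_funD; first exact: measurable_wrt_fun Gm mx.
  apply: measurable_funD; last first.
    apply: measurable_funM; first by apply: measurable_funM => //; exact: measurable_wrt_fun Gm mv.
    by apply: measurable_funB;
      [exact: measurable_wrt_fun (filtration_measurable hF s'0) (poisson_adapted hN s'0)
      |exact: measurable_wrt_fun Gm (poisson_adapted hN s0)].
  apply: measurable_funD; first by apply: measurable_funM => //; exact: measurable_wrt_fun Gm ma.
  apply: measurable_funM; first exact: measurable_wrt_fun Gm mb.
  exact: (brownian_increment_measurable hF s0 ss' hB).
have := has_expectation_le hL hU.
have W40 w : 0 <= W w ^+ 4 by exact: exprn_even_ge0.
have W20 w : 0 <= W w ^+ 2 by exact: sqr_ge0.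
move=> /(_ _)/le_trans main; apply: main => [w|].
  rewrite /xi1 /xi2 /xi3 /xi4 !indicE; have [wA|wA] := boolP (w \in A); last first.
    rewrite !mul0r mulr0 !add0r; apply: addr_ge0; apply: mulr_ge0 => //;
      [exact: ltW|by rewrite addr_ge0// addr_ge0|by rewrite addr_ge0].
  have [hx hv _] := hA w (set_mem wA).
  have hv0 : 0 <= v w <= C by have /andP[h5 h6] := hv; rewrite h6 andbT; exact: le_trans (ltW c0) h5.
  have hD : 0 <= D <= D0 by rewrite Dge0.
  have := step (x w) (v w) (f (v w)) (g (v w)) D (W w) (n w) hx hv0 (hAf _ hv) (hAg _ hv) hD.
  rewrite !mul1r /n natrB// -/(W w) => st.
  exact: step_rearrange.
apply: step_total => //; first by rewrite ltW.
- by rewrite /e' divfK// gt_eqF.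
- have hK : has_expectation P (fun w => K - \1_A w * phi (x w)) (K + - EZ).
    have -> : - EZ = -1 * EZ by rewrite mulN1r.
    have := has_expectationD (has_expectation_cst P K) (has_expectationZ (-1) hZ).
    by rewrite (_ : (fun w => K + -1 * _) = (fun w => K - \1_A w * phi (x w)))//; apply/funext => w; rewrite mulN1r.
  apply: (has_expectation_le (has_expectationD (has_expectationD h1 h3) (has_expectationZ lambda h4)) hK) => w.
  rewrite /xi1 /xi3 /xi4 !indicE; have [wA|wA] := boolP (w \in A); last first.
    by rewrite !mul0r mulr0 !addr0 subr0.
  have [_ _] := hA w (set_mem wA); rewrite /generator expr2 !mul1r.
  by move=> h; apply: le_trans h; rewrite !mulrA.
- rewrite ler_norml; apply/andP; split.
    apply: (has_expectation_le (has_expectation_cst P (- M)) h4).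
    by move=> w; have := bxi4 w; rewrite ler_norml => /andP[].
  apply: (has_expectation_le h4 (has_expectation_cst P M)).
  by move=> w; have := bxi4 w; rewrite ler_norml => /andP[].
Qed.
End one_step_expectation.

(** * A Lenglart inequality for martingale transforms *)

Section lenglart.
Context {R : realType} {d : measure_display} {T : measurableType d}.
Variables (P : probability T R) (F : R -> set (set T)).
Hypothesis hF : filtration F.
Variable B : R -> T -> R.
Hypothesis hB : brownian_motion P F B.
Variables (u : nat -> R) (xi : nat -> T -> R).
Hypotheses (u0 : 0 <= u 0%N) (u_nd : {homo u : i j / (i <= j)%N >-> i <= j})
  (mxi : forall i, measurable_wrt (F (u i)) (xi i)).

Definition transform j w := \sum_(i < j) xi i w * (B (u i.+1) w - B (u i) w).
Definition quadratic_variation j w := \sum_(i < j) xi i w ^+ 2 * (u i.+1 - u i).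

Variables (eps C : R).
Hypotheses (eps0 : 0 < eps) (C0 : 0 < C).

(** The test on step [i] looks at the quadratic variation including that step, which is already
    known at time [u i]; so the variation of the stopped transform never passes [C]. Once [stopped]
    exceeds [eps], all later coefficients vanish and it stays there. *)
Fixpoint stopped j w := if j is i.+1 then
    stopped i w + (if (quadratic_variation i.+1 w <= C) && (`|stopped i w| <= eps)
                   then xi i w else 0) * (B (u i.+1) w - B (u i) w)
  else 0.

Definition stopped_coef i w :=
  if (quadratic_variation i.+1 w <= C) && (`|stopped i w| <= eps) then xi i w else 0.

Let uge0 i : 0 <= u i. Proof. by apply: le_trans u0 _; exact: u_nd. Qed.
Let sG i := filtration_sigma_algebra hF (uge0 i).
Let Gm i := filtration_measurable hF (uge0 i).
Let FS i j : (i <= j)%N -> F (u i) `<=` F (u j).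
Proof. by move=> ij; apply: (filtration_nondecreasing hF (uge0 i)); exact: u_nd. Qed.
Let Du i : 0 <= u i.+1 - u i. Proof. by rewrite subr_ge0 u_nd. Qed.

Lemma measurable_wrt_transform j : measurable_wrt (F (u j)) (transform j).
Proof.
apply: (@measurable_wrt_sum _ _ _ _ (sG j) _ _ (fun i : 'I_j => fun w => xi i w * (B (u i.+1) w - B (u i) w))) => i.
apply: (measurable_wrtM (sG j)); first exact: measurable_wrtS (FS (ltnW (ltn_ord i))) (mxi i).
apply: (measurable_wrtB (sG j)).
  exact: measurable_wrtS (FS (ltn_ord i)) (brownian_adapted hB (uge0 _)).
exact: measurable_wrtS (FS (ltnW (ltn_ord i))) (brownian_adapted hB (uge0 _)).
Qed.

(** The index is one ahead of the time: the last summand uses [xi j], known at [u j], and a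
    deterministic length. This predictability allows stopping before [C] is passed. *)
Lemma measurable_wrt_quadratic_variation j :
  measurable_wrt (F (u j)) (quadratic_variation j.+1).
Proof.
apply: (@measurable_wrt_sum _ _ _ _ (sG j) _ _ (fun i : 'I_j.+1 => fun w => xi i w ^+ 2 * (u i.+1 - u i))) => i.
apply: (measurable_wrtM (sG j)); last exact: measurable_wrt_cst (sG j) _.
have m : measurable_wrt (F (u j)) (xi i).
  by apply: measurable_wrtS (mxi i); apply: FS; rewrite -ltnS.
exact (measurable_wrtM (sG j) m m).
Qed.

Lemma quadratic_variation_nd w : {homo quadratic_variation ^~ w : i j / (i <= j)%N >-> i <= j}.
Proof.
apply: homo_leq => //; first exact: le_trans.
by move=> i; rewrite /quadratic_variation big_ord_recr/= lerDl mulr_ge0// sqr_ge0.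
Qed.

Let active i := [set w | quadratic_variation i.+1 w <= C] `&` [set w | `|stopped i w| <= eps].

Lemma stopped_coefE i : stopped_coef i = fun w => \1_(active i) w * xi i w.
Proof.
apply/funext => w; rewrite /stopped_coef indicE.
have -> : (w \in active i) = (quadratic_variation i.+1 w <= C) && (`|stopped i w| <= eps).
  by apply/idP/andP => [|h]; rewrite inE.
by case: ifP; rewrite ?mul1r ?mul0r.
Qed.

Lemma measurable_wrt_stopped i : measurable_wrt (F (u i)) (stopped i) /\
  measurable_wrt (F (u i)) (stopped_coef i).
Proof.
have key j : measurable_wrt (F (u j)) (stopped j) -> measurable_wrt (F (u j)) (stopped_coef j).
  move=> mS; rewrite stopped_coefE; apply: (measurable_wrtM (sG j)) => //.
  apply: (measurable_wrt_indic (sG j)).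
  apply: (sigma_algebraI (sG j)).
    exact: (measurable_wrt_le (sG j) (measurable_wrt_quadratic_variation j) (measurable_wrt_cst (sG j) C)).
  apply: (measurable_wrt_le (sG j) _ (measurable_wrt_cst (sG j) eps)).
  exact: (measurable_wrt_comp (sG j) (@normr_measurable R setT)).
suff h : measurable_wrt (F (u i)) (stopped i) by split => //; exact: key.
elim: i => [|i IH]; first exact: measurable_wrt_cst (sG 0%N) 0.
apply: (measurable_wrtD (sG i.+1)); first exact: measurable_wrtS (FS (leqnSn i)) IH.
apply: (measurable_wrtM (sG i.+1)); first exact: measurable_wrtS (FS (leqnSn i)) (key i IH).
apply: (measurable_wrtB (sG i.+1)); first exact: (brownian_adapted hB).
exact: measurable_wrtS (FS (leqnSn i)) (brownian_adapted hB (uge0 _)).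
Qed.

Lemma stopped_coef_sqr i w : stopped_coef i w ^+ 2 * (u i.+1 - u i) <= C.
Proof.
rewrite /stopped_coef; case: ifP => [/andP[h _]|_]; last by rewrite expr0n mul0r ltW.
apply: le_trans h; rewrite /quadratic_variation big_ord_recr/= lerDr sumr_ge0// => j _.
by rewrite mulr_ge0// sqr_ge0.
Qed.

Lemma stopped_quadratic_variation j w :
  \sum_(i < j) stopped_coef i w ^+ 2 * (u i.+1 - u i) <= C.
Proof.
elim: j => [|j IH]; first by rewrite big_ord0 ltW.
rewrite big_ord_recr/= {2}/stopped_coef; case: ifP => [/andP[h _]|_].
  apply: le_trans h; rewrite /quadratic_variation [leRHS]big_ord_recr/= lerD2r.
  apply: ler_sum => i _; rewrite /stopped_coef; case: ifP => // _.
  by rewrite expr0n mul0r mulr_ge0// sqr_ge0.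
by rewrite expr0n mul0r addr0.
Qed.

(** A discrete Ito isometry. The cross term has zero mean because its weight
    [stopped j * stopped_coef j] is bounded: the coefficient vanishes where [stopped j] exceeds
    [eps], and its square times the length is at most [C]. *)
Lemma stopped_second_moment j : exists v : R,
  has_expectation P (fun w => stopped j w ^+ 2) v /\
  has_expectation P (fun w => \sum_(i < j) stopped_coef i w ^+ 2 * (u i.+1 - u i)) v.
Proof.
elim: j => [|j [v [h1 h2]]].
  exists 0; split.
    by rewrite /= expr0n; exact: has_expectation_cst.
  rewrite (_ : (fun w => _) = (fun=> 0)); first exact: has_expectation_cst.
  by apply/funext => w; rewrite big_ord0.
have [mS mc] := measurable_wrt_stopped j.
(* The sorted times may repeat; a cell of length zero contributes nothing, and the laws of the
   increments are available only for strictly ordered times. *)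
have [E|uS] := eqVneq (u j.+1) (u j).
  exists v; split.
    rewrite (_ : (fun w => _) = (fun w => stopped j w ^+ 2))//.
    by apply/funext => w /=; rewrite E subrr mulr0 addr0.
  rewrite (_ : (fun w => _) = (fun w => \sum_(i < j) stopped_coef i w ^+ 2 * (u i.+1 - u i)))//.
  by apply/funext => w; rewrite big_ord_recr/= E subrr mulr0 addr0.
have uS' : u j < u j.+1 by rewrite lt_neqAle eq_sym uS u_nd.
have D0 : 0 < u j.+1 - u j by rewrite subr_gt0.
set D := u j.+1 - u j in D0.
have bc w : `|stopped_coef j w| ^+ 2 <= C / D.
  by rewrite real_normK ?num_real// ler_pdivlMr//; exact: stopped_coef_sqr.
have CD0 : 0 <= C / D by rewrite divr_ge0// ltW.
have bc1 w : `|stopped_coef j w| <= 1 + C / D.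
  have [h|h] := leP `|stopped_coef j w| 1; first by apply: le_trans h _; rewrite lerDl.
  apply: le_trans (_ : `|stopped_coef j w| ^+ 2 <= _).
    by rewrite expr2 ler_peMr// ltW.
  by apply: le_trans (bc w) _; rewrite lerDr.
have bSc w : `|stopped j w * stopped_coef j w| <= eps * (1 + C / D).
  rewrite normrM; have := bc1 w; rewrite /stopped_coef; case: ifP => [/andP[_ h] h'|_ _].
    exact: ler_pM.
  by rewrite normr0 mulr0 mulr_ge0// ?addr_ge0// ltW.
have mSc := measurable_wrtM (sG j) mS mc.
have mc2 := measurable_wrtM (sG j) mc mc.
have bc2 w : `|stopped_coef j w * stopped_coef j w| <= C / D.
  by rewrite normrM -expr2.
have [i1 E1 _ _] := brownian_expectation hF (uge0 j) uS' hB mSc bSc.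
have [_ _ i3 E3] := brownian_expectation hF (uge0 j) uS' hB mc2 bc2.
have hX : has_expectation P (fun w => stopped_coef j w * stopped_coef j w) (\int[P]_w (stopped_coef j w * stopped_coef j w)).
  apply: has_expectation_bounded bc2.
  exact: (measurable_wrt_fun (@Gm j) mc2).
exists (v + (\int[P]_w (stopped_coef j w * stopped_coef j w)) * D); split.
  have h4 : has_expectation P (fun w => stopped j w * stopped_coef j w * (B (u j.+1) w - B (u j) w)) 0 by split.
  have h5 := has_expectationD (has_expectationD h1 (has_expectationZ 2 h4)) (conj i3 E3).
  rewrite mulr0 addr0 in h5.
  rewrite (_ : (fun w => stopped j.+1 w ^+ 2) = (fun w => stopped j w ^+ 2 +
    2 * (stopped j w * stopped_coef j w * (B (u j.+1) w - B (u j) w)) +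
    stopped_coef j w * stopped_coef j w * (B (u j.+1) w - B (u j) w) ^+ 2))//.
  apply/funext => w; rewrite [stopped j.+1 w]/= -/(stopped_coef j w); ring.
have h5 := has_expectationD h2 (has_expectationZ D hX).
rewrite mulrC.
rewrite (_ : (fun w => \sum_(i < j.+1) _) = (fun w => \sum_(i < j) stopped_coef i w ^+ 2 * (u i.+1 - u i) +
     D * (stopped_coef j w * stopped_coef j w)))//.
by apply/funext => w; rewrite big_ord_recr/= expr2 [D * _]mulrC.
Qed.

(** Stopped and original transforms coincide until the level [eps] is passed, and the stopped one is
    frozen afterwards, so its final value records an excess at any earlier index. *)
Lemma stopped_exceeds k w : quadratic_variation k w <= C ->
  (exists2 j, (j <= k)%N & eps < `|transform j w|) -> eps < `|stopped k w|.
Proof.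
move=> hQ; have key j : (j <= k)%N -> (stopped j w = transform j w /\
    forall l, (l <= j)%N -> `|transform l w| <= eps) \/ eps < `|stopped j w|.
  elim: j => [_|j IH jk].
    left; split; first by rewrite /transform big_ord0.
    by move=> l; rewrite leqn0 => /eqP ->; rewrite /transform big_ord0 normr0 ltW.
  have hQ' : quadratic_variation j.+1 w <= C.
    by apply: le_trans hQ; exact: quadratic_variation_nd.
  have [[e1 h]|h] := IH (ltnW jk); last first.
    by right; rewrite /= [`|_| <= eps]leNgt h andbF mul0r addr0.
  have e2 : stopped j.+1 w = transform j.+1 w.
    by rewrite /= hQ' e1 h// /transform big_ord_recr.
  have [h3|h3] := ltP eps `|stopped j.+1 w|; first by right.
  left; split=> // l; rewrite leq_eqVlt => /predU1P[->|]; first by rewrite -e2.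
  by rewrite ltnS; exact: h.
move=> [j jk hj]; have [[_ /(_ _ jk)]|//] := key k (leqnn k).
by rewrite leNgt hj.
Qed.

Lemma measurable_transform_exceeds k :
  measurable [set w | exists2 j, (j <= k)%N & eps < `|transform j w|].
Proof.
apply: measurable_exists_norm_gt => j _.
exact: (measurable_wrt_fun (@Gm j) (measurable_wrt_transform j)).
Qed.

(* The transform stopped just before its quadratic variation exceeds [C], and as soon
   as it exceeds [eps], has second moment at most [C]. *)
Lemma lenglart k :
  (P [set w | exists2 j, (j <= k)%N & (eps < `|transform j w|)%R] <=
   (C / eps ^+ 2)%:E + P [set w | (C < quadratic_variation k w)%R])%E.
Proof.
have mQ : measurable [set w | C < quadratic_variation k w].
  apply: measurable_set_gt; case: k => [|k].
    rewrite (_ : quadratic_variation 0 = fun=> 0)//.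
    by apply/funext => w; rewrite /quadratic_variation big_ord0.
  exact: (measurable_wrt_fun (@Gm k) (measurable_wrt_quadratic_variation k)).
have [mS _] := measurable_wrt_stopped k.
have mA : measurable [set w | eps < `|stopped k w|].
  apply: measurable_set_gt; apply: (measurableT_comp (@normr_measurable R setT)).
  exact: (measurable_wrt_fun (@Gm k) mS).
apply: (@le_trans _ _ (P ([set w | eps < `|stopped k w|] `|` [set w | (C < quadratic_variation k w)%R]))).
  apply: le_measure; rewrite ?inE; [exact: measurable_transform_exceeds|exact: measurableU|].
  move=> w /= hw; have [h|h] := leP (quadratic_variation k w) C; [left|by right].
  exact: stopped_exceeds hw.
apply: le_trans (measureU2 _ mA mQ) _; rewrite leeD2r//.
have [v [hv1 hv2]] := stopped_second_moment k.
have vC : v <= C.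
  by apply: has_expectation_le hv2 (has_expectation_cst P C) _ => w; exact: stopped_quadratic_variation.
have hI : has_expectation P (\1_[set w | eps < `|stopped k w|]) (fine (P [set w | eps < `|stopped k w|])).
  split; first by apply: (@bounded_integrable _ _ _ P _ 1) => // w; rewrite indicE; case: (_ \in _); rewrite ?normr1 ?normr0.
  by rewrite /Rintegral integral_indic// setIT.
rewrite -[leLHS]fineK ?fin_num_measure// lee_fin ler_pdivlMr ?exprn_gt0//.
apply: le_trans vC; rewrite mulrC.
apply: has_expectation_le (has_expectationZ (eps ^+ 2) hI) hv1 _ => w.
rewrite indicE; have [h|h] := boolP (w \in _); last by rewrite mulr0 sqr_ge0.
rewrite mulr1 -[leRHS]real_normK ?num_real//; apply: lerXn2r; rewrite ?nnegrE; [exact: ltW|exact: normr_ge0|].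
by move: h; rewrite inE => /ltW.
Qed.
End lenglart.

(** * Elementary integrands *)

Lemma indic_itvoc {R : realType} (a b s : R) : \1_(`]a, b]) s = (a < s <= b)%R%:R :> R.
Proof.
rewrite indicE; congr (_%:R); congr nat_of_bool.
by apply/idP/idP; rewrite inE /= in_itv.
Qed.

Lemma measurable_itvoc {R : realType} (a b : R) (D : set R) :
  measurable_fun D (fun s : R => (a < s <= b)%R%:R : R).
Proof.
rewrite (_ : (fun s => _) = \1_(`]a, b])); first exact: measurable_indic.
by apply/funext => s; rewrite indic_itvoc.
Qed.

Lemma integral_itvoc_le {R : realType} (a a' b k : R) : 0 <= a -> a <= a' -> a' <= b -> 0 <= k ->
  (\int[lebesgue_measure]_(s in `[0%R, b]) (k * (a < s <= a')%R%:R)%:E = (k * (a' - a))%:E)%E.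
Proof.
move=> a0 aa' ab k0.
under eq_integral => s _ do rewrite EFinM -indic_itvoc.
rewrite ge0_integralZl//; last by apply/measurable_EFinP; exact: measurable_indic.
rewrite integral_indic// EFinM; congr (_ * _)%E.
rewrite (_ : _ `&` _ = `]a, a']%classic).
  have /= -> := lebesgue_measure_itv (`]a, a']).
  by rewrite lte_fin; case: ltP => h; rewrite -?EFinB//; congr EFin; apply/eqP; rewrite eq_le subr_ge0 aa' subr_le0.
apply/seteqP; split=> x /=; rewrite !in_itv/=; first by case.
move=> /andP[h1 h2]; split; first by rewrite h1.
by rewrite (le_trans a0 (ltW h1)) (le_trans h2).
Qed.

Section elementary.
Context {R : realType} {d : measure_display} {T : measurableType d}.
Variables (P : probability T R) (F : R -> set (set T)).
Hypothesis hF : filtration F.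
Variable B : R -> T -> R.
Hypothesis hB : brownian_motion P F B.
Variables (I : finType) (lo hi : I -> R) (z : I -> T -> R) (b : R)
  (pts : nat -> R) (k : nat).
Hypotheses (b0 : 0 <= b) (lo0 : forall l, 0 <= lo l) (lohi : forall l, lo l <= hi l)
  (mz : forall l, measurable_wrt (F (lo l)) (z l))
  (ptsb : forall j, (j <= k)%N -> 0 <= pts j <= b).

(* The integrals at the times [pts j] become martingale transforms along the sorted
   list of all endpoints (cut at [b]) and evaluation times. *)
Let pl : seq R := 0 :: b :: [seq pts j | j <- iota 0 k.+1] ++
  [seq Num.min b (lo l) | l <- enum I] ++ [seq Num.min b (hi l) | l <- enum I].
Let L := sort <=%R pl.
Let u j := nth b L j.

Let plb x : x \in pl -> 0 <= x <= b.
Proof.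
rewrite 2!in_cons !mem_cat => /orP[/eqP ->|/orP[/eqP ->|]]; rewrite ?lexx ?b0//.
move=> /orP[/mapP[j]|/orP[]/mapP[l _ ->]].
- by rewrite mem_iota/= add0n ltnS => jk ->; exact: ptsb.
- by rewrite ge_min lexx /= le_min b0 lo0.
- by rewrite ge_min lexx /= le_min b0 (le_trans (lo0 l)).
Qed.

Let Lb x : x \in L -> 0 <= x <= b. Proof. by rewrite mem_sort; exact: plb. Qed.

Let sL : sorted <=%R L. Proof. by apply: sort_sorted; exact: le_total. Qed.

Let ub j : 0 <= u j <= b.
Proof.
have [h|h] := ltnP j (size L); first by apply: Lb; exact: mem_nth.
by rewrite /u nth_default// b0 lexx.
Qed.

Let u_nd : {homo u : i j / (i <= j)%N >-> i <= j}.
Proof.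
move=> i j ij; have [h|h] := ltnP j (size L); last first.
  by rewrite {2}/u nth_default//; have /andP[] := ub i.
by apply: (sorted_leq_nth le_trans lexx b sL) => //; rewrite inE (leq_ltn_trans ij).
Qed.

Let ex x : x \in pl -> exists2 j, (j < size L)%N & u j = x.
Proof. by rewrite -(mem_sort <=%R) => h; exists (index x L); [rewrite index_mem|exact: nth_index]. Qed.

Let u0 : u 0%N = 0.
Proof.
have [|j jL E] := @ex 0; first by rewrite inE eqxx.
by apply/eqP; rewrite eq_le -{1}E u_nd//=; have /andP[] := ub 0%N.
Qed.

(** No listed time lies strictly inside a cell, so every interval from [lo l] to [hi l] contains a
    cell or misses it. *)
Let gap x j : x \in pl -> x <= u j \/ u j.+1 <= x.
Proof. by move=> /ex[i _ <-]; have [h|h] := leqP i j; [left|right]; exact: u_nd. Qed.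

Let gap' x j : Num.min b x \in pl -> x <= u j \/ u j.+1 <= x.
Proof.
have [bx _|_ /gap] := leP b x; last exact.
by right; apply: le_trans bx; have /andP[] := ub j.+1.
Qed.

Let gaplo l j : lo l <= u j \/ u j.+1 <= lo l.
Proof.
apply: gap'; rewrite 2!in_cons !mem_cat; do 3 (apply/orP; right); apply/orP; left; by apply/mapP; exists l => //; rewrite mem_enum.
Qed.

Let gaphi l j : hi l <= u j \/ u j.+1 <= hi l.
Proof.
apply: gap'; rewrite 2!in_cons !mem_cat; do 4 (apply/orP; right); by apply/mapP; exists l => //; rewrite mem_enum.
Qed.

(** The integrand is constant on the half-open cell ending at [u j.+1], so its right end represents
    it; only intervals with [lo l <= u j] count when the cell is not empty, which makes the value
    known at [u j]. *)
Let xi j w := \sum_l z l w * (lo l < u j.+1 <= hi l)%R%:R.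

Let uu0 : 0 <= u 0%N. Proof. by rewrite u0. Qed.

Let mxi j : measurable_wrt (F (u j)) (xi j).
Proof.
have uj0 : 0 <= u j by have /andP[] := ub j.
have sG := filtration_sigma_algebra hF uj0.
apply: (@measurable_wrt_sum _ _ _ _ sG _ _ (fun l => fun w => z l w * (lo l < u j.+1 <= hi l)%R%:R)) => l.
have [/andP[h1 h2]|_] := boolP (lo l < u j.+1 <= hi l); last first.
  rewrite (_ : (fun w => _) = fun=> 0); first exact: measurable_wrt_cst.
  by apply/funext => w; rewrite mulr0.
apply: (measurable_wrtM sG); last exact: measurable_wrt_cst.
apply: measurable_wrtS (mz l); apply: (filtration_nondecreasing hF) => //.
by have [//|] := gaplo l j; rewrite leNgt h1.
Qed.

Let transformE j w :
  transform B u xi j w = \sum_l z l w * (B (Num.min (hi l) (u j)) w - B (Num.min (lo l) (u j)) w).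
Proof.
rewrite /transform; elim: j => [|j IH].
  rewrite big_ord0 big1// => l _; rewrite u0 !min_r ?subrr ?mulr0//.
  by rewrite (le_trans (lo0 l)).
rewrite big_ord_recr/= IH /xi mulr_suml -big_split/=; apply: eq_bigr => l _.
rewrite -mulrA -mulrDr; congr (_ * _).
have ujj : u j <= u j.+1 by exact: u_nd.
have [h1|h1] := gaplo l j.
  rewrite (min_l h1) (min_l (le_trans h1 ujj)).
  have [h2|h2] := gaphi l j.
    rewrite (min_l h2) (min_l (le_trans h2 ujj)).
    have [/andP[_ h3]|_] := boolP (lo l < u j.+1 <= hi l); last by rewrite mul0r addr0.
    have -> : u j.+1 = u j by apply/eqP; rewrite eq_le ujj (le_trans h3).
    by rewrite subrr mulr0 addr0.
  rewrite (min_r h2) (min_r (le_trans ujj h2)) h2 andbT.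
  have [h3|h3] := ltP (lo l) (u j.+1); first by rewrite mul1r; ring.
  have -> : u j.+1 = u j by apply/eqP; rewrite eq_le ujj (le_trans h3).
  by rewrite mul0r addr0.
have h2 := le_trans h1 (lohi l).
rewrite (min_r h1) (min_r h2) (min_r (le_trans ujj h1)) (min_r (le_trans ujj h2)).
by rewrite ltNge h1 mul0r !subrr addr0.
Qed.

(** [Q] is a finite sum, hence visibly measurable, and stands in for the time integral of the
    squared integrand, which is used only pathwise as an upper bound. *)
Lemma elementary_lenglart : exists Q : T -> R, [/\ measurable_fun setT Q,
  forall w, ((Q w)%:E <= \int[lebesgue_measure]_(s in `[0%R, b])
     ((\sum_l z l w * (lo l < s <= hi l)%R%:R) ^+ 2)%:E)%E &
  forall eps C, 0 < eps -> 0 < C ->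
    let E := [set w | exists2 j, (j <= k)%N & eps <
      `|\sum_l z l w * (B (Num.min (hi l) (pts j)) w - B (Num.min (lo l) (pts j)) w)|] in
    measurable E /\ (P E <= (C / eps ^+ 2)%:E + P [set w | (C < Q w)%R])%E].
Proof.
have Gm j : F (u j) `<=` measurable by apply: (filtration_measurable hF); have /andP[] := ub j.
exists (quadratic_variation u xi (size L)); split.
- case: (size L) => [|n].
    by rewrite (_ : quadratic_variation u xi 0 = fun=> 0)//; apply/funext => w; rewrite /quadratic_variation big_ord0.
  exact: (measurable_wrt_fun (@Gm n) (measurable_wrt_quadratic_variation hF uu0 u_nd mxi n)).
- move=> w; rewrite /quadratic_variation.
  have -> : (\sum_(i < size L) xi i w ^+ 2 * (u i.+1 - u i))%:E =
     (\int[lebesgue_measure]_(s in `[0%R, b]) (\sum_(i < size L) xi i w ^+ 2 * (u i < s <= u i.+1)%R%:R)%:E)%E.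
    under eq_integral => s _ do rewrite -sumEFin.
    rewrite ge0_integral_sum//; last 2 first.
    - move=> i; apply/measurable_EFinP; apply: measurable_funM => //; exact: measurable_itvoc.
    - by move=> i s _; rewrite lee_fin mulr_ge0// sqr_ge0.
    rewrite -sumEFin; apply: eq_bigr => i _; rewrite integral_itvoc_le ?sqr_ge0//.
    - by have /andP[] := ub i.
    - exact: u_nd.
    - by have /andP[] := ub i.+1.
  apply: ge0_le_integral => //.
  - by move=> s _; rewrite lee_fin sumr_ge0// => i _; rewrite mulr_ge0// sqr_ge0.
  - apply/measurable_EFinP; apply: measurable_sum => i; apply: measurable_funM => //; exact: measurable_itvoc.
  - apply/measurable_EFinP; apply: measurable_funX; apply: measurable_sum => i.
    apply: measurable_funM => //; exact: measurable_itvoc.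
  move=> s /=; rewrite in_itv/= => /andP[s0 sb]; rewrite lee_fin.
  have [h1 h2] := nondecreasing_block_sum (fun i => xi i w ^+ 2) s (size L) u_nd.
  have [h|h] := boolP (u 0%N < s <= u (size L)); last by rewrite (h2 h) sqr_ge0.
  have [i _ [/andP[i1 i2] ->]] := h1 h.
  rewrite le_eqVlt; apply/orP; left; apply/eqP; congr (_ ^+ 2); apply: eq_bigr => l _.
  congr (_ * _%:R); congr nat_of_bool.
  have [g1|g1] := gaplo l i; last by rewrite !ltNge g1 (le_trans i2 g1).
  have [g2|g2] := gaphi l i.
    by rewrite [u i.+1 <= _]leNgt [s <= _]leNgt (le_lt_trans g2 i1) (le_lt_trans g2 (lt_le_trans i1 i2)) !andbF.
  by rewrite g2 (le_trans i2 g2) (le_lt_trans g1 i1) (le_lt_trans g1 (lt_le_trans i1 i2)).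
- move=> eps C eps0 C0 E.
  have hE : E `<=` [set w | exists2 j, (j <= size L)%N & eps < `|transform B u xi j w|].
    move=> w [j jk h].
    have [|i iL ui] := @ex (pts j).
      rewrite 2!in_cons mem_cat; do 2 (apply/orP; right); apply/orP; left.
      by apply/mapP; exists j => //; rewrite mem_iota/= add0n ltnS.
    by exists i; [exact: ltnW|rewrite transformE ui].
  have mE : measurable E.
    apply: measurable_exists_norm_gt => j jk.
    have /andP[p0 pb] := ptsb jk.
    have mB s : 0 <= s -> measurable_fun setT (B s).
      by move=> s0; exact: (measurable_wrt_fun (filtration_measurable hF s0) (brownian_adapted hB s0)).
    apply: measurable_sum => l; apply: measurable_funM.
      exact: (measurable_wrt_fun (filtration_measurable hF (lo0 l)) (mz l)).
    by apply: measurable_funB; apply: mB; rewrite le_min p0 ?lo0// (le_trans (lo0 l)).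
  split=> //; apply: le_trans (lenglart hF hB uu0 u_nd mxi eps0 C0 (size L)).
  apply: le_measure; rewrite ?inE//.
  exact: (measurable_transform_exceeds hF hB uu0 u_nd mxi).
Qed.
End elementary.

(** * Convergence in probability *)

Section small_probability.
Context {R : realType} {d : measure_display} {T : measurableType d}.
Variable P : probability T R.

Definition small_probability (E : nat -> set T) :=
  (forall m, measurable (E m)) /\
  forall e : R, 0 < e -> exists m0 : nat, forall m, (m0 <= m)%N -> (P (E m) <= e%:E)%E.

Lemma small_probability_cvg (E : nat -> set T) : (forall m, measurable (E m)) ->
  P (E m) @[m --> \oo] --> 0%E -> small_probability E.
Proof.
move=> mE h; split=> // e e0.
have Pfin m : P (E m) \is a fin_num by exact: fin_num_measure.
have h' : (fine \o (fun m => P (E m))) @ \oo --> (0 : R) by exact: (fine_cvg h).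
have [m0 _ hm] := (@cvgrPdist_le _ _ _ _ _ _ _).1 h' e e0.
exists m0 => m mm0; rewrite -(fineK (Pfin m)) lee_fin.
have := hm m mm0; rewrite /= sub0r normrN; apply: le_trans; exact: ler_norm.
Qed.

Lemma small_probabilityU (E A : nat -> set T) : small_probability E -> small_probability A ->
  small_probability (fun m => E m `|` A m).
Proof.
move=> [mE hE] [mA hA]; split=> [m|e e0]; first exact: measurableU.
have e2 : 0 < e / 2 by rewrite divr_gt0.
have [m1 h1] := hE _ e2; have [m2 h2] := hA _ e2.
exists (maxn m1 m2) => m; rewrite geq_max => /andP[k1 k2].
apply: (le_trans (measureU2 _ (mE m) (mA m))).
rewrite [X in X%:E]splitr EFinD; apply: leeD; [exact: h1|exact: h2].
Qed.

(* The pathwise hypothesis is only almost sure: no measurability of the path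
   functionals behind it is needed. *)
Lemma small_probability_ae (E A : nat -> set T) : (forall m, measurable (E m)) ->
  small_probability A ->
  (\forall w \ae P, exists m0 : nat, forall m, (m0 <= m)%N -> E m w -> A m w) ->
  small_probability E.
Proof.
move=> mE sA hae; have [mA _] := sA.
(* These sets decrease to the event that [E] occurs without [A] infinitely often, which is null by
   hypothesis; continuity from above makes them small. *)
pose G m := \bigcup_(k in [set k | (m <= k)%N]) (E k `\` A k).
have mG m : measurable (G m) by apply: bigcup_measurable => k _; exact: measurableD.
have sG : small_probability G.
  apply: small_probability_cvg => //.
  have mI : measurable (\bigcap_m G m) by exact: bigcapT_measurable.
  have <- : P (\bigcap_m G m) = 0%E.
    apply: measure_negligible => //; apply: negligibleS hae => w Gw /= [m0 h].
    by have [k /= mk [Ek]] := Gw m0 I; apply; exact: h.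
  apply: nonincreasing_cvg_mu => //; first by rewrite ltey_eq fin_num_measure.
  move=> i j ij; rewrite subsetEset => w [k /= jk h]; exists k => //=; exact: leq_trans jk.
split=> // e e0; have [_ /(_ _ e0)[m0 h]] := small_probabilityU sA sG.
exists m0 => m mm0; apply: le_trans (h m mm0).
apply: le_measure; rewrite ?inE//; first exact: measurableU.
move=> w Ew; have [Aw|nAw] := pselect (A m w); [by left|right].
by exists m => /=.
Qed.

End small_probability.

Lemma cadlag_step_L2 {R : realType} (v : R -> R) (b e : R) : cadlag v -> 0 <= b -> 0 < e ->
  exists m0 : nat, forall m, (m0 <= m)%N ->
  (\int[lebesgue_measure]_(s in `[0%R, b])
     ((v s - \sum_(i < m.+1) v (grid b m i) * (grid b m i < s <= grid b m i.+1)%R%:R) ^+ 2)%:E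
   <= e%:E)%E.
Proof.
move=> cv b0 e0; have [M M0 hM] := cadlag_bounded b cv.
(* Path and step function differ by at most [2 * M], so the squared error is at most [K] times the
   absolute error and [cadlag_riemann] applies. Time 0 lies in no cell, hence the passage to the
   half-open interval below. *)
pose K := 2 * M + 1.
have K0 : 0 < K by rewrite ltr_wpDl// mulr_ge0.
have [m0 hm0] := cadlag_riemann cv b0 (divr_gt0 e0 K0).
exists m0 => m /hm0 hm.
pose chi i s : R := (grid b m i < s <= grid b m i.+1)%R%:R.
pose stp s := \sum_(i < m.+1) v (grid b m i) * chi i s.
have mv (D : set R) : measurable D -> D `<=` `[0, +oo[ -> measurable_fun D v.
  move=> _ DE; apply: (measurable_funS (measurable_itv _) DE).
  by apply: right_continuous_measurable; case: cv.
have mv1 : measurable_fun `]0, b] v.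
  by apply: mv => // x /=; rewrite !in_itv/= => /andP[/ltW ->].
have mstp D : measurable_fun D stp.
  apply: measurable_sum => i; apply: measurable_funM => //; exact: measurable_itvoc.
rewrite -integral_itv_obnd_cbnd; last first.
  by apply/measurable_EFinP; apply: measurable_funX; apply: measurable_funB => //; exact: mstp.
apply: (@le_trans _ _ (\int[lebesgue_measure]_(s in `]0%R, b])
   (\sum_(i < m.+1) (K * `|v s - v (grid b m i)|)%:E * (\1_(`]grid b m i, grid b m i.+1]) s)%:E)%E)%E).
  apply: ge0_le_integral => //.
  - by move=> s _; rewrite lee_fin sqr_ge0.
  - by apply/measurable_EFinP; apply: measurable_funX; apply: measurable_funB => //; exact: mstp.
  - apply: emeasurable_sum => i; apply: emeasurable_funM; apply/measurable_EFinP; last exact: measurable_indic.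
    apply: measurable_funM => //; apply: measurableT_comp => //; apply: measurable_funB => //.
  move=> s /=; rewrite in_itv/= => /andP[s0 sb].
  rewrite (_ : (\sum_(i < m.+1) _)%E = (\sum_(i < m.+1) K * `|v s - v (grid b m i)| * chi i s)%:E); last first.
    by rewrite -sumEFin; apply: eq_bigr => i _; rewrite indic_itvoc.
  rewrite lee_fin.
  have [h1 _] := nondecreasing_block_sum (fun i => v (grid b m i)) s m.+1 (@grid_nd _ b m b0).
  have hs : grid b m 0 < s <= grid b m m.+1 by rewrite grid0 gridT s0.
  have [i im [hi ->]] := h1 hs.
  apply: (@le_trans _ _ (K * `|v s - v (grid b m i)|)).
    rewrite -[leLHS]real_normK ?num_real// expr2 ler_wpM2r//.
    have g0 := @grid_ge0 _ b m i b0.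
    have := hM s; rewrite (ltW s0) sb => /(_ isT).
    have := hM (grid b m i); rewrite g0 (grid_le b0 (ltnW im)) => /(_ isT).
    have := ler_normB (v s) (v (grid b m i)); rewrite /K; lra.
  rewrite (bigD1 (Ordinal im))//= [chi i s](_ : _ = 1) ?mulr1; last by rewrite /chi hi.
  rewrite lerDl sumr_ge0// => j _.
  by rewrite mulr_ge0// mulr_ge0// ltW.
rewrite ge0_integral_sum//; last 2 first.
- move=> i; apply: emeasurable_funM; apply/measurable_EFinP; last exact: measurable_indic.
  by apply: measurable_funM => //; apply: measurableT_comp => //; apply: measurable_funB.
- by move=> i s _; rewrite -EFinM lee_fin mulr_ge0// mulr_ge0// ltW.
apply: (@le_trans _ _ (\sum_(i < m.+1) (K * \int[lebesgue_measure]_(x in `]grid b m i, grid b m i.+1])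
    `|v x - v (grid b m i)|)%:E)%E); last first.
  rewrite sumEFin lee_fin -mulr_sumr.
  by have := ler_wpM2l (ltW K0) hm; rewrite mulrCA divff ?gt_eqF// mulr1.
apply: lee_sum => i _.
apply: (@le_trans _ _ (\int[lebesgue_measure]_(s in `]0%R, b])
    (((fun x => (K * `|v x - v (grid b m i)|)%:E) \_ `]grid b m i, grid b m i.+1]) s))%E).
  rewrite le_eqVlt; apply/orP; left; apply/eqP; apply: eq_integral => s _.
  by rewrite epatch_indic.
rewrite -integral_mkcondr.
have g0 := @grid_ge0 _ b m i b0.
have -> : `]0, b] `&` `]grid b m i, grid b m i.+1] = `]grid b m i, grid b m i.+1]%classic.
  apply/seteqP; split=> x /=; rewrite !in_itv/=; first by case.
  move=> /andP[h1 h2]; split; last by rewrite h1.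
  by rewrite (le_lt_trans g0 h1) (le_trans h2)// grid_le.
have mg : measurable_fun `]grid b m i, grid b m i.+1] v.
  by apply: mv => // x /=; rewrite !in_itv/= => /andP[h1 _]; rewrite (le_trans g0 (ltW h1)).
under eq_integral => s _ do rewrite EFinM.
rewrite ge0_integralZl//; last 2 first.
- by apply/measurable_EFinP; apply: measurableT_comp => //; apply: measurable_funB.
- by rewrite lee_fin ltW.
rewrite EFinM /Rintegral fineK//.
apply: integrable_fin_num => //.
exact: (@cadlag_integrable _ _ _ _ false false (cadlag_dist (v (grid b m i)) cv) g0).
Qed.

(** * Riemann sums for the Ito integral *)

Lemma grid_sum_min {R : realType} (b : R) m j (h W : R -> R) : 0 <= b -> (j <= m.+1)%N ->
  \sum_(i < m.+1) h (grid b m i) *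
     (W (Num.min (grid b m i.+1) (grid b m j)) - W (Num.min (grid b m i) (grid b m j))) =
  \sum_(i < j) h (grid b m i) * (W (grid b m i.+1) - W (grid b m i)).
Proof.
move=> b0 jm.
pose G i := h (grid b m i) *
     (W (Num.min (grid b m i.+1) (grid b m j)) - W (Num.min (grid b m i) (grid b m j))).
transitivity (\sum_(i < j) G i).
  rewrite (big_ord_widen m.+1 G jm) [LHS](bigID (fun i : 'I_m.+1 => (i < j)%N))/=.
  rewrite [X in _ + X]big1 ?addr0// => i; rewrite -leqNgt => ji.
  by rewrite !min_r ?subrr ?mulr0//; apply: grid_nd => //; exact: leqW.
apply: eq_bigr => i _; rewrite /G !min_l//; apply: grid_nd => //; exact: ltnW.
Qed.

Lemma sqrD_le2 {R : realDomainType} (x y : R) : (x + y) ^+ 2 <= 2 * x ^+ 2 + 2 * y ^+ 2.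
Proof. by have := sqr_ge0 (x - y); nra. Qed.

Lemma forall_eventually (n : nat) (Q : 'I_n -> nat -> Prop) :
  (forall j, exists m0, forall m, (m0 <= m)%N -> Q j m) ->
  exists m0, forall m, (m0 <= m)%N -> forall j, Q j m.
Proof.
move=> /choice[f hf]; exists (\max_j f j) => m hm j; apply: hf; apply: leq_trans hm.
exact: (leq_bigmax j).
Qed.

Section ito_riemann.
Context {R : realType} {d : measure_display} {T : measurableType d}.
Variables (P : probability T R) (F : R -> set (set T)).
Hypothesis hF : filtration F.
Variable B : R -> T -> R.
Hypothesis hB : brownian_motion P F B.
Variables (H I : R -> T -> R) (b : R).
Hypotheses (hH : adapted F H) (cH : \forall w \ae P, cadlag (H ^~ w))
  (hI : ito_integral P F B H I) (b0 : 0 <= b).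

Let l (m : nat) : R := 1 / m.+1%:R.

Let l_gt0 m : 0 < l m. Proof. by rewrite divr_gt0. Qed.

Let DD m w : \bar R := (\int[lebesgue_measure]_(s in `[0%R, b])
     ((H s w - \sum_(i < m.+1) H (grid b m i) w * (grid b m i < s <= grid b m i.+1)%R%:R) ^+ 2)%:E)%E.

(** For each [m] one simple process is fixed. [U] is the event that it is far from [H] in mean
    square, [V] that its integral is far from [I] at some grid time, and [E] that it differs from
    the left-endpoint sum. Lenglart bounds [E] through [Q], which [DD] controls on each cadlag
    path. *)
Lemma ito_riemann_package (eta : R) (m : nat) : 0 < eta ->
  exists QEVU : (T -> R) * (set T * set T * set T), let: (Q, (E, V, U)) := QEVU in
  [/\ [/\ measurable_fun setT Q, measurable E, measurable V & measurable U],
   (P U <= (l m)%:E)%E, (P V <= (l m)%:E)%E &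
   [/\ forall C, 0 < C -> (P E <= (C / (eta / 2) ^+ 2)%:E + P [set w | (C < Q w)%R])%E,
    forall w, cadlag (H ^~ w) -> ~ U w -> ((Q w)%:E <= (2 * l m)%:E + 2%:E * DD m w)%E &
    forall w j, (j <= m.+1)%N -> ~ E w -> ~ V w ->
     `|\sum_(i < j) H (grid b m i) w * (B (grid b m i.+1) w - B (grid b m i) w)
       - I (grid b m j) w| <= eta]].
Proof.
move=> eta0; have eta2 : 0 < eta / 2 by rewrite divr_gt0.
have [_ [X hX]] := hI.
(* The tolerance is shared among the [m.+2] grid times, so that their union [V] keeps probability at
   most [l m]. *)
have lm2 : 0 < l m / m.+2%:R by rewrite divr_gt0.
have [n1 hn1] : exists n0, forall n, (n0 <= n)%N -> forall j : 'I_m.+2,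
    (P [set w | ((eta / 2)%:E <= `|simple_integral (X n) B (grid b m j) w - I (grid b m j) w|%:E)%E]
      <= (l m / m.+2%:R)%:E)%E.
  apply: (@forall_eventually _ (fun j n => (P [set w | ((eta / 2)%:E <= `|simple_integral (X n) B (grid b m j) w - I (grid b m j) w|%:E)%E]
      <= (l m / m.+2%:R)%:E)%E)) => j.
  have [_ /(_ _ eta2)[h1 h2]] := hX _ (@grid_ge0 _ b m j b0).
  by have [_ /(_ _ lm2)] := small_probability_cvg h1 h2.
have [/(_ _ (l_gt0 m))[hU1 hU2] _] := hX _ b0.
have [_ /(_ _ (l_gt0 m))[n2 hn2]] := small_probability_cvg hU1 hU2.
pose n := maxn n1 n2; pose Xn := X n.
pose U := [set w | ((l m)%:E <= \int[lebesgue_measure]_(s in `[0%R, b]) ((simple_value Xn s w - H s w) ^+ 2)%:E)%E].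
pose Sj (j : nat) := [set w | ((eta / 2)%:E <= `|simple_integral Xn B (grid b m j) w - I (grid b m j) w|%:E)%E].
have mSj j : measurable (Sj j).
  have [_ /(_ _ eta2)[h1 h2]] := hX _ (@grid_ge0 _ b m j b0); exact: h1.
pose V := \big[setU/set0]_(j < m.+2) Sj j.
(* The sum type joins the pieces of the simple process to the grid pieces of [- H], so the
   difference is one elementary integrand with no common refinement to build. *)
pose J : finType := ('I_(simple_size Xn) + 'I_m.+1)%type.
pose lo (i : J) := match i with inl i => simple_time Xn i | inr i => grid b m i end.
pose hi (i : J) := match i with inl i => simple_time Xn i.+1 | inr i => grid b m i.+1 end.
pose z (i : J) := match i with inl i => simple_coef Xn i | inr i => fun w => - H (grid b m i) w end.
have lo0 i : 0 <= lo i.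
  case: i => i /=; last exact: grid_ge0.
  by apply: le_trans (simple_time_ge0 Xn) _; exact: simple_time_nondecreasing.
have lohi i : lo i <= hi i.
  by case: i => i /=; [exact: simple_time_nondecreasing|exact: grid_nd].
have mz i : measurable_wrt (F (lo i)) (z i).
  case: i => i /=; first exact: simple_coef_measurable.
  have g0 := @grid_ge0 _ b m i b0.
  have sG := filtration_sigma_algebra hF g0.
  rewrite (_ : (fun w => _) = (fun w => -1 * H (grid b m i) w)); last by apply/funext => w; rewrite mulN1r.
  by apply: (measurable_wrtM sG); [exact: measurable_wrt_cst|exact: hH].
have pts j : (j <= m.+1)%N -> 0 <= grid b m j <= b.
  by move=> jm; rewrite grid_ge0// grid_le.
have [Q [mQ Qle hE]] := elementary_lenglart hF hB b0 lo0 lohi mz pts.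
pose E := [set w | exists2 j, (j <= m.+1)%N & eta / 2 <
      `|\sum_i z i w * (B (Num.min (hi i) (grid b m j)) w - B (Num.min (lo i) (grid b m j)) w)|].
have mE : measurable E by have [] := hE _ _ eta2 ltr01.
have sumE w j : (j <= m.+1)%N ->
   \sum_i z i w * (B (Num.min (hi i) (grid b m j)) w - B (Num.min (lo i) (grid b m j)) w) =
   simple_integral Xn B (grid b m j) w -
   \sum_(i < j) H (grid b m i) w * (B (grid b m i.+1) w - B (grid b m i) w).
  move=> jm; rewrite big_sumType/=; congr (_ + _).
  rewrite -(@grid_sum_min _ b m j (H ^~ w) (B ^~ w) b0 jm) -sumrN.
  by apply: eq_bigr => i _; rewrite mulNr.
have mS : measurable V by apply: bigsetU_measurable.
have mU : measurable U by exact: hU1.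
exists (Q, (E, V, U)); split => //.
- by apply: hn2; exact: leq_maxr.
- apply: (@le_trans _ _ (\sum_(j < m.+2) P (Sj j))%E); first exact: Boole_inequality.
  apply: (@le_trans _ _ (\sum_(j < m.+2) (l m / m.+2%:R)%:E)%E).
    by apply: lee_sum => j _; apply: hn1; exact: leq_maxl.
  by rewrite sumEFin sumr_const card_ord -[_ *+ m.+2]mulr_natr divfK.
split.
- by move=> C C0; have [] := hE _ _ eta2 C0.
- move=> w cw nU.
  have iU : (\int[lebesgue_measure]_(s in `[0%R, b]) ((simple_value Xn s w - H s w) ^+ 2)%:E <= (l m)%:E)%E.
    by apply: ltW; rewrite ltNge; apply/negP.
  have mH : measurable_fun `[0, b] (H ^~ w).
    apply: (measurable_funS (measurable_itv `[0, +oo[)).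
      by move=> x /=; rewrite !in_itv/= => /andP[->].
    by apply: right_continuous_measurable; case: cw.
  have mX : measurable_fun `[0, b] (fun s => simple_value Xn s w).
    by apply: measurable_sum => i; apply: measurable_funM => //; exact: measurable_indic.
  have mHm : measurable_fun `[0, b] (fun s => \sum_(i < m.+1) H (grid b m i) w * (grid b m i < s <= grid b m i.+1)%R%:R).
    by apply: measurable_sum => i; apply: measurable_funM => //; exact: measurable_itvoc.
  have m1 : measurable_fun `[0, b] (fun s => ((simple_value Xn s w - H s w) ^+ 2)%:E).
    by apply/measurable_EFinP; apply: measurable_funX; exact: measurable_funB.
  have m2 : measurable_fun `[0, b] (fun s => ((H s w - \sum_(i < m.+1) H (grid b m i) w * (grid b m i < s <= grid b m i.+1)%R%:R) ^+ 2)%:E).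
    by apply/measurable_EFinP; apply: measurable_funX; exact: measurable_funB.
  apply: le_trans (Qle w) _.
  apply: (@le_trans _ _ (\int[lebesgue_measure]_(s in `[0%R, b])
    (2%:E * ((simple_value Xn s w - H s w) ^+ 2)%:E +
     2%:E * ((H s w - \sum_(i < m.+1) H (grid b m i) w * (grid b m i < s <= grid b m i.+1)%R%:R) ^+ 2)%:E))%E).
    apply: ge0_le_integral => //.
    + by move=> s _; rewrite lee_fin sqr_ge0.
    + apply/measurable_EFinP; apply: measurable_funX; apply: measurable_sum => i.
      by apply: measurable_funM => //; exact: measurable_itvoc.
    + by apply: emeasurable_funD; apply: measurable_funeM.
    move=> s _; rewrite -!EFinM -EFinD lee_fin.
    apply: le_trans (sqrD_le2 _ _); rewrite big_sumType/= addrA subrK.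
    rewrite le_eqVlt; apply/orP; left; apply/eqP; congr (_ ^+ 2); congr (_ + _).
      by apply: eq_bigr => i _; rewrite indic_itvoc.
    by rewrite -sumrN; apply: eq_bigr => i _; rewrite mulNr.
  rewrite ge0_integralD//; last 4 first.
  + by move=> s _; rewrite -EFinM lee_fin mulr_ge0// sqr_ge0.
  + exact: measurable_funeM.
  + by move=> s _; rewrite -EFinM lee_fin mulr_ge0// sqr_ge0.
  + exact: measurable_funeM.
  rewrite !ge0_integralZl//; try (by move=> s _; rewrite lee_fin sqr_ge0).
  by apply: leeD => //; rewrite EFinM; apply: lee_wpmul2l => //; rewrite lee_fin.
- move=> w j jm nE nS.
  have h1 : ~ Sj j w.
    move=> h; apply: nS; rewrite /V -bigcup_mkord; exists j => //=; by rewrite ltnS.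
  have {}h1 : `|simple_integral Xn B (grid b m j) w - I (grid b m j) w| <= eta / 2.
    by rewrite leNgt; apply/negP => h; apply: h1; rewrite /Sj /= lee_fin ltW.
  have h2 : `|simple_integral Xn B (grid b m j) w -
   \sum_(i < j) H (grid b m i) w * (B (grid b m i.+1) w - B (grid b m i) w)| <= eta / 2.
    by rewrite -sumE// leNgt; apply/negP => h; apply: nE; exists j.
  rewrite distrC in h2; rewrite (splitr eta).
  by apply: le_trans (ler_distD (simple_integral Xn B (grid b m j) w) _ _) (lerD h2 h1).
Qed.

Lemma ito_riemann (eta : R) : 0 < eta -> exists2 A : nat -> set T, small_probability P A &
  forall m w j, (j <= m.+1)%N -> ~ A m w ->
   `|\sum_(i < j) H (grid b m i) w * (B (grid b m i.+1) w - B (grid b m i) w)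
       - I (grid b m j) w| <= eta.
Proof.
move=> eta0; have /choice[f hf] := fun m => ito_riemann_package m eta0.
pose Q m := (f m).1; pose E m := (f m).2.1.1; pose V m := (f m).2.1.2; pose U m := (f m).2.2.
have {}hf m : [/\ [/\ measurable_fun setT (Q m), measurable (E m), measurable (V m) & measurable (U m)],
   (P (U m) <= (l m)%:E)%E, (P (V m) <= (l m)%:E)%E &
   [/\ forall C, 0 < C -> (P (E m) <= (C / (eta / 2) ^+ 2)%:E + P [set w | (C < Q m w)%R])%E,
    forall w, cadlag (H ^~ w) -> ~ U m w -> ((Q m w)%:E <= (2 * l m)%:E + 2%:E * DD m w)%E &
    forall w j, (j <= m.+1)%N -> ~ E m w -> ~ V m w ->
     `|\sum_(i < j) H (grid b m i) w * (B (grid b m i.+1) w - B (grid b m i) w)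
       - I (grid b m j) w| <= eta]].
  by have := hf m; rewrite /Q /E /V /U; case: (f m) => q [[e s] u].
have smallS : small_probability P V.
  split=> [m|e e0]; first by have [[]] := hf m.
  have [m0 hm0] := @mesh_small R 1 e e0; exists m0 => m /hm0 hm.
  by have [_ _ h _] := hf m; apply: le_trans h _; rewrite lee_fin.
have smallU : small_probability P U.
  split=> [m|e e0]; first by have [[]] := hf m.
  have [m0 hm0] := @mesh_small R 1 e e0; exists m0 => m /hm0 hm.
  by have [_ h _ _] := hf m; apply: le_trans h _; rewrite lee_fin.
(* Outside [U], [Q] is at most [2 * l m + 2 * DD m], and each part is eventually at most [C / 2]
   along almost every path. *)
have smallQ C : 0 < C -> small_probability P (fun m => [set w | C < Q m w]).
  move=> C0; apply: (@small_probability_ae _ _ _ P _ U) => //.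
    move=> m; have [[mQ _ _ _] _ _ _] := hf m.
    exact: measurable_set_gt mQ.
  apply: filterS cH => w cw.
  have C4 : 0 < C / 4 by rewrite divr_gt0.
  have [m1 h1] := cadlag_step_L2 cw b0 C4.
  have [m2 h2] := @mesh_small R 1 _ C4.
  exists (maxn m1 m2) => m; rewrite geq_max => /andP[/h1 k1 /h2 k2] /= CQ.
  apply: contrapT => nU; have [_ _ _ [_ h _]] := hf m.
  have := h w cw nU; apply/negP; rewrite -ltNge.
  apply: (@le_lt_trans _ _ ((2 * l m)%:E + 2%:E * (C / 4)%:E)%E).
    by apply: leeD => //; apply: lee_wpmul2l => //; rewrite lee_fin.
  by rewrite -EFinM -EFinD lte_fin; move: k2 CQ; rewrite -/(l m); lra.
have smallE : small_probability P E.
  split=> [m|e e0]; first by have [[]] := hf m.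
  pose C := e / 2 * (eta / 2) ^+ 2.
  have eta2 : 0 < (eta / 2) ^+ 2 by rewrite exprn_gt0// divr_gt0.
  have e2 : 0 < e / 2 by rewrite divr_gt0.
  have C0 : 0 < C by rewrite mulr_gt0.
  have [_ /(_ _ e2)[m0 hm0]] := smallQ _ C0.
  exists m0 => m /hm0 hm; have [_ _ _ [h _ _]] := hf m.
  apply: le_trans (h _ C0) _; rewrite /C mulfK ?gt_eqF//.
  by rewrite [leRHS](_ : _ = (e / 2)%:E + (e / 2)%:E)%E ?leeD2l// -EFinD -splitr.
exists (fun m => E m `|` V m); first exact: small_probabilityU.
move=> m w j jm /not_orP[nE nS]; have [_ _ _ [_ _ h]] := hf m; exact: h.
Qed.
End ito_riemann.

(** * The Euler scheme along the solution *)

(** Positivity of the left limits makes the inverse path cadlag, hence bounded, which keeps the path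
    away from 0. *)
Lemma positive_path_bounds {R : realType} (v : R -> R) (b : R) : cadlag v ->
  (forall t, 0 <= t -> 0 < v t) -> (forall t, 0 < t -> 0 < left_limit v t) ->
  exists n0 : nat, forall n s, (n0 <= n)%N -> 0 <= s <= b -> n.+1%:R^-1 <= v s <= n.+1%:R.
Proof.
move=> cv v_gt0 l_gt0.
have [c1 _] := @cadlag_comp _ v (fun x => x^-1) cv v_gt0 l_gt0
   (fun x x0 => @inv_continuous R x (lt0r_neq0 x0)).
have [M M0 hM] := cadlag_bounded b cv.
have [M' M'0 hM'] := cadlag_bounded b c1.
exists (Num.truncn (M + M')) => n s hn sb; have s0 : 0 <= s by case/andP: sb.
have hn0 : M + M' <= n.+1%:R.
  by apply: ltW; apply: lt_le_trans (truncnS_gt _) _; rewrite ler_nat ltnS.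
have vs := v_gt0 s s0.
have := hM s sb; rewrite gtr0_norm// => h1.
have := hM' s sb; rewrite /= gtr0_norm ?invr_gt0// => h2.
apply/andP; split; last by lra.
rewrite -[leRHS]invrK lef_pV2 ?posrE ?invr_gt0//; lra.
Qed.

Section path.
Context {R : realType}.
Variables (f g v i_ W : R -> R) (nn : R -> nat) (delta y0 : R).
Hypotheses (cv : cadlag v) (v_gt0 : forall t, 0 <= t -> 0 < v t)
  (nn_nd : forall s t : R, 0 <= s -> s <= t -> (nn s <= nn t)%N)
  (nn_rc : right_continuous_path (fun t => (nn t)%:R : R))
  (fint : forall t, 0 <= t -> lebesgue_measure.-integrable `[0, t] (EFin \o (f \o v)))
  (ci : {within `[0, +oo[, continuous i_})
  (veq : forall t, 0 <= t -> v t = y0 + \int[lebesgue_measure]_(s in `[0, t]) f (v s) + i_ t +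
     jump_integral (fun s => delta * left_limit v s) (fun s => (nn s)%:R) t).

Lemma cvg_left_limit s : 0 < s -> v x @[x --> s^'-] --> left_limit v s.
Proof. by case: cv => _; exact. Qed.

(* A zero of the left limit would not be a jump time, forcing [v] itself to vanish. *)
Lemma left_limit_gt0 s : 0 < s -> 0 < left_limit v s.
Proof.
move=> s0; have cl := cvg_left_limit s0.
have L0 : 0 <= left_limit v s.
  apply: limr_ge; first by case: cv => _; exact.
  by near=> x; apply: ltW; apply: v_gt0; near: x; exact: nbhs_left_ge.
rewrite lt_neqAle L0 andbT; apply/eqP => /esym L.
have [taus tausb nnE] := nat_jump_times (ltW s0) nn_nd nn_rc.
have jE := jump_integralE tausb nnE (fun s => delta * left_limit v s).
have gap0 c : c \in taus -> 0 < (if c < s then s - c else 1).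
  by move=> _; case: ifP => // h; rewrite subr_gt0.
have [r r0 hr] := seq_lower_bound gap0.
(* Other jump times are at distance at least [r] from [s], and a jump at [s] itself has size
   [delta * left_limit v s], which is zero here. *)
have Jconst x : s - r < x -> x <= s -> jump_integral (fun s => delta * left_limit v s) (fun s => (nn s)%:R) x =
    jump_integral (fun s => delta * left_limit v s) (fun s => (nn s)%:R) s.
  move=> rx xs; rewrite !jE//.
  rewrite [LHS]big_seq_cond [RHS]big_seq_cond [LHS]big_mkcond [RHS]big_mkcond/=.
  apply: eq_bigr => c _; have [ct|] //= := boolP (c \in taus).
  have /andP[c0 cs] := tausb _ ct; rewrite cs.
  move: cs; rewrite le_eqVlt => /predU1P[->|cs].
    by case: ifP => // _; rewrite L mulr0.
  have := hr _ ct; rewrite cs => h; rewrite ifT//; apply: ltW; apply: le_lt_trans rx.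
  by rewrite lerBrDl -lerBrDr.
have cI : i_ x @[x --> s^'-] --> i_ s.
  have : {within `[0, s], continuous i_}.
    by apply: continuous_subspaceW ci => x /=; rewrite !in_itv/= => /andP[->].
  by move=> /(continuous_within_itvP _ s0)[].
have cD : (\int[lebesgue_measure]_(u in `[0, x]) f (v u)) @[x --> s^'-] -->
     \int[lebesgue_measure]_(u in `[0, s]) f (v u).
  have := parameterized_integral_continuous (ltW s0) (fint (ltW s0)).
  by move=> /(continuous_within_itvP _ s0)[].
have cvs : v x @[x --> s^'-] --> v s.
  rewrite (veq (ltW s0)).
  apply: (@cvg_trans _ ((y0 + \int[lebesgue_measure]_(u in `[0, x]) f (v u) + i_ x +
    jump_integral (fun s => delta * left_limit v s) (fun s => (nn s)%:R) s) @[x --> s^'-])).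
    apply: near_eq_cvg; near=> x; rewrite veq; last by near: x; apply: nbhs_left_ge.
    congr (_ + _); rewrite (@Jconst x)//.
    by near: x; apply: nbhs_left_gt; rewrite ltrBlDr ltrDl.
  by apply: cvgD; [apply: cvgD => //; apply: cvgD => //; exact: cvg_cst|exact: cvg_cst].
have vs : v s = left_limit v s by apply: (cvg_unique _ cvs cl); exact: norm_hausdorff.
by have := v_gt0 (ltW s0); rewrite vs L ltxx.
Unshelve. all: by end_near. Qed.

Hypotheses (cf : forall x : R, 0 < x -> {for x, continuous f}).

(** The stochastic part is subtracted, so what remains is the quadrature error of drift and jumps on
    a single path; [W] is arbitrary. *)
Lemma euler_error (b e : R) : 0 <= b -> 0 < e -> exists m0 : nat, forall m, (m0 <= m)%N ->
  forall j, (j <= m.+1)%N ->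
  `|(y0 + \sum_(i < j) (f (v (grid b m i)) * (grid b m i.+1 - grid b m i) +
      g (v (grid b m i)) * (W (grid b m i.+1) - W (grid b m i)) +
      delta * v (grid b m i) * ((nn (grid b m i.+1))%:R - (nn (grid b m i))%:R))) - v (grid b m j)
    - (\sum_(i < j) g (v (grid b m i)) * (W (grid b m i.+1) - W (grid b m i)) - i_ (grid b m j))| <= e.
Proof.
move=> b0 e0; have e2 : 0 < e / 2 by rewrite divr_gt0.
have [cfv _] := cadlag_comp cv v_gt0 left_limit_gt0 cf.
have [m1 h1] := cadlag_riemann cfv b0 e2.
have [taus tausb nnE] := nat_jump_times b0 nn_nd nn_rc.
have cJ c : 0 < c -> delta * v x @[x --> c^'-] --> delta * left_limit v c.
  by move=> c0; apply: cvgM; [exact: cvg_cst|exact: cvg_left_limit].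
have [m2 h2] := jump_riemann tausb nnE b0 e2 cJ.
exists (maxn m1 m2) => m; rewrite geq_max => /andP[/h1 k1 /h2 k2] j jm.
have {}k1 := le_trans (riemann_error cfv b0 jm) k1.
rewrite distrC in k1; have {}k2 := k2 j jm.
rewrite (veq (@grid_ge0 _ b m j b0)) !big_split/=.
have -> : \sum_(i < j) f (v (grid b m i)) * (grid b m i.+1 - grid b m i) =
   \sum_(i < j) (f \o v) (grid b m i) * (b / m.+1%:R).
  by apply: eq_bigr => i _; rewrite gridS addrC addKr.
rewrite (splitr e); apply: le_trans (lerD k1 k2).
apply: le_trans (ler_normD _ _); rewrite le_eqVlt; apply/orP; left; apply/eqP; congr (`| _ |).
by rewrite /comp; ring.
Qed.
End path.

Section euler.
Context {R : realType} {d : measure_display} {T : measurableType d}.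
Variables (P : probability T R) (F : R -> set (set T)).
Hypothesis hF : filtration F.
Variables (B : R -> T -> R) (lambda : R) (N : R -> T -> nat).
Hypotheses (hB : brownian_motion P F B) (hN : poisson_process P F lambda N).
Variables (f g : R -> R) (delta y0 : R) (y : R -> T -> R).
Hypotheses (cf : forall x : R, 0 < x -> {for x, continuous f})
  (cg : forall x : R, 0 < x -> {for x, continuous g})
  (mf : measurable_fun setT f) (mg : measurable_fun setT g)
  (hy : positive_global_solution P F B N f g (fun x => delta * x) y0 y).
Variable b : R.
Hypothesis b0 : 0 <= b.

Let s m i := grid b m i.
Let s0 m i : 0 <= s m i. Proof. exact: grid_ge0. Qed.

(** The coefficients are read off the solution, not off the scheme, so the distance between the two
    is a sum of quadrature errors and calls for no Gronwall or Lipschitz argument. *)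
Definition euler m j w := y0 + \sum_(i < j)
  (f (y (s m i) w) * (s m i.+1 - s m i) + g (y (s m i) w) * (B (s m i.+1) w - B (s m i) w) +
   delta * y (s m i) w * ((N (s m i.+1) w)%:R - (N (s m i) w)%:R)).

Lemma measurable_wrt_euler m j : measurable_wrt (F (s m j)) (euler m j).
Proof.
have sG := filtration_sigma_algebra hF (s0 m j).
apply: (measurable_wrtD sG); first exact: measurable_wrt_cst.
apply: (@measurable_wrt_sum _ _ _ _ sG _ _ (fun i : 'I_j => fun w =>
  f (y (s m i) w) * (s m i.+1 - s m i) + g (y (s m i) w) * (B (s m i.+1) w - B (s m i) w) +
   delta * y (s m i) w * ((N (s m i.+1) w)%:R - (N (s m i) w)%:R))) => i.
have FS k : (k <= j)%N -> F (s m k) `<=` F (s m j).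
  by move=> kj; apply: (filtration_nondecreasing hF (s0 m k)); exact: grid_nd.
have i1 := FS _ (ltn_ord i); have i0 := FS _ (ltnW (ltn_ord i)).
have my := measurable_wrtS i0 (solution_adapted hy (s0 m i)).
have mB k : (k <= j)%N -> measurable_wrt (F (s m j)) (B (s m k)).
  by move=> kj; exact: measurable_wrtS (FS _ kj) (brownian_adapted hB (s0 m k)).
have mN k : (k <= j)%N -> measurable_wrt (F (s m j)) (fun w => (N (s m k) w)%:R : R).
  by move=> kj; exact: (measurable_wrtS (FS _ kj) (poisson_adapted hN (s0 m k))).
apply: (measurable_wrtD sG); first apply: (measurable_wrtD sG).
- by apply: (measurable_wrtM sG); [exact: (measurable_wrt_comp sG mf my)|exact: measurable_wrt_cst].
- apply: (measurable_wrtM sG); first exact: (measurable_wrt_comp sG mg my).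
  by apply: (measurable_wrtB sG); apply: mB => //; exact: ltnW.
- apply: (measurable_wrtM sG); first by apply: (measurable_wrtM sG) => //; exact: measurable_wrt_cst.
  by apply: (measurable_wrtB sG); apply: mN => //; exact: ltnW.
Qed.

Hypotheses (Nmono : forall w (s t : R), 0 <= s -> s <= t -> (N s w <= N t w)%N).

Lemma solution_paths : \forall w \ae P, [/\ cadlag (y ^~ w), forall t, 0 <= t -> 0 < y t w &
  forall t, 0 < t -> 0 < left_limit (y ^~ w) t].
Proof.
have [I [[hI1 _] hI2]] := solution_equation hy.
apply: filterS (filterI (filterI (filterI (solution_cadlag hy) (solution_positive hy))
  (filterI (solution_drift_integrable hy) (poisson_right_continuous hN))) (filterI hI1 hI2)).
move=> w [[[c1 c2] [c3 c4]] [c5 c6]]; split=> //.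
exact: (@left_limit_gt0 _ f (y ^~ w) (I ^~ w) (N ^~ w) delta y0 c1 c2 (Nmono w) c4 c3 c5 c6).
Qed.

Lemma euler_small (eta : R) : 0 < eta -> small_probability P
  (fun m => [set w | exists2 j, (j <= m.+1)%N & eta < `|euler m j w - y (s m j) w|]).
Proof.
move=> eta0; have e2 : 0 < eta / 2 by rewrite divr_gt0.
have [I [hI hI2]] := solution_equation hy; have [hI1 _] := hI.
have hgy : adapted F (fun s w => g (y s w)).
  move=> t t0; exact: (measurable_wrt_comp (filtration_sigma_algebra hF t0) mg (solution_adapted hy t0)).
have cgy : \forall w \ae P, cadlag (fun s => g (y s w)).
  apply: filterS solution_paths => w [c1 c2 c3].
  by have [] := cadlag_comp c1 c2 c3 cg.
have [A sA hA] := ito_riemann hF hB hgy cgy hI b0 e2.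
apply: (@small_probability_ae _ _ _ P _ A) => //.
  move=> m; apply: measurable_exists_norm_gt => j _; apply: measurable_funB.
    exact: (measurable_wrt_fun (filtration_measurable hF (s0 m j)) (@measurable_wrt_euler m j)).
  exact: (measurable_wrt_fun (filtration_measurable hF (s0 m j)) (solution_adapted hy (s0 m j))).
apply: filterS (filterI (filterI (filterI (solution_cadlag hy) (solution_positive hy))
  (filterI (solution_drift_integrable hy) (poisson_right_continuous hN))) (filterI hI1 hI2)).
move=> w [[[c1 c2] [c3 c4]] [c5 c6]].
have [m0 hm0] := euler_error g (B ^~ w) c1 c2 (Nmono w) c4 c3 c5 c6 cf b0 e2.
exists m0 => m /hm0 hm [j jm]; rewrite ltNge => /negP hE.
apply: contrapT => /(hA m w j jm) h; apply: hE.
have := lerD (hm j jm) h; rewrite -splitr; apply: le_trans.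
by apply: le_trans (ler_normD _ _); rewrite subrK.
Qed.
End euler.

(** * The exponential bound for a bounded Lyapunov function *)

Section lyapunov_bound.
Context {R : realType} {d : measure_display} {T : measurableType d}.
Variables (P : probability T R) (F : R -> set (set T)).
Hypothesis hF : filtration F.
Variables (B : R -> T -> R) (lambda : R) (N : R -> T -> nat).
Hypotheses (hB : brownian_motion P F B) (lambda0 : 0 < lambda)
  (hN : poisson_process P F lambda N)
  (Nmono : forall w (s t : R), 0 <= s -> s <= t -> (N s w <= N t w)%N).
Variables (phi phi1 phi2 f g : R -> R) (M delta : R).
Hypotheses (phiM : forall x, 0 <= phi x <= M)
  (dphi : forall x : R, 0 < x -> is_derive x 1 phi (phi1 x))
  (dphi1 : forall x : R, 0 < x -> is_derive x 1 phi1 (phi2 x))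
  (cphi2 : forall x : R, 0 < x -> {for x, continuous phi2})
  (cf : forall x : R, 0 < x -> {for x, continuous f})
  (cg : forall x : R, 0 < x -> {for x, continuous g})
  (mphi : measurable_fun setT phi) (mphi1 : measurable_fun setT phi1)
  (mphi2 : measurable_fun setT phi2) (mf : measurable_fun setT f)
  (mg : measurable_fun setT g) (delta0 : 0 <= delta).

Let gen := generator lambda phi phi1 phi2 f g delta.

Lemma generator_perturb (c C e : R) : 0 < c -> 0 < e ->
  exists2 eta : R, 0 < eta & forall x v, c <= x <= C -> c <= v <= C -> `|x - v| <= eta ->
    gen x v <= gen v v + e /\ `|phi x - phi v| <= e.
Proof.
move=> c0 e0.
have [Af Af0 hAf] : exists2 L : R, 0 < L & forall x, c <= x <= C -> `|f x| <= L.
  by apply: bounded_itv => x /andP[cx _]; apply: cf; exact: lt_le_trans cx.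
have [Ag Ag0 hAg] : exists2 L : R, 0 < L & forall x, c <= x <= C -> `|g x| <= L.
  by apply: bounded_itv => x /andP[cx _]; apply: cg; exact: lt_le_trans cx.
(* The first three summands weigh the variations of [phi1], [phi2] and [phi] in the generator; the
   last one gives [e1 <= e]. *)
pose L := Af + Ag ^+ 2 / 2 + 2 * lambda + 1.
have L1 : 1 <= L.
  by rewrite /L lerDr !addr_ge0 ?mulr_ge0 ?sqr_ge0// ltW.
have L0 : 0 < L by exact: lt_le_trans L1.
pose e1 := e / L.
have e10 : 0 < e1 by rewrite divr_gt0.
have e1e : e1 <= e by rewrite ler_pdivrMr// ler_peMr// ltW.
have [r0 r00 hr0] := @unif_continuous_itv _ phi c (C + delta * C) e1 e10 
  (fun x xc => @is_derive_continuous _ _ _ _ (dphi (lt_le_trans c0 (andP xc).1))).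
have [r1 r10 hr1] := @unif_continuous_itv _ phi1 c C e1 e10
  (fun x xc => @is_derive_continuous _ _ _ _ (dphi1 (lt_le_trans c0 (andP xc).1))).
have [r2 r20 hr2] := @unif_continuous_itv _ phi2 c C e1 e10
  (fun x xc => cphi2 (lt_le_trans c0 (andP xc).1)).
exists (Num.min r0 (Num.min r1 r2)); first by rewrite !lt_min r00 r10.
move=> x v xc vc; rewrite !le_min => /and3P[d0 d1 d2].
have v0 : 0 <= v by rewrite (le_trans (ltW c0))//; case/andP: vc.
have C0 : 0 <= C by case/andP: vc => _; exact: le_trans.
have dv : 0 <= delta * v by rewrite mulr_ge0.
have dvC : delta * v <= delta * C by rewrite ler_wpM2l//; case/andP: vc.
have dC : 0 <= delta * C by rewrite mulr_ge0.
have wide u : c <= u <= C -> c <= u <= C + delta * C.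
  by move=> /andP[-> h] /=; rewrite (le_trans h)// lerDl.
have wided u : c <= u <= C -> c <= u + delta * v <= C + delta * C.
  by move=> /andP[h1 h2] /=; rewrite lerD// (le_trans h1)// lerDl.
have k0 := hr0 x v (wide x xc) (wide v vc) d0.
have k0' := hr0 _ _ (wided x xc) (wided v vc).
rewrite opprD addrACA subrr addr0 in k0'; have {}k0' := k0' d0.
have k1 := hr1 x v xc vc d1; have k2 := hr2 x v xc vc d2.
split; last exact: le_trans k0 e1e.
have t1 : (phi1 x - phi1 v) * f v <= e1 * Af.
  by apply: le_trans (ler_norm _) _; rewrite normrM ler_pM// hAf.
have t2 : (phi2 x - phi2 v) * (g v ^+ 2 / 2) <= e1 * (Ag ^+ 2 / 2).
  apply: le_trans (ler_norm _) _; rewrite normrM ler_pM//.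
  rewrite ger0_norm; last by rewrite mulr_ge0// sqr_ge0.
  rewrite ler_pM2r ?invr_gt0//.
  by rewrite -real_normK ?num_real// lerXn2r ?nnegrE ?hAg// ltW.
have t3 : lambda * ((phi (x + delta * v) - phi (v + delta * v)) - (phi x - phi v)) <= e1 * (2 * lambda).
  have -> : e1 * (2 * lambda) = lambda * (2 * e1) by ring.
  rewrite ler_pM2l//.
  move: k0 k0'; rewrite !ler_norml => /andP[? ?] /andP[? ?]; lra.
have eE : e1 * L = e by rewrite divfK// gt_eqF.
have -> : gen x v = gen v v + ((phi1 x - phi1 v) * f v + (phi2 x - phi2 v) * (g v ^+ 2 / 2) +
   lambda * ((phi (x + delta * v) - phi (v + delta * v)) - (phi x - phi v))).
  rewrite /gen /generator; ring.
rewrite lerD2l -eE /L; apply: le_trans (lerD (lerD t1 t2) t3) _.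
by rewrite -!mulrDr ler_pM2l// lerDl.
Qed.

Variables (y0 : R) (y : R -> T -> R) (K t : R).
Hypotheses (hy : positive_global_solution P F B N f g (fun x => delta * x) y0 y)
  (K0 : 0 <= K) (t0 : 0 < t)
  (hgen : forall v : R, 0 < v -> gen v v <= K - phi v).

Let s m i := grid t m i.
Let s0 m i : 0 <= s m i. Proof. by apply: grid_ge0; exact: ltW. Qed.
Let E m i w := euler B N f g delta y0 y t m i w.

(** The events [A i] shrink with [i] and [phi] is nonnegative, so restricting to the next event only
    lowers the expectation and the one-step bound can be iterated. *)
Lemma euler_expectation (c C eta e : R) : 0 < c -> 0 < e ->
  (forall x v, c <= x <= C -> c <= v <= C -> `|x - v| <= eta -> gen x v <= gen v v + e /\ `|phi x - phi v| <= e) ->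
  exists m0 : nat, forall m, (m0 <= m)%N ->
  let A i := [set w | forall j, (j <= i)%N ->
    [/\ c <= E m j w <= C, c <= y (s m j) w <= C & `|E m j w - y (s m j) w| <= eta]] in
  F t (A m.+1) /\ 
  \int[P]_w (\1_(A m.+1) w * phi (E m m.+1 w)) <= expR (- t) * phi y0 + K + 4 * e.
Proof.
move=> c0 e0 heta; have t0' := ltW t0.
have Ke0 : 0 <= K + 2 * e by rewrite addr_ge0// mulr_ge0// ltW.
(* The [2 * e] pays for moving from [v] to [x] in the generator and in [phi]. *)
have [D0 D00 [kap kap0 step]] := @one_step_expectation _ _ _ P F hF B lambda N hB lambda0 hN Nmono
  phi phi1 phi2 f g M delta phiM dphi dphi1 cphi2 cf cg mphi mphi1 mphi2 mf mg delta0
  c C e (K + 2 * e) c0 e0 Ke0.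
have kap1 : 0 < kap + 1 by rewrite ltr_wpDl.
have [m0 hm0] := @mesh_small _ t (Num.min (Num.min D0 1) (e / (kap + 1))) 
  (ltac:(by rewrite !lt_min D00 ltr01 divr_gt0)).
exists m0 => m /hm0; rewrite !le_min => /andP[/andP[hD0 hD1] hDk] A.
set D := t / m.+1%:R in hD0 hD1 hDk.
have Dgt0 : 0 < D by rewrite divr_gt0.
have Dge0 := ltW Dgt0.
have sS i : s m i.+1 - s m i = D by rewrite /s gridS addrC addKr.
have FS i j : (i <= j)%N -> F (s m i) `<=` F (s m j).
  by move=> ij; apply: (filtration_nondecreasing hF (s0 m i)); exact: grid_nd.
have sG i := filtration_sigma_algebra hF (s0 m i).
have Gm i := filtration_measurable hF (s0 m i).
have mE i : measurable_wrt (F (s m i)) (E m i) by exact: (measurable_wrt_euler hF hB hN mf mg hy t0').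
have my i : measurable_wrt (F (s m i)) (y (s m i)) by exact: (solution_adapted hy (s0 m i)).
have mcst i (k : R) := measurable_wrt_cst (sG i) k.
have FA i : F (s m i) (A i).
  rewrite (_ : A i = \bigcap_(j in [set j | (j <= i)%N])
    (([set w | c <= E m j w] `&` [set w | E m j w <= C]) `&`
     ([set w | c <= y (s m j) w] `&` [set w | y (s m j) w <= C]) `&`
     [set w | `|E m j w - y (s m j) w| <= eta])); last first.
    apply/seteqP; split=> w h j /= ij.
      by have [/andP[? ?] /andP[? ?] ?] := h j ij.
    by have [[[-> ->] [-> ->]] ->] := h j ij.
  apply: (sigma_algebra_bigcap (sG i)) => j /= ji.
  have mEj := measurable_wrtS (FS _ _ ji) (mE j).
  have myj := measurable_wrtS (FS _ _ ji) (my j).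
  apply: (sigma_algebraI (sG i)); first apply: (sigma_algebraI (sG i)).
  - apply: (sigma_algebraI (sG i)); exact: (measurable_wrt_le (sG i)).
  - apply: (sigma_algebraI (sG i)); exact: (measurable_wrt_le (sG i)).
  - apply: (measurable_wrt_le (sG i) _ (mcst i eta)).
    apply: (measurable_wrt_comp (sG i) (@normr_measurable R setT)).
    exact: (measurable_wrtB (sG i)).
have iA i k : has_expectation P (fun w => \1_(A i) w * phi (E m k w)) (\int[P]_w (\1_(A i) w * phi (E m k w))).
  apply: (@has_expectation_bounded _ _ _ P _ M).
    apply: measurable_funM; first by apply: measurable_indic; exact: (@Gm i).
    apply: measurableT_comp => //; exact: (measurable_wrt_fun (@Gm k)).
  move=> w; have /andP[h1 h2] := phiM (E m k w); rewrite ger0_norm ?mulr_ge0// indicE.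
  by case: (_ \in _); rewrite ?mul1r ?mul0r//; exact: le_trans h2.
have rec i : \int[P]_w (\1_(A i.+1) w * phi (E m i.+1 w)) <=
   (1 - D) * \int[P]_w (\1_(A i) w * phi (E m i w)) + (K + 2 * e + e) * D + kap * D ^+ 2.
  apply: (@le_trans _ _ (\int[P]_w (\1_(A i) w * phi (E m i.+1 w)))).
    apply: (has_expectation_le (iA i.+1 i.+1) (iA i i.+1)) => w.
    have /andP[h1 _] := phiM (E m i.+1 w); rewrite ler_wpM2r// !indicE ler_nat.
    have [wA|//] := boolP (w \in A i.+1); rewrite inE in wA.
    rewrite mem_set// => j ji; apply: wA; exact: leqW.
  have ss' : s m i < s m i.+1 by rewrite -subr_gt0 sS.
  have := step (s m i) (s m i.+1) (A i) (E m i) (y (s m i)) (s0 m i) ss'.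
  rewrite sS => /(_ hD0 (FA i) (mE i) (my i)) h.
  have Eq : (fun w => E m i w + (f (y (s m i) w) * D + g (y (s m i) w) * (B (s m i.+1) w - B (s m i) w) +
     delta * y (s m i) w * ((N (s m i.+1) w)%:R - (N (s m i) w)%:R))) = E m i.+1.
    by apply/funext => w; rewrite -(sS i) /E /euler big_ord_recr/= -[LHS]addrA.
  move: h; under eq_Rintegral => w _ do rewrite (congr1 (fun u : T -> R => u w) Eq).
  apply=> w wA; have [h1 h2 h3] := wA i (leqnn i); split=> //.
  have [h4 h5] := heta _ _ h1 h2 h3.
  have yi : 0 < y (s m i) w by apply: lt_le_trans c0 _; case/andP: h2.
  have := hgen yi; move: h4 h5; rewrite ler_norml => h4 /andP[h5 h6] h7.
  rewrite -/gen; lra.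
split; first by have := FA m.+1; rewrite /s gridT.
(* The fixed point of the recursion: [(1 - D) * K1] plus the increment
   [(K + 3 * e) * D + kap * D ^+ 2] gives [K1] back. *)
pose K1 := K + 3 * e + kap * D.
have bound i : \int[P]_w (\1_(A i) w * phi (E m i w)) <= (1 - D) ^+ i * phi y0 + K1.
  have K10 : 0 <= K1 by rewrite !addr_ge0// mulr_ge0// ltW.
  elim: i => [|i IH].
    rewrite expr0 mul1r (@le_trans _ _ (phi y0)) ?lerDl//.
    apply: (has_expectation_le (iA 0%N 0%N) (has_expectation_cst P (phi y0))) => w.
    have -> : E m 0 w = y0 by rewrite /E /euler big_ord0 addr0.
    have /andP[h1 _] := phiM y0; rewrite indicE; case: (_ \in _); by rewrite ?mul1r ?mul0r.
  apply: le_trans (rec i) _.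
  have D1 : 0 <= 1 - D by rewrite subr_ge0.
  have := ler_wpM2l D1 IH; rewrite [(1 - D) ^+ i.+1]exprS -(mulrA (1 - D)) /K1.
  move: (_ ^+ i * _) (\int[P]_w _) => q v; lra.
apply: le_trans (bound m.+1) _; rewrite -addrA.
have hexp : (1 - D) ^+ m.+1 <= expR (- t).
  have -> : - t = m.+1%:R * - D by rewrite /D; field.
  rewrite expRM_natl; apply: lerXn2r; rewrite ?nnegrE ?subr_ge0 ?expR_ge0//.
  exact: expR_ge1Dx.
have /andP[h1 _] := phiM y0.
apply: lerD; first by rewrite ler_wpM2r.
rewrite /K1 -addrA lerD2l.
have : kap * D <= e; last by lra.
apply: le_trans (_ : (kap + 1) * D <= _); first by rewrite ler_wpM2r// lerDl.
by rewrite mulrC -ler_pdivlMr.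
Qed.

Lemma lyapunov_expectation : \int[P]_w phi (y t w) <= expR (- t) * phi y0 + K.
Proof.
have t0' := ltW t0.
have M0 : 0 <= M by have /andP[h1 h2] := phiM 0; exact: le_trans h2.
have mys r : 0 <= r -> measurable_fun setT (y r).
  by move=> r0; exact: (measurable_wrt_fun (filtration_measurable hF r0) (solution_adapted hy r0)).
pose in_range n m j w := n.+1%:R^-1 <= y (s m j) w <= n.+1%:R.
(* The grid times of all meshes are taken together, so the range [n] can be fixed before the mesh,
   and the union is still countable. *)
pose Z n := \bigcup_m \bigcup_(j in [set j | (j <= m.+1)%N]) [set w | ~ in_range n m j w].
have smallZ : small_probability P Z.
  apply: (@small_probability_ae _ _ _ P _ (fun=> set0)).
  - move=> n; apply: bigcupT_measurable => m; apply: bigcup_measurable => j _.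
    rewrite (_ : [set w | _] = ~` ((y (s m j)) @^-1` `[n.+1%:R^-1, n.+1%:R])); last first.
      by apply/seteqP; split=> w /=; rewrite in_itv.
    apply: measurableC; rewrite -[X in measurable X]setTI.
    exact: mys.
  - by split=> // e e0; exists 0%N => m _; rewrite measure0 lee_fin ltW.
  apply: filterS (solution_paths hN hy Nmono) => w [c1 c2 c3].
  have [n0 hn0] := positive_path_bounds t c1 c2 c3.
  exists n0 => n nn [m _ [j /= jm]]; apply; apply: hn0 => //.
  by rewrite s0 grid_le.
(* The scheme costs [4 * e], replacing it by the solution at time [t] another [e], and each of the
   exceptional events [Z n] and [Em] costs [M * e]. *)
apply: (@le_of_small _ _ _ (5 + 2 * M)) => e /andP[e0 e1].
have [mZ /(_ _ e0)[n hn]] := smallZ; have {}hn := hn n (leqnn n).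
pose c0 : R := n.+1%:R^-1.
have c00 : 0 < c0 by rewrite invr_gt0.
have c02 : 0 < c0 / 2 by rewrite divr_gt0.
(* The range is widened by [c0 / 2] below and 1 above, so a scheme within [eta] of a solution in
   range is itself in the compact set. *)
have [eta' eta'0 heta'] := @generator_perturb (c0 / 2) (n.+1%:R + 1) e c02 e0.
pose eta := Num.min eta' (Num.min (c0 / 2) 1).
have eta0 : 0 < eta by rewrite !lt_min eta'0 c02 ltr01.
have [eta1 [eta2 eta3]] : eta <= eta' /\ (eta <= c0 / 2 /\ eta <= 1).
  by rewrite /eta !ge_min !lexx ?orbT.
have heta x v : c0 / 2 <= x <= n.+1%:R + 1 -> c0 / 2 <= v <= n.+1%:R + 1 -> `|x - v| <= eta ->
   gen x v <= gen v v + e /\ `|phi x - phi v| <= e.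
  by move=> xc vc xv; apply: heta' => //; exact: le_trans xv eta1.
have [m1 hm1] := euler_expectation c02 e0 heta.
have [mE /(_ _ e0)[m2 hm2]] := euler_small hF hB hN cf cg mf mg hy t0' Nmono eta0.
pose m := maxn m1 m2.
have {hm2} := hm2 m (leq_maxr _ _).
set Em := [set w | exists2 j, _ & _] => hE.
pose A := [set w | forall j, (j <= m.+1)%N -> [/\ c0 / 2 <= E m j w <= n.+1%:R + 1,
  c0 / 2 <= y (s m j) w <= n.+1%:R + 1 & `|E m j w - y (s m j) w| <= eta]].
have [FA hA] : F t A /\ \int[P]_w (\1_A w * phi (E m m.+1 w)) <= expR (- t) * phi y0 + K + 4 * e.
  exact: hm1 (leq_maxl _ _).
have mEm : measurable Em by exact: mE.
have mA : measurable A by exact: (filtration_measurable hF t0' FA).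
have EmE w : E m m.+1 w = euler B N f g delta y0 y t m m.+1 w by [].
have meul : measurable_fun setT (E m m.+1).
  by apply: (measurable_wrt_fun (filtration_measurable hF (s0 m m.+1))); exact: (measurable_wrt_euler hF hB hN mf mg hy t0').
have indP (D : set T) : measurable D -> (P D <= e%:E)%E -> exists2 q, q <= e & has_expectation P (\1_D) q.
  move=> mD PD; exists (fine (P D)).
    by rewrite -lee_fin fineK ?fin_num_measure.
  split; last by rewrite /Rintegral integral_indic// setIT.
  by apply: (@bounded_integrable _ _ _ P _ 1) => // w; rewrite indicE; case: (_ \in _); rewrite ?normr1 ?normr0.
have [qE qEe iE] := indP _ mEm hE.
have [qZ qZe iZ] := indP _ (mZ n) hn.
have iA : has_expectation P (fun w => \1_A w * phi (E m m.+1 w)) (\int[P]_w (\1_A w * phi (E m m.+1 w))).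
  apply: (@has_expectation_bounded _ _ _ P _ M).
    by apply: measurable_funM => //; exact: measurableT_comp.
  move=> w; have /andP[h1 h2] := phiM (E m m.+1 w); rewrite ger0_norm ?mulr_ge0// indicE.
  by case: (_ \in _); rewrite ?mul1r ?mul0r//; exact: le_trans h2.
have iphi : has_expectation P (fun w => phi (y t w)) (\int[P]_w phi (y t w)).
  apply: (@has_expectation_bounded _ _ _ P _ M).
    by apply: measurableT_comp => //; exact: mys.
  by move=> w; have /andP[h1 h2] := phiM (y t w); rewrite ger0_norm.
have main := has_expectation_le iphi (has_expectationD (has_expectationD (has_expectationD iA (has_expectation_cst P e))
  (has_expectationZ M iE)) (has_expectationZ M iZ)).
apply: le_trans (main _) _ => [w|]; last first.
  have h3 := ler_wpM2l M0 qEe; have h4 := ler_wpM2l M0 qZe; lra.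
have I0 (D : set T) : 0 <= M * \1_D w by rewrite mulr_ge0.
have /andP[p0 pM] := phiM (y t w).
have Ap0 : 0 <= \1_A w * phi (E m m.+1 w) by have /andP[? _] := phiM (E m m.+1 w); exact: mulr_ge0.
have [wZ|wZ] := pselect (Z n w).
  have -> : \1_(Z n) w = 1 :> R by rewrite indicE mem_set.
  have := I0 Em; lra.
have [wE|wE] := pselect (Em w).
  have -> : \1_Em w = 1 :> R by rewrite indicE mem_set.
  have := I0 (Z n); lra.
have wA : A w.
  move=> j jm.
  have hd : `|E m j w - y (s m j) w| <= eta.
    by rewrite leNgt; apply/negP => h; apply: wE; exists j.
  have /andP[r1 r2] : in_range n m j w.
    by apply: contrapT => h; apply: wZ; exists m => //; exists j.
  rewrite -/c0 in r1.
  by split=> //; move: hd; rewrite ler_norml => /andP[d1 d2]; apply/andP; split; lra.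
have [h1 h2 h3] := wA m.+1 (leqnn _).
have [_ hphi] := heta _ _ h1 h2 h3.
have -> : \1_A w = 1 :> R by rewrite indicE mem_set.
have st : s m m.+1 = t by rewrite /s gridT.
move: hphi; rewrite st distrC mul1r ler_norml => /andP[_ hphi].
have := I0 Em; have := I0 (Z n); lra.
Qed.
End lyapunov_bound.

(** * The Lyapunov function *)

Lemma is_derive_powR {R : realType} (a x : R) : 0 < x ->
  is_derive x 1 (fun z => z `^ a) (a * x `^ (a - 1)).
Proof.
move=> x0; have xI : x \in `]0, +oo[ by rewrite in_itv/= x0.
apply: DeriveDef; first exact: derivable_powR.
by rewrite -derive1E powR_derive1.
Qed.

Lemma continuous_powR {R : realType} (a x : R) : 0 < x -> {for x, continuous (fun z => z `^ a)}.
Proof.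
move=> x0.
exact: (@is_derive_continuous R (fun z => z `^ a) (fun=> a * x `^ (a - 1)) x (is_derive_powR a x0)).
Qed.

Lemma gt0_powRD {R : realType} (x k l : R) : 0 < x -> x `^ (k + l) = x `^ k * x `^ l.
Proof. by move=> x0; rewrite powRD// (gt_eqF x0) /= implybT. Qed.

Lemma power_absorb {R : realType} (r m C kap : R) : 0 <= r -> r < m -> 0 <= C -> 0 < kap ->
  exists2 K : R, 0 <= K & forall v, 0 < v -> C * v `^ r <= kap * v `^ m + K.
Proof.
move=> r0 rm C0 k0; have mr : 0 < m - r by rewrite subr_gt0.
(* At [V] the two power terms are equal; above it the higher power dominates, below it the lower one
   is at most its value at [V]. *)
pose V := (C / kap) `^ (m - r)^-1.
exists (C * V `^ r) => [|v v0]; first by rewrite mulr_ge0// powR_ge0.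
have [h|h] := leP v V.
  rewrite -[leLHS]add0r lerD ?mulr_ge0 ?powR_ge0 ?(ltW k0)//.
  by rewrite ler_wpM2l// ge0_ler_powR ?nnegrE ?powR_ge0// ltW.
rewrite -[leLHS]addr0 lerD ?mulr_ge0 ?powR_ge0//.
have -> : v `^ m = v `^ (m - r) * v `^ r by rewrite -gt0_powRD// subrK.
rewrite mulrA ler_wpM2r ?powR_ge0// mulrC -ler_pdivrMr//.
have -> : C / kap = V `^ (m - r) by rewrite /V -powRrM mulVf ?gt_eqF// powRr1// divr_ge0// ltW.
by rewrite ge0_ler_powR ?nnegrE ?powR_ge0// ltW.
Qed.

Section lyapunov_function.
Context {R : realType}.
Variables (p q eps : R).
Hypotheses (p2 : 2 <= p) (q0 : 0 < q) (eps0 : 0 < eps).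

Let a := p / q.
Let p0 : 0 < p. Proof. exact: lt_le_trans p2. Qed.
Let a0 : 0 < a. Proof. exact: divr_gt0. Qed.
Let aq : q * a = p. Proof. by rewrite /a mulrC divfK// gt_eqF. Qed.

Definition damping (x : R) := 1 + eps * x `^ q.
(** For positive [x] this is the [p]-th power of [x / (1 + eps x^q)^(1/q)], a smooth truncation of
    [x] at level [eps^(-1/q)]. *)
Definition lyapunov x := x `^ p * damping x `^ (- (p / q)).
Definition lyapunov1 x := p * x `^ (p - 1) * damping x `^ (- (p / q) - 1).
Definition lyapunov2 x := p * (p - 1) * x `^ (p - 2) * damping x `^ (- (p / q) - 1) -
  p * (p + q) * eps * x `^ (p - 2 + q) * damping x `^ (- (p / q) - 2).

Lemma damping_ge1 x : 1 <= damping x.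
Proof. by rewrite lerDl mulr_ge0 ?powR_ge0// ltW. Qed.

Let d0 x : 0 < damping x. Proof. exact: lt_le_trans (damping_ge1 x). Qed.

Lemma is_derive_damping (k x : R) : 0 < x ->
  is_derive x 1 (fun z => damping z `^ k) (k * damping x `^ (k - 1) * (eps * (q * x `^ (q - 1)))).
Proof.
move=> x0; have h1 := is_derive_powR k (d0 x).
have h2 : is_derive x 1 damping (eps * (q * x `^ (q - 1))).
  have h3 := is_derive_powR q x0.
  have h4 : is_derive x 1 (cst (1 : R)) 0 by exact: is_derive_cst.
  have h5 := is_deriveD h4 (is_deriveZ eps h3).
  by apply: is_derive_eq; rewrite add0r.
exact: (@is_derive1_comp _ (fun z => z `^ k) damping).
Qed.

Lemma is_derive_lyapunov (x : R) : 0 < x -> is_derive x 1 lyapunov (lyapunov1 x).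
Proof.
move=> x0; have := is_deriveM (is_derive_powR p x0) (is_derive_damping (- (p / q)) x0).
move=> h; apply: is_derive_eq; rewrite /GRing.scale/= /lyapunov1.
have E1 : damping x `^ (- (p / q)) = damping x `^ (- (p / q) - 1) * damping x.
  by rewrite -[X in _ = _ * X]powRr1 ?(ltW (d0 x))// -gt0_powRD// subrK.
have E2 : x `^ p * x `^ (q - 1) = x `^ (p - 1) * x `^ q.
  by rewrite -!gt0_powRD//; congr (x `^ _); ring.
transitivity (p * x `^ (p - 1) * damping x `^ (- (p / q)) -
   (q * (p / q)) * eps * (x `^ p * x `^ (q - 1)) * damping x `^ (- (p / q) - 1)).
  ring.
rewrite E2 E1 aq /damping; ring.
Qed.

Lemma is_derive_lyapunov1 (x : R) : 0 < x -> is_derive x 1 lyapunov1 (lyapunov2 x).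
Proof.
move=> x0; have := is_deriveM (is_deriveZ p (is_derive_powR (p - 1) x0)) (is_derive_damping (- (p / q) - 1) x0).
move=> h; apply: is_derive_eq; rewrite /GRing.scale/= /lyapunov2.
have -> : p - 1 - 1 = p - 2 by ring.
have -> : - (p / q) - 1 - 1 = - (p / q) - 2 by ring.
have E2 : x `^ (p - 1) * x `^ (q - 1) = x `^ (p - 2 + q).
  by rewrite -!gt0_powRD//; congr (x `^ _); ring.
rewrite -E2; change (p *: x `^ (p - 1)) with (p * x `^ (p - 1)).
transitivity (p * (p - 1) * x `^ (p - 2) * damping x `^ (- (p / q) - 1) -
   p * (q * (p / q) + q) * eps * (x `^ (p - 1) * x `^ (q - 1)) * damping x `^ (- (p / q) - 2)).
  ring.
by rewrite aq.
Qed.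

Lemma continuous_lyapunov2 (x : R) : 0 < x -> {for x, continuous lyapunov2}.
Proof.
move=> x0.
have cE k : {for x, continuous (fun z => damping z `^ k)}.
  exact: (@is_derive_continuous R (fun z => damping z `^ k)
    (fun=> k * damping x `^ (k - 1) * (eps * (q * x `^ (q - 1)))) x (is_derive_damping k x0)).
have cp k := @continuous_powR R k x x0.
by apply: cvgB; (apply: cvgM; [apply: cvgM; [exact: cvg_cst|exact: cp]|exact: cE]).
Qed.

Lemma measurable_damping (k : R) : measurable_fun setT (fun x => damping x `^ k).
Proof.
apply: (measurableT_comp (@measurable_powR R k)); apply: measurable_funD => //.
by apply: measurable_funM => //; exact: measurable_powR.
Qed.

Lemma measurable_lyapunov : measurable_fun setT lyapunov.
Proof. by apply: measurable_funM; [exact: measurable_powR|exact: measurable_damping]. Qed.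

Lemma measurable_lyapunov1 : measurable_fun setT lyapunov1.
Proof.
by apply: measurable_funM; [apply: measurable_funM => //; exact: measurable_powR|exact: measurable_damping].
Qed.

Lemma measurable_lyapunov2 : measurable_fun setT lyapunov2.
Proof.
by apply: measurable_funB; (apply: measurable_funM;
  [apply: measurable_funM => //; exact: measurable_powR|exact: measurable_damping]).
Qed.

Lemma lyapunov_ge0 x : 0 <= lyapunov x.
Proof. by rewrite mulr_ge0// powR_ge0. Qed.

(** The function is the power [p / q] of [x^q / (1 + eps x^q)]. The bound covers every real [x], as
    the scheme may leave the positive half-line. *)
Lemma lyapunov_bounded x : 0 <= lyapunov x <= eps^-1 `^ (p / q).
Proof.
rewrite lyapunov_ge0 /lyapunov /= powRN ler_pdivrMr ?powR_gt0// -{1}aq powRrM -/a.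
rewrite -powRM ?invr_ge0 ?(ltW eps0) ?(ltW (d0 x))//.
apply: ge0_ler_powR; rewrite ?nnegrE; [exact: ltW|exact: powR_ge0| |].
  by rewrite mulr_ge0 ?invr_ge0 ?(ltW eps0) ?(ltW (d0 x)).
by rewrite mulrC ler_pdivlMr// mulrC /damping lerDr.
Qed.

Lemma lyapunov_le x : lyapunov x <= x `^ p.
Proof.
rewrite ler_piMr ?powR_ge0// powRN invf_le1 ?powR_gt0//.
by rewrite -(powRr0 (damping x)) ler_powR ?damping_ge1// ltW.
Qed.

(** Damping only grows under scaling by [c]; with [c = 1 + delta] the jump term is bounded by a
    multiple of the function itself, independent of [eps]. *)
Lemma lyapunov_scale (c x : R) : 1 <= c -> 0 < x -> lyapunov (c * x) <= c `^ p * lyapunov x.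
Proof.
move=> c1 x0; have c0 : 0 <= c by exact: le_trans c1.
have x0' := ltW x0.
rewrite /lyapunov (powRM _ c0 x0') mulrA; apply: ler_wpM2l.
  by apply: mulr_ge0; exact: powR_ge0.
rewrite (powRN (damping (c * x))) (powRN (damping x)).
rewrite lef_pV2; [|rewrite posrE; exact: powR_gt0|rewrite posrE; exact: powR_gt0].
apply: ge0_ler_powR; rewrite ?nnegrE; [exact: ltW|exact: ltW|exact: ltW|].
rewrite lerD2l ler_pM2l//; apply: ge0_ler_powR; rewrite ?nnegrE; [exact: ltW|exact: ltW| |].
  by rewrite mulr_ge0// ltW.
by rewrite ler_peMl// ltW.
Qed.

Lemma lyapunovE x : 0 < x ->
  lyapunov x = (x `^ p + eps * x `^ (p + q)) * damping x `^ (- (p / q) - 1).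
Proof.
move=> x0; rewrite /lyapunov.
have -> : damping x `^ (- (p / q)) = damping x * damping x `^ (- (p / q) - 1).
  by rewrite -[X in _ = X * _]powRr1 ?(ltW (d0 x))// -gt0_powRD// addrC subrK.
by rewrite mulrA /damping mulrDr mulr1 mulrCA -gt0_powRD// [p + q]addrC.
Qed.

(* By [lyapunovE], the zero-order terms carry an extra [eps * v `^ (p + q)], which the
   dissipative term absorbs when [eps] is small. *)
Lemma lyapunov_generator (am1 c0 a1 a2 b delta theta gamma lambda K kap : R) :
  0 <= c0 -> 0 <= delta -> 0 <= lambda -> 0 <= K -> gamma = q + 1 ->
  (lambda * (1 + delta) `^ p + 1) * eps <= kap ->
  (forall v, 0 < v -> p * (am1 * v `^ (p - 2) + a1 * v `^ p - a2 * v `^ (p + q)) +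
     p * (p - 1) / 2 * b ^+ 2 * v `^ (p - 2 + 2 * theta) +
     (lambda * (1 + delta) `^ p + 1) * v `^ p <= K - kap * v `^ (p + q)) ->
  forall v, 0 < v ->
  generator lambda lyapunov lyapunov1 lyapunov2
    (fun x => am1 * x^-1 - c0 + a1 * x - a2 * x `^ gamma) (fun x => b * x `^ theta) delta v v
    <= K - lyapunov v.
Proof.
move=> c00 delta0 lambda0 K0 gammaE heps hK v v0; rewrite /generator.
set D := damping v `^ (- (p / q) - 1).
have D0 : 0 < D by exact: powR_gt0.
have D1 : D <= 1.
  rewrite -(powRr0 (damping v)) ler_powR ?damping_ge1//.
  by rewrite -opprD oppr_le0 addr_ge0// ltW.
have e1 : v `^ (p - 1) * v^-1 = v `^ (p - 2).
  by rewrite -powR_inv1 ?(ltW v0)// -gt0_powRD//; congr (v `^ _); ring.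
have e2 : v `^ (p - 1) * v = v `^ p.
  by rewrite -[X in _ * X = _]powRr1 ?(ltW v0)// -gt0_powRD// subrK.
have e3 : v `^ (p - 1) * v `^ gamma = v `^ (p + q).
  by rewrite -gt0_powRD// gammaE; congr (v `^ _); ring.
have e4 : v `^ (p - 2) * (v `^ theta) ^+ 2 = v `^ (p - 2 + 2 * theta).
  by rewrite expr2 -!gt0_powRD//; congr (v `^ _); ring.
have t1 : lyapunov1 v * (am1 * v^-1 - c0 + a1 * v - a2 * v `^ gamma) <=
   D * (p * (am1 * v `^ (p - 2) + a1 * v `^ p - a2 * v `^ (p + q))).
  rewrite -e1 -e3 -e2 /lyapunov1 -/D -subr_ge0.
  have h : 0 <= D * p * v `^ (p - 1) * c0 by rewrite !mulr_ge0 ?powR_ge0 ?(ltW D0) ?(ltW p0).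
  by rewrite (_ : _ - _ = D * p * v `^ (p - 1) * c0)//; ring.
(* The second summand of [lyapunov2] enters with a favourable sign and is dropped, leaving the
   common factor [D]. *)
have t2 : lyapunov2 v * (b * v `^ theta) ^+ 2 / 2 <=
   D * (p * (p - 1) / 2 * b ^+ 2 * v `^ (p - 2 + 2 * theta)).
  rewrite -e4 /lyapunov2 -/D -subr_ge0.
  set Q := damping v `^ (- (p / q) - 2).
  have h : 0 <= p * (p + q) * eps * v `^ (p - 2 + q) * Q * (b * v `^ theta) ^+ 2 / 2.
    apply: divr_ge0 => //; apply: mulr_ge0; last exact: sqr_ge0.
    do 2 (apply: mulr_ge0; last exact: powR_ge0).
    by apply: mulr_ge0; [apply: mulr_ge0; [exact: ltW|rewrite addr_ge0// ltW]|exact: ltW].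
  by rewrite (_ : _ - _ = p * (p + q) * eps * v `^ (p - 2 + q) * Q * (b * v `^ theta) ^+ 2 / 2)//; ring.
have t3 : lambda * (lyapunov (v + delta * v) - lyapunov v) <= lambda * (1 + delta) `^ p * lyapunov v.
  rewrite -mulrA ler_wpM2l// lerBlDr -[v in v + _]mul1r -mulrDl.
  apply: le_trans (lyapunov_scale _ v0) _; first by rewrite lerDl.
  by rewrite lerDl lyapunov_ge0.
apply: le_trans (lerD (lerD t1 t2) t3) _; rewrite lyapunovE// -/D.
have h1 := ler_wpM2l (ltW D0) (hK v v0).
have h2 : (lambda * (1 + delta) `^ p + 1) * eps * (v `^ (p + q) * D) <= kap * (v `^ (p + q) * D).
  by rewrite ler_wpM2r// mulr_ge0 ?powR_ge0 ?(ltW D0).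
have h3 : D * K <= K by rewrite ler_piMl.
move: h1 h2 h3; move: (v `^ (p - 2)) (v `^ p) (v `^ (p + q)) (v `^ _) ((1 + delta) `^ p) => X2 Xp Xq Xt l1.
clear; lra.
Qed.
End lyapunov_function.

(** The noise has exponent [p - 2 + 2 * theta] and the damping drift [p + gamma - 1]: condition (i)
    says that the first is smaller, (ii) that they agree and that the drift coefficient wins. *)
Lemma dissipativity {R : realType} (am1 a1 a2 b theta gamma p L : R) :
  0 <= am1 -> 0 <= a1 -> 0 <= b -> 1 < theta -> 1 < gamma -> 2 <= p -> 0 <= L ->
  (2 * theta < gamma + 1 /\ 0 < a2) \/ (2 * theta = gamma + 1 /\ (p - 1) * b ^+ 2 / 2 < a2) ->
  exists kap K : R, [/\ 0 < kap, 0 <= K & forall v, 0 < v ->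
    p * (am1 * v `^ (p - 2) + a1 * v `^ p - a2 * v `^ (p + (gamma - 1))) +
     p * (p - 1) / 2 * b ^+ 2 * v `^ (p - 2 + 2 * theta) + L * v `^ p
    <= K - kap * v `^ (p + (gamma - 1))].
Proof.
move=> am10 a10 b0 theta1 gamma1 p2 L0.
have p0 : 0 < p by exact: lt_le_trans p2.
set m := p + (gamma - 1).
have key kap : 0 < kap -> exists2 K, 0 <= K & forall v, 0 < v ->
    p * am1 * v `^ (p - 2) + p * a1 * v `^ p + L * v `^ p <= 3 * kap * v `^ m + K.
  move=> k0; have c1 : 0 <= p * am1 by rewrite mulr_ge0// ltW.
  have c2 : 0 <= p * a1 by rewrite mulr_ge0// ltW.
  have pm : p < m by rewrite /m; lra.
  have r2 : 0 <= p - 2 by lra.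
  have r2m : p - 2 < m by rewrite /m; lra.
  have [K1 K10 h1] := power_absorb r2 r2m c1 k0.
  have [K2 K20 h2] := power_absorb (ltW p0) pm c2 k0.
  have [K3 K30 h3] := power_absorb (ltW p0) pm L0 k0.
  exists (K1 + K2 + K3); first by rewrite !addr_ge0.
  by move=> v v0; have := h1 v v0; have := h2 v v0; have := h3 v v0; lra.
move=> [[tg a20]|[tg ha]].
(* Of five equal shares, three absorb the lower-order terms, one absorbs the noise and one is left
   over. *)
- pose kap := p * a2 / 5.
  have k0 : 0 < kap by rewrite !mulr_gt0.
  have [K K0 hK] := key _ k0.
  have c1 : 0 <= p * (p - 1) / 2 * b ^+ 2 by rewrite !mulr_ge0 ?sqr_ge0 ?(ltW p0)//; lra.
  have r1 : 0 <= p - 2 + 2 * theta by lra.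
  have r1m : p - 2 + 2 * theta < m by rewrite /m; lra.
  have [K1 K10 h1] := power_absorb r1 r1m c1 k0.
  exists kap, (K + K1); split=> //; first exact: addr_ge0.
  move=> v v0; have := h1 v v0; have := hK v v0.
  have e : p * a2 * v `^ m = 5 * kap * v `^ m by rewrite /kap; field.
  lra.
(* The noise is subtracted exactly from the drift; three of the four shares absorb the lower-order
   terms. *)
- pose kap := p * (a2 - (p - 1) * b ^+ 2 / 2) / 4.
  have k0 : 0 < kap by rewrite !mulr_gt0// subr_gt0.
  have [K K0 hK] := key _ k0.
  exists kap, K; split=> // v v0; have := hK v v0.
  have -> : p - 2 + 2 * theta = m by rewrite /m tg; ring.
  have e : p * a2 * v `^ m = (4 * kap + p * (p - 1) / 2 * b ^+ 2) * v `^ m by rewrite /kap; field.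
  lra.
Qed.

(** * Null sets and the limit *)

Section poisson_modification.
Context {R : realType} {d : measure_display} {T : measurableType d}.
Variables (P : probability T R) (F : R -> set (set T)).
Hypotheses (hF : filtration F) (hFu : usual_conditions P F).

Lemma measure_eq_off_null (Z A B : set T) : measurable Z -> P Z = 0%E ->
  measurable A -> measurable B -> (forall w, ~ Z w -> A w <-> B w) -> P A = P B.
Proof.
move=> mZ PZ mA mB AB.
have le (C D : set T) : measurable C -> measurable D -> (forall w, ~ Z w -> C w -> D w) -> (P C <= P D)%E.
  move=> mC mD CD; rewrite -[leRHS]adde0 -PZ; apply: le_trans (measureU2 _ mD mZ).
  apply: le_measure; rewrite ?inE//; first exact: measurableU.
  by move=> w Cw; have [|nZ] := pselect (Z w); [right|left; exact: CD].
by apply/eqP; rewrite eq_le !le// => w /AB h /h.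
Qed.

(** The process is set to 0 on the null set of non-monotone paths. The usual conditions place this
    set in [F 0], so adaptedness survives, and null sets affect neither laws nor independence. *)
Lemma poisson_modification (lambda : R) (N : R -> T -> nat) : poisson_process P F lambda N ->
  exists N' : R -> T -> nat, [/\ poisson_process P F lambda N',
    forall w (s t : R), 0 <= s -> s <= t -> (N' s w <= N' t w)%N &
    \forall w \ae P, forall t, N' t w = N t w].
Proof.
move=> hN.
pose Z := ~` [set w | forall s t : R, 0 <= s -> s <= t -> (N s w <= N t w)%N].
have negZ : P.-negligible Z := poisson_nondecreasing hN.
have FZ := usual_complete hFu negZ.
have mZ : measurable Z := filtration_measurable hF (lexx 0) FZ.
have PZ : P Z = 0%E by exact: measure_negligible.
pose N' t w := if w \in Z then 0%N else N t w.
have N'E t w : ~ Z w -> N' t w = N t w.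
  by move=> nZ; rewrite /N' ifF//; apply/negbTE; rewrite notin_setE.
have aeN' : \forall w \ae P, forall t, N' t w = N t w.
  by apply: negligibleS negZ => w /= h; apply: contrapT => nZ; apply: h => t; exact: N'E.
have FtZ t : 0 <= t -> F t Z by move=> t0; apply: (filtration_nondecreasing hF) FZ.
have adN' : adapted F (real_process N').
  move=> t t0; have sG := filtration_sigma_algebra hF t0.
  rewrite (_ : real_process N' t = fun w => \1_(~` Z) w * real_process N t w); last first.
    apply/funext => w; rewrite /real_process /N' indicE in_setC.
    by case: (w \in Z); rewrite ?mul0r ?mul1r.
  apply: (measurable_wrtM sG); last exact: (poisson_adapted hN).
  by apply: (measurable_wrt_indic sG); case: sG => _ + _ => /(_ _ (FtZ t t0)); rewrite setTD.
have mr (n : R -> T -> nat) t : adapted F (real_process n) -> 0 <= t -> measurable_fun setT (real_process n t).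
  by move=> ad t0; exact: (measurable_wrt_fun (filtration_measurable hF t0) (ad t t0)).
have mincr (n : R -> T -> nat) s t U : adapted F (real_process n) -> 0 <= s -> s < t -> measurable U ->
    measurable ((fun w => real_process n t w - real_process n s w) @^-1` U).
  move=> ad s0 st mU; rewrite -[X in measurable X]setTI.
  by apply: measurable_funB => //; apply: mr => //; exact: le_trans (ltW st).
have mlaw (n : R -> T -> nat) s t k : adapted F (real_process n) -> 0 <= s -> s < t ->
    measurable [set w | n t w = (n s w + k)%N].
  move=> ad s0 st; have := mincr _ _ _ [set (k%:R : R)] ad s0 st (measurable_set1 _).
  congr measurable; apply/seteqP; split=> w /=; rewrite /real_process.
    by move/eqP; rewrite subr_eq -natrD eqr_nat addnC => /eqP.
  by move=> ->; rewrite natrD addrC addKr.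
have adN := poisson_adapted hN.
exists N'; split=> //; last first.
  move=> w s t s0 st; rewrite /N'; have [//|wZ] := boolP (w \in Z).
  by move: wZ; rewrite notin_setE => /contrapT; exact.
split=> //.
- by apply: filterS (filterI aeN' (poisson_start hN)) => w [-> ->].
- apply: filterE => w s t s0 st; rewrite /N'; have [//|wZ] := boolP (w \in Z).
  by move: wZ; rewrite notin_setE => /contrapT; exact.
- apply: filterS (filterI aeN' (poisson_right_continuous hN)) => w [e].
  by rewrite (_ : real_process N' ^~ w = real_process N ^~ w)//; apply/funext => t; rewrite /real_process e.
- move=> s t k s0 st; rewrite -(poisson_law hN k s0 st).
  apply: (measure_eq_off_null mZ PZ); [exact: mlaw|exact: mlaw|].
  by move=> w nZ /=; rewrite !N'E.
- move=> s t s0 st A U FA mU.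
  have e w : ~ Z w -> real_process N' t w - real_process N' s w = real_process N t w - real_process N s w.
    by move=> nZ; rewrite /real_process !N'E.
  have mA : measurable A := filtration_measurable hF s0 FA.
  rewrite (measure_eq_off_null mZ PZ (B := A `&` (fun w => real_process N t w - real_process N s w) @^-1` U)); last 3 first.
  + by apply: measurableI => //; exact: mincr.
  + by apply: measurableI => //; exact: mincr.
  + by move=> w nZ /=; rewrite /preimage /= e.
  rewrite (poisson_independent hN s0 st FA mU); congr (_ * _)%E.
  apply: (measure_eq_off_null mZ PZ); [exact: mincr|exact: mincr|].
  by move=> w nZ /=; rewrite /preimage /= e.
Qed.

Lemma solution_modification (B : R -> T -> R) (N N' : R -> T -> nat) (f g h : R -> R) (y0 : R)
    (y : R -> T -> R) : (\forall w \ae P, forall t, N' t w = N t w) ->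
  positive_global_solution P F B N f g h y0 y -> positive_global_solution P F B N' f g h y0 y.
Proof.
move=> e [c1 c2 c3 c4 c5 [I [hI eqI]]]; split=> //; exists I; split=> //.
apply: filterS (filterI e eqI) => w [ew eqw].
have -> : real_process N' ^~ w = real_process N ^~ w.
  by apply/funext => s; rewrite /real_process ew.
exact: eqw.
Qed.
End poisson_modification.

Lemma measurable_inv {R : realType} : measurable_fun setT (fun x : R => x^-1).
Proof.
(* At 0 both sides vanish, the inverse of 0 being 0 by convention. *)
rewrite (_ : (fun x : R => x^-1) = fun x => x * (x ^+ 2) `^ (-1)).
  apply: measurable_funM => //.
  by apply: (measurableT_comp (@measurable_powR R (-1))); exact: measurable_funX.
apply/funext => x; rewrite powR_inv1 ?sqr_ge0// expr2; have [->|x0] := eqVneq x 0.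
  by rewrite invr0 mul0r.
by rewrite invfM mulrA divff// mul1r.
Qed.

Lemma cvg_lyapunov {R : realType} (p q e x : R) : 0 < e ->
  lyapunov p q (e / n.+1%:R) x @[n --> \oo] --> x `^ p.
Proof.
move=> e0; have d1 : damping q (e / n.+1%:R) x @[n --> \oo] --> (1 : R).
  rewrite -[X in _ --> X]addr0 -[X in _ + X](mul0r (x `^ q)) -[X in X * _](mulr0 e).
  apply: cvgD; first exact: cvg_cst.
  apply: cvgM; last exact: cvg_cst.
  by apply: cvgM; [exact: cvg_cst|exact: cvg_harmonic].
have := cvg_comp _ _ d1 (@continuous_powR R (- (p / q)) 1 ltr01); rewrite powR1 => d2.
by rewrite -[X in _ --> X]mulr1; apply: cvgM; [exact: cvg_cst|exact: d2].
Qed.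

Lemma lyapunov_nd {R : realType} (p q e x : R) : 0 < p -> 0 < q -> 0 < e ->
  {homo (fun n => lyapunov p q (e / n.+1%:R) x) : m n / (m <= n)%N >-> m <= n}.
Proof.
move=> p0 q0 e0 m n mn.
have d k : 0 < damping q (e / k.+1%:R) x.
  by rewrite ltr_pwDl// mulr_ge0 ?powR_ge0// divr_ge0// ltW.
rewrite ler_wpM2l ?powR_ge0// !powRN lef_pV2; [|rewrite posrE; exact: powR_gt0|rewrite posrE; exact: powR_gt0].
apply: ge0_ler_powR; rewrite ?nnegrE; [by rewrite divr_ge0// ltW|exact: ltW|exact: ltW|].
rewrite lerD2l ler_wpM2r ?powR_ge0// ler_pM2l// lef_pV2 ?posrE//.
by rewrite ler_nat ltnS.
Qed.

Theorem theorem3p1 (R : realType) (d : measure_display) (T : measurableType d)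
    (P : probability T R) (F : R -> set (set T))
    (hP : measure_is_complete P)
    (hF : filtration F) (hFu : usual_conditions P F)
    (B : R -> T -> R) (hB : brownian_motion P F B)
    (lambda : R) (hlambda : 0 < lambda)
    (N : R -> T -> nat) (hN : poisson_process P F lambda N)
    (am1 a0 a1 a2 b delta theta gamma y0 : R)
    (ham1 : 0 <= am1) (ha0 : 0 <= a0) (ha1 : 0 <= a1) (ha2 : 0 <= a2)
    (hb : 0 <= b) (hdelta : 0 <= delta)
    (htheta : 1 < theta) (hgamma : 1 < gamma) (hy0 : 0 < y0)
    (y : R -> T -> R)
    (hy : positive_global_solution P F B N
            (fun x => am1 * x^-1 - a0 + a1 * x - a2 * x `^ gamma)
            (fun x => b * x `^ theta)
            (fun x => delta * x)
            y0 y)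
    (p : R) (hp : 2 <= p)
    (hcond : (2 * theta < gamma + 1 /\ 0 < a2) \/
             (2 * theta = gamma + 1 /\ (p - 1) * b ^+ 2 / 2 < a2)) :
  exists K2 : R, forall t : R, 0 < t ->
    ('E_P[(fun w => (y t w `^ p)%R)] <= (y0 `^ p / expR t + K2)%:E)%E.
Proof.
have [N' [hN' Nmono aeN']] := poisson_modification hF hFu hN.
have {}hy := solution_modification aeN' hy.
have p0 : 0 < p by exact: lt_le_trans hp.
have q0 : 0 < gamma - 1 by rewrite subr_gt0.
(* The first summand bounds the jump part of the generator, the 1 produces the [- phi] behind the
   exponential decay. *)
pose L := lambda * (1 + delta) `^ p + 1.
have L0 : 0 < L by rewrite ltr_wpDl// mulr_ge0 ?powR_ge0// ltW.
have [kap [K [kap0 K0 hK]]] := dissipativity ham1 ha1 hb htheta hgamma hp (ltW L0) hcond.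
(* The largest parameter allowed by [lyapunov_generator]; all [e / n.+1] then share the same [K]. *)
pose e := kap / L.
have e0 : 0 < e by rewrite divr_gt0.
have gammaE : gamma = gamma - 1 + 1 by rewrite subrK.
exists K => t t0.
pose phi n := lyapunov p (gamma - 1) (e / n.+1%:R).
have en0 n : 0 < e / n.+1%:R by rewrite divr_gt0.
have cinv x : 0 < x -> {for x, continuous (fun x : R => x^-1)}.
  by move=> x0; apply: inv_continuous; rewrite gt_eqF.
have cf (x : R) : 0 < x -> {for x, continuous (fun x : R => am1 * x^-1 - a0 + a1 * x - a2 * x `^ gamma)}.
  move=> x0; apply: cvgB; last by apply: cvgM; [exact: cvg_cst|exact: continuous_powR].
  apply: cvgD; last by apply: cvgM; [exact: cvg_cst|exact: cvg_id].
  by apply: cvgB; [apply: cvgM; [exact: cvg_cst|exact: cinv]|exact: cvg_cst].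
have cg (x : R) : 0 < x -> {for x, continuous (fun x : R => b * x `^ theta)}.
  by move=> x0; apply: cvgM; [exact: cvg_cst|exact: continuous_powR].
have mf : measurable_fun setT (fun x : R => am1 * x^-1 - a0 + a1 * x - a2 * x `^ gamma).
  apply: measurable_funB; last by apply: measurable_funM => //; exact: measurable_powR.
  apply: measurable_funD; last exact: measurable_funM.
  by apply: measurable_funB => //; apply: measurable_funM => //; exact: measurable_inv.
have mg : measurable_fun setT (fun x : R => b * x `^ theta).
  by apply: measurable_funM => //; exact: measurable_powR.
have bound n : \int[P]_w phi n (y t w) <= expR (- t) * phi n y0 + K.
  have hLe : L * (e / n.+1%:R) <= kap.
    rewrite mulrA /e [L * _]mulrC divfK ?gt_eqF//.
    by rewrite ler_piMr ?(ltW kap0)// invf_le1 ?ler1n.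
  exact: (@lyapunov_expectation _ _ _ P F hF B lambda N' hB hlambda hN' Nmono (phi n)
    (lyapunov1 p (gamma - 1) (e / n.+1%:R)) (lyapunov2 p (gamma - 1) (e / n.+1%:R)) _ _ _ delta
    (lyapunov_bounded hp q0 (en0 n)) (is_derive_lyapunov p q0 (en0 n))
    (is_derive_lyapunov1 p q0 (en0 n)) (@continuous_lyapunov2 _ p (gamma - 1) _ (en0 n)) cf cg
    (@measurable_lyapunov _ _ _ _) (@measurable_lyapunov1 _ _ _ _) (@measurable_lyapunov2 _ _ _ _)
    mf mg hdelta y0 y K t hy K0 t0
    (lyapunov_generator hp q0 (en0 n) ha0 hdelta (ltW hlambda) K0 gammaE hLe hK)).
have mphi n : measurable_fun setT (fun w => phi n (y t w)).
  apply: (measurableT_comp (@measurable_lyapunov _ _ _ _)).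
  exact: (measurable_wrt_fun (filtration_measurable hF (ltW t0)) (solution_adapted hy (ltW t0))).
have phi0 n x : 0 <= phi n x by exact: lyapunov_ge0.
have boundE n : (\int[P]_w (phi n (y t w))%:E <= (y0 `^ p / expR t + K)%:E)%E.
  have iphi : P.-integrable setT (EFin \o (fun w => phi n (y t w))).
    apply: (@bounded_integrable _ _ _ P _ ((e / n.+1%:R)^-1 `^ (p / (gamma - 1)))) => // w.
    by have /andP[_ h] := lyapunov_bounded hp q0 (en0 n) (y t w); rewrite ger0_norm.
  rewrite -[leLHS]fineK ?(integrable_fin_num _ iphi)// lee_fin; apply: le_trans (bound n) _.
  rewrite lerD2r mulrC -expRN ler_wpM2r ?expR_ge0//; exact: lyapunov_le.
have lim_phi w : (phi n (y t w))%:E @[n --> \oo] --> (y t w `^ p)%:E.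
  by apply: cvg_EFin; [exact: nearW|exact: cvg_lyapunov].
rewrite unlock.
(* The truncations increase to the [p]-th power, so monotone convergence passes the uniform bound to
   the limit and also shows that the moment is finite. *)
rewrite (eq_integral (fun w => limn (fun n => (phi n (y t w))%:E))); last first.
  by move=> w _; rewrite (cvg_lim _ (lim_phi w)).
have mc : (\int[P]_w (phi n (y t w))%:E @[n --> \oo] -->
    \int[P]_w limn (fun n => (phi n (y t w))%:E))%E.
  apply: (@cvg_monotone_convergence _ _ _ P setT measurableT (fun n w => (phi n (y t w))%:E)).
  - by move=> n; apply/measurable_EFinP.
  - by move=> n w _; rewrite lee_fin.
  - by move=> w _ m n mn; rewrite lee_fin lyapunov_nd.
rewrite -(cvg_lim _ mc)//; apply: lime_le; first by apply/cvg_ex; eexists; exact: mc.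
by apply: nearW => n; exact: boundE.
Qed.
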